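(* Let $X$ and $Y$ be two finite posets. For $y\in Y$ write $[y,\cdot]=\{y'\in Y : y'\ge y\}$ and $[\cdot,y]=\{y'\in Y: y'\le y\}$. Let $\{Y_x\}_{x\in X}$ be a collection of subsets of $Y$ indexed by the elements of $X$ such that $$[y,\cdot]\cap[y',\cdot]=\emptyset\quad\text{and}\quad[\cdot,y]\cap[\cdot,y']=\emptyset$$ for any $x\in X$ and any $y\ne y'$ in $Y_x$. Assume in addition that for any $x\le x'$ in $X$ there exists an isomorphism $\varphi_{x,x'}:Y_x\xrightarrow{\sim}Y_{x'}$ such that $y\le\varphi_{x,x'}(y)$ for all $y\in Y_x$. Define two partial orders $\le_+$ and $\le_-$ on the disjoint union $X\sqcup Y$ as follows: inside $X$ and inside $Y$ both agree with the original orders, and for $x\in X$, $y\in Y$, $$x\le_+ y\iff\exists\,y_x\in Y_x\text{ with }y_x\le y,\qquad y\le_- x\iff\exists\,y_x\in Y_x\text{ with }y\le y_x,$$ with no other relations. Then the two posets $(X\sqcup Y,\le_+)$ and $(X\sqcup Y,\le_-)$ are universally derived equivalent.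
   Context: For a poset $P$ (viewed as a small category with a unique morphism $p\to p'$ if $p\le p'$ and none otherwise) and a category $\mathcal{A}$, $\mathcal{A}^P$ denotes the category of functors $P\to\mathcal{A}$ (diagrams over $P$ with values in $\mathcal{A}$). If $\mathcal{A}$ is abelian, so is $\mathcal{A}^P$, and $D(\mathcal{A}^P)$ denotes its (unbounded) derived category, obtained from the category of complexes over $\mathcal{A}^P$ by formally inverting quasi-isomorphisms, with its standard triangulated structure. Two posets $P$ and $Q$ are universally derived equivalent if for every abelian category $\mathcal{A}$ the derived categories $D(\mathcal{A}^P)$ and $D(\mathcal{A}^Q)$ are equivalent as triangulated categories. The isomorphisms $\varphi_{x,x'}$ are isomorphisms of posets, with $Y_x,Y_{x'}$ carrying the order induced from $Y$. *)

(* Defs.v *)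
From HB Require Import structures.
From mathcomp Require Import all_boot order ssralg ssrint generic_quotient.
From mathcomp Require Import boolp.
Set Implicit Arguments.
Unset Strict Implicit.
Unset Printing Implicit Defensive.
Import Order.TTheory GRing.Theory.
Local Open Scope ring_scope.
#[local] Obligation Tactic := idtac.

Reserved Notation "g \co f" (at level 40, left associativity).

Record category := Category {
  obj :> Type;
  hom : obj -> obj -> Type;
  idc : forall X, hom X X;
  comp : forall X Y Z, hom Y Z -> hom X Y -> hom X Z;
  comp1c : forall X Y (f : hom X Y), comp (idc Y) f = f;
  compc1 : forall X Y (f : hom X Y), comp f (idc X) = f;
  compA : forall X Y Z T (h : hom Z T) (g : hom Y Z) (f : hom X Y),
    comp h (comp g f) = comp (comp h g) f
}.
Arguments hom {c} X Y.
Arguments idc {c} X.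
Arguments comp {c X Y Z} g f.
Notation "g \co f" := (comp g f).

Section Morphisms.
Context {C : category}.

Definition is_iso (X Y : C) (f : hom X Y) : Prop :=
  exists g : hom Y X, g \co f = idc X /\ f \co g = idc Y.

Definition is_mono (X Y : C) (f : hom X Y) : Prop :=
  forall T (g h : hom T X), f \co g = f \co h -> g = h.

Definition is_epi (X Y : C) (f : hom X Y) : Prop :=
  forall T (g h : hom Y T), g \co f = h \co f -> g = h.

Lemma is_iso_comp (X Y Z : C) (g : hom Y Z) (f : hom X Y) :
  is_iso g -> is_iso f -> is_iso (g \co f).
Proof.
move=> [g' [g'g gg']] [f' [f'f ff']]; exists (f' \co g'); split.
  by rewrite compA -(compA f') g'g compc1.
by rewrite compA -(compA g) ff' compc1.
Qed.

End Morphisms.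

Record functor (C D : category) := Functor {
  fobj :> C -> D;
  fmap : forall X Y : C, hom X Y -> hom (fobj X) (fobj Y);
  fmap1 : forall X, fmap (idc X) = idc (fobj X);
  fmapM : forall X Y Z (g : hom Y Z) (f : hom X Y),
    fmap (g \co f) = fmap g \co fmap f
}.
Arguments fmap {C D} F {X Y} f : rename.

Program Definition id_functor (C : category) : functor C C :=
  @Functor C C (fun X => X) (fun _ _ f => f) _ _.
Next Obligation. by []. Qed.
Next Obligation. by []. Qed.

Program Definition comp_functor (C D E : category)
    (G : functor D E) (F : functor C D) : functor C E :=
  @Functor C E (fun X => G (F X)) (fun _ _ f => fmap G (fmap F f)) _ _.
Next Obligation. by move=> * /=; rewrite !fmap1. Qed.
Next Obligation. by move=> * /=; rewrite !fmapM. Qed.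

Record nat_trans (C D : category) (F G : functor C D) := NatTrans {
  component :> forall X, hom (F X) (G X);
  naturality : forall X Y (f : hom X Y),
    component Y \co fmap F f = fmap G f \co component X
}.

Arguments NatTrans {C D F G} component naturality.

Lemma nat_transP (C D : category) (F G : functor C D) (a b : nat_trans F G) :
  (forall X, a X = b X) -> a = b.
Proof.
case: a b => [a an] [b bn] /= ab.
have E : a = b by apply: functional_extensionality_dep.
by subst b; congr NatTrans; apply: Prop_irrelevance.
Qed.

Definition naturally_isomorphic (C D : category) (F G : functor C D) : Prop :=
  exists a : nat_trans F G, forall X, is_iso (a X).

Definition is_equivalence (C D : category) (F : functor C D) : Prop :=
  exists G : functor D C,
    naturally_isomorphic (comp_functor G F) (id_functor C) /\
    naturally_isomorphic (comp_functor F G) (id_functor D).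

Section FunctorCategory.
Variables C D : category.
Implicit Types F G H : functor C D.

Program Definition nt_id F : nat_trans F F := NatTrans (fun X => idc (F X)) _.
Next Obligation. by move=> * /=; rewrite comp1c compc1. Qed.

Program Definition nt_comp F G H (b : nat_trans G H) (a : nat_trans F G) :
  nat_trans F H := NatTrans (fun X => b X \co a X) _.
Next Obligation.
by move=> F G H b a X Y f /=; rewrite -compA naturality !compA naturality.
Qed.

Program Definition functor_cat : category :=
  @Category (functor C D) (@nat_trans C D) nt_id nt_comp _ _ _.
Next Obligation. by move=> *; apply: nat_transP => X /=; rewrite comp1c. Qed.
Next Obligation. by move=> *; apply: nat_transP => X /=; rewrite compc1. Qed.
Next Obligation. by move=> *; apply: nat_transP => X /=; rewrite compA. Qed.

End FunctorCategory.

Definition hom_group (C : category)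
    (m : forall X Y : C, GRing.Zmodule.axioms_ (hom X Y)) (X Y : C) : zmodType :=
  GRing.Zmodule.Pack (m X Y).

Record preadditive := Preadditive {
  pa_cat :> category;
  pa_zmod : forall X Y : pa_cat, GRing.Zmodule.axioms_ (hom X Y);
  pa_compDl : forall (X Y Z : pa_cat) (f : hom X Y),
    {morph (fun g : hom_group pa_zmod Y Z => g \co f : hom_group pa_zmod X Z)
      : g h / g + h};
  pa_compDr : forall (X Y Z : pa_cat) (g : hom Y Z),
    {morph (fun f : hom_group pa_zmod X Y => g \co f : hom_group pa_zmod X Z)
      : f h / f + h}
}.

HB.instance Definition _ (A : preadditive) (X Y : A) :
  GRing.Zmodule.axioms_ (hom X Y) := pa_zmod X Y.

Section PreadditiveTheory.
Context {A : preadditive}.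
Implicit Types X Y Z : A.

Lemma compDl X Y Z (g h : hom Y Z) (f : hom X Y) :
  (g + h) \co f = g \co f + h \co f.
Proof. exact: pa_compDl. Qed.

Lemma compDr X Y Z (g : hom Y Z) (f h : hom X Y) :
  g \co (f + h) = g \co f + g \co h.
Proof. exact: pa_compDr. Qed.

Lemma comp0c X Y Z (f : hom X Y) : (0 : hom Y Z) \co f = 0.
Proof. by apply: (addrI ((0 : hom Y Z) \co f)); rewrite -compDl !addr0. Qed.

Lemma compc0 X Y Z (g : hom Y Z) : g \co (0 : hom X Y) = 0.
Proof. by apply: (addrI (g \co (0 : hom X Y))); rewrite -compDr !addr0. Qed.

Lemma compNl X Y Z (g : hom Y Z) (f : hom X Y) : (- g) \co f = - (g \co f).
Proof. by apply: (addrI (g \co f)); rewrite -compDl !subrr comp0c. Qed.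

Lemma compNr X Y Z (g : hom Y Z) (f : hom X Y) : g \co (- f) = - (g \co f).
Proof. by apply: (addrI (g \co f)); rewrite -compDr !subrr compc0. Qed.

Definition is_zero_object Z : Prop :=
  forall X, (forall f g : hom X Z, f = g) /\ (forall f g : hom Z X, f = g).

Definition is_kernel X Y K (f : hom X Y) (k : hom K X) : Prop :=
  f \co k = 0 /\
  forall T (t : hom T X), f \co t = 0 -> exists! u : hom T K, k \co u = t.

Definition is_cokernel X Y Q (f : hom X Y) (q : hom Y Q) : Prop :=
  q \co f = 0 /\
  forall T (t : hom Y T), t \co f = 0 -> exists! u : hom Q T, u \co q = t.

Record kernel X Y (f : hom X Y) := Kernel {
  ker_obj :> A;
  ker_map : hom ker_obj X;
  ker_mapP : is_kernel f ker_map
}.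

Record cokernel X Y (f : hom X Y) := Cokernel {
  coker_obj :> A;
  coker_map : hom Y coker_obj;
  coker_mapP : is_cokernel f coker_map
}.

Record biproduct X Y := Biproduct {
  bip_obj :> A;
  inj1 : hom X bip_obj;
  inj2 : hom Y bip_obj;
  prj1 : hom bip_obj X;
  prj2 : hom bip_obj Y;
  prj1_inj1 : prj1 \co inj1 = idc X;
  prj2_inj2 : prj2 \co inj2 = idc Y;
  prj1_inj2 : prj1 \co inj2 = 0;
  prj2_inj1 : prj2 \co inj1 = 0;
  bip_id : inj1 \co prj1 + inj2 \co prj2 = idc bip_obj
}.

Lemma kernel_mono X Y K (f : hom X Y) (k : hom K X) : is_kernel f k -> is_mono k.
Proof.
move=> [fk kP] T g h e; have [|u [_ uniq]] := kP T (k \co h).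
  by rewrite compA fk comp0c.
by rewrite -(uniq g e) -(uniq h).
Qed.

Lemma cokernel_epi X Y Q (f : hom X Y) (q : hom Y Q) : is_cokernel f q -> is_epi q.
Proof.
move=> [qf qP] T g h e; have [|u [_ uniq]] := qP T (h \co q).
  by rewrite -compA qf compc0.
by rewrite -(uniq g e) -(uniq h).
Qed.

Section Lifts.
Variables (X Y : A) (f : hom X Y).

Definition ker_lift (K : kernel f) T (t : hom T X) (ft : f \co t = 0) :
  hom T K := sval (cid ((ker_mapP K).2 T t ft)).

Lemma ker_liftK (K : kernel f) T (t : hom T X) (ft : f \co t = 0) :
  ker_map K \co ker_lift K ft = t.
Proof. by rewrite /ker_lift; case: cid => u []. Qed.

Lemma ker_inj (K : kernel f) : is_mono (ker_map K).
Proof. exact: kernel_mono (ker_mapP K). Qed.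

Definition coker_desc (Q : cokernel f) T (t : hom Y T) (tf : t \co f = 0) :
  hom Q T := sval (cid ((coker_mapP Q).2 T t tf)).

Lemma coker_descK (Q : cokernel f) T (t : hom Y T) (tf : t \co f = 0) :
  coker_desc Q tf \co coker_map Q = t.
Proof. by rewrite /coker_desc; case: cid => u []. Qed.

Lemma coker_surj (Q : cokernel f) : is_epi (coker_map Q).
Proof. exact: cokernel_epi (coker_mapP Q). Qed.

End Lifts.
End PreadditiveTheory.

Record abelian := Abelian {
  ab_pa :> preadditive;
  zero_obj : ab_pa;
  zero_objP : is_zero_object zero_obj;
  bip : forall X Y : ab_pa, biproduct X Y;
  ker : forall (X Y : ab_pa) (f : hom X Y), kernel f;
  coker : forall (X Y : ab_pa) (f : hom X Y), cokernel f;
  mono_normal : forall (X Y : ab_pa) (f : hom X Y),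
    is_mono f -> exists Z (g : hom Y Z), is_kernel g f;
  epi_normal : forall (X Y : ab_pa) (f : hom X Y),
    is_epi f -> exists Z (g : hom Z X), is_cokernel g f
}.
Arguments bip {a} X Y.
Arguments ker {a X Y} f.
Arguments coker {a X Y} f.

Section AbelianTheory.
Context {A : abelian}.

Lemma mono_ker_coker (X Y : A) (f : hom X Y) :
  is_mono f -> is_kernel (coker_map (coker f)) f.
Proof.
move=> mf; have [Z [g [gf gP]]] := mono_normal mf; split.
  exact: (coker_mapP (coker f)).1.
move=> T t qt; have gt : g \co t = 0.
  by rewrite -(coker_descK (coker f) gf) -compA qt compc0.
exact: gP.
Qed.

Lemma epi_coker_ker (X Y : A) (f : hom X Y) :
  is_epi f -> is_cokernel (ker_map (ker f)) f.
Proof.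
move=> ef; have [Z [g [fg gP]]] := epi_normal ef; split.
  exact: (ker_mapP (ker f)).1.
move=> T t tk; have tg : t \co g = 0.
  by rewrite -(ker_liftK (ker f) fg) compA tk comp0c.
exact: gP.
Qed.

End AbelianTheory.

HB.instance Definition _ (C D : category) (F G : functor C D) :=
  gen_eqMixin (nat_trans F G).
HB.instance Definition _ (C D : category) (F G : functor C D) :=
  gen_choiceMixin (nat_trans F G).

Section FunctorPreadditive.
Variables (C : category) (A : preadditive).
Implicit Types F G H : functor C A.

Program Definition nt_zero F G : nat_trans F G := NatTrans (fun X => 0) _.
Next Obligation. by move=> * /=; rewrite comp0c compc0. Qed.

Program Definition nt_opp F G (a : nat_trans F G) : nat_trans F G :=
  NatTrans (fun X => - a X) _.
Next Obligation. by move=> * /=; rewrite compNl compNr naturality. Qed.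

Program Definition nt_add F G (a b : nat_trans F G) : nat_trans F G :=
  NatTrans (fun X => a X + b X) _.
Next Obligation. by move=> * /=; rewrite compDl compDr !naturality. Qed.

Fact nt_addA F G : associative (@nt_add F G).
Proof. by move=> *; apply: nat_transP => X /=; rewrite addrA. Qed.
Fact nt_addC F G : commutative (@nt_add F G).
Proof. by move=> *; apply: nat_transP => X /=; rewrite addrC. Qed.
Fact nt_add0 F G : left_id (nt_zero F G) (@nt_add F G).
Proof. by move=> *; apply: nat_transP => X /=; rewrite add0r. Qed.
Fact nt_addN F G : left_inverse (nt_zero F G) (@nt_opp F G) (@nt_add F G).
Proof. by move=> *; apply: nat_transP => X /=; rewrite addNr. Qed.

HB.instance Definition _ F G := GRing.isZmodule.Build (nat_trans F G)
  (@nt_addA F G) (@nt_addC F G) (@nt_add0 F G) (@nt_addN F G).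

Program Definition functor_preadditive : preadditive :=
  @Preadditive (functor_cat C A) (fun F G => GRing.Zmodule.class (nat_trans F G)) _ _.
Next Obligation. by move=> F G H a b c; apply: nat_transP => X; exact: compDl. Qed.
Next Obligation. by move=> F G H a b c; apply: nat_transP => X; exact: compDr. Qed.

End FunctorPreadditive.
Section BiproductTheory.
Context {A : preadditive} {X Y : A} (B : biproduct X Y).

Lemma prj1_inj1K (T : A) (t : hom T X) : prj1 B \co (inj1 B \co t) = t.
Proof. by rewrite compA prj1_inj1 comp1c. Qed.
Lemma prj2_inj2K (T : A) (t : hom T Y) : prj2 B \co (inj2 B \co t) = t.
Proof. by rewrite compA prj2_inj2 comp1c. Qed.
Lemma prj1_inj2K (T : A) (t : hom T Y) : prj1 B \co (inj2 B \co t) = 0.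
Proof. by rewrite compA prj1_inj2 comp0c. Qed.
Lemma prj2_inj1K (T : A) (t : hom T X) : prj2 B \co (inj1 B \co t) = 0.
Proof. by rewrite compA prj2_inj1 comp0c. Qed.

Definition bipE := (prj1_inj1 B, prj2_inj2 B, prj1_inj2 B, prj2_inj1 B,
  prj1_inj1K, prj2_inj2K, prj1_inj2K, prj2_inj1K).

End BiproductTheory.

Section FunctorAbelian.
Variables (C : category) (A : abelian).
Implicit Types F G H K : functor C A.
Local Notation FA := (functor_preadditive C A).

Lemma nt_compE F G H (g : hom (G : FA) H) (f : hom (F : FA) G) X :
  (g \co f : nat_trans F H) X = (g : nat_trans G H) X \co (f : nat_trans F G) X.
Proof. by []. Qed.

Lemma pointwise_kernel F G K (f : nat_trans F G) (k : nat_trans K F) :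
  (forall X, is_kernel (f X) (k X)) -> @is_kernel FA F G K f k.
Proof.
move=> kP; split; first by apply: nat_transP => X; apply: (kP X).1.
move=> T t ft; have ftX X : f X \co (t : nat_trans T F) X = 0.
  by rewrite -(nt_compE (f : hom (F : FA) G)) ft.
pose u X := sval (cid ((kP X).2 _ _ (ftX X))).
have uE X : k X \co u X = (t : nat_trans T F) X by rewrite /u; case: cid => v [].
have uN X Y (h : hom X Y) : u Y \co fmap (T : functor C A) h = fmap K h \co u X.
  apply: (kernel_mono (kP Y)); rewrite compA uE naturality -uE compA.
  by rewrite -naturality compA.
exists (NatTrans u uN : nat_trans T K); split.
  by apply: nat_transP => X; apply: uE.
move=> v kv; apply: nat_transP => X; apply: (kernel_mono (kP X)).
by rewrite /= uE -kv.
Qed.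

Lemma pointwise_cokernel F G Q (f : nat_trans F G) (q : nat_trans G Q) :
  (forall X, is_cokernel (f X) (q X)) -> @is_cokernel FA F G Q f q.
Proof.
move=> qP; split; first by apply: nat_transP => X; apply: (qP X).1.
move=> T t tf; have tfX X : (t : nat_trans G T) X \co f X = 0.
  by rewrite -(nt_compE _ (f : hom (F : FA) G)) tf.
pose u X := sval (cid ((qP X).2 _ _ (tfX X))).
have uE X : u X \co q X = (t : nat_trans G T) X by rewrite /u; case: cid => v [].
have uN X Y (h : hom X Y) : u Y \co fmap Q h = fmap (T : functor C A) h \co u X.
  apply: (cokernel_epi (qP X)); rewrite -compA -naturality compA uE naturality.
  by rewrite -uE compA.
exists (NatTrans u uN : nat_trans Q T); split.
  by apply: nat_transP => X; apply: uE.
move=> v vq; apply: nat_transP => X; apply: (cokernel_epi (qP X)).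
by rewrite /= uE -vq.
Qed.

Section KernelFunctor.
Variables (F G : functor C A) (f : nat_trans F G).

Fact fun_ker_subproof X Y (h : hom X Y) :
  f Y \co (fmap F h \co ker_map (ker (f X))) = 0.
Proof. by rewrite compA naturality -compA (ker_mapP _).1 compc0. Qed.

Program Definition fun_ker_obj : functor C A :=
  Functor (fobj := fun X => ker (f X))
    (fmap := fun X Y h => ker_lift (ker (f Y)) (fun_ker_subproof h)) _ _.
Next Obligation. by move=> X; apply: ker_inj; rewrite ker_liftK fmap1 comp1c compc1. Qed.
Next Obligation.
move=> X Y Z g h; apply: ker_inj.
by rewrite ker_liftK fmapM compA ker_liftK -!compA ker_liftK.
Qed.

Program Definition fun_ker_map : nat_trans fun_ker_obj F :=
  NatTrans (fun X => ker_map (ker (f X))) _.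
Next Obligation. by move=> X Y h; rewrite /= ker_liftK. Qed.

Definition fun_ker : @kernel FA F G f :=
  @Kernel FA F G f fun_ker_obj fun_ker_map
    (pointwise_kernel (k := fun_ker_map) (fun X => ker_mapP (ker (f X)))).

Fact fun_coker_subproof X Y (h : hom X Y) :
  (coker_map (coker (f Y)) \co fmap G h) \co f X = 0.
Proof. by rewrite -compA -naturality compA (coker_mapP _).1 comp0c. Qed.

Program Definition fun_coker_obj : functor C A :=
  Functor (fobj := fun X => coker (f X))
    (fmap := fun X Y h => coker_desc (coker (f X)) (fun_coker_subproof h)) _ _.
Next Obligation.
by move=> X; apply: coker_surj; rewrite coker_descK fmap1 comp1c compc1.
Qed.
Next Obligation.
move=> X Y Z g h; apply: coker_surj.
by rewrite coker_descK fmapM -compA coker_descK !compA coker_descK.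
Qed.

Program Definition fun_coker_map : nat_trans G fun_coker_obj :=
  NatTrans (fun X => coker_map (coker (f X))) _.
Next Obligation. by move=> X Y h; rewrite /= coker_descK. Qed.

Definition fun_coker : @cokernel FA F G f :=
  @Cokernel FA F G f fun_coker_obj fun_coker_map
    (pointwise_cokernel (q := fun_coker_map) (fun X => coker_mapP (coker (f X)))).

End KernelFunctor.

Lemma mono_pointwise F G (f : nat_trans F G) X :
  @is_mono FA F G f -> is_mono (f X).
Proof.
move=> mf; have k0 : (ker_map (fun_ker f) : nat_trans (fun_ker_obj f) F) X = 0.
  suff -> : ker_map (fun_ker f) = 0 by [].
  by apply: mf; rewrite (ker_mapP (fun_ker f)).1 compc0.
move=> T g h e; apply/eqP; rewrite -subr_eq0; apply/eqP.
have e0 : f X \co (g - h) = 0 by rewrite compDr compNr e subrr.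
by rewrite -(ker_liftK (ker (f X)) e0) [ker_map _]k0 comp0c.
Qed.

Lemma epi_pointwise F G (f : nat_trans F G) X :
  @is_epi FA F G f -> is_epi (f X).
Proof.
move=> ef; have q0 : (coker_map (fun_coker f) : nat_trans G (fun_coker_obj f)) X = 0.
  suff -> : coker_map (fun_coker f) = 0 by [].
  by apply: ef; rewrite (coker_mapP (fun_coker f)).1 comp0c.
move=> T g h e; apply/eqP; rewrite -subr_eq0; apply/eqP.
have e0 : (g - h) \co f X = 0 by rewrite compDl compNl e subrr.
by rewrite -(coker_descK (coker (f X)) e0) [coker_map _]q0 compc0.
Qed.

Program Definition fun_zero : functor C A :=
  Functor (fobj := fun=> zero_obj A) (fmap := fun _ _ _ => idc (zero_obj A)) _ _.
Next Obligation. by []. Qed.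
Next Obligation. by move=> * /=; rewrite comp1c. Qed.

Section BiproductFunctor.
Variables F G : functor C A.
Let B X := bip (F X) (G X).

Program Definition fun_bip_obj : functor C A :=
  Functor (fobj := fun X => B X)
    (fmap := fun X Y h =>
       inj1 (B Y) \co fmap F h \co prj1 (B X) +
       inj2 (B Y) \co fmap G h \co prj2 (B X)) _ _.
Next Obligation. by move=> X /=; rewrite !fmap1 !compc1 bip_id. Qed.
Next Obligation.
move=> X Y Z g f /=; rewrite !fmapM !compDl !compDr -!compA !bipE.
by rewrite !compc0 addr0 add0r.
Qed.

Program Definition fun_bip : @biproduct FA F G :=
  @Biproduct FA F G fun_bip_obj
    (NatTrans (F := F) (G := fun_bip_obj) (fun X => inj1 (B X)) _)
    (NatTrans (F := G) (G := fun_bip_obj) (fun X => inj2 (B X)) _)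
    (NatTrans (F := fun_bip_obj) (G := F) (fun X => prj1 (B X)) _)
    (NatTrans (F := fun_bip_obj) (G := G) (fun X => prj2 (B X)) _)
    _ _ _ _ _.
Next Obligation. by move=> X Y h /=; rewrite compDl -!compA !bipE !compc0 compc1 addr0. Qed.
Next Obligation. by move=> X Y h /=; rewrite compDl -!compA !bipE !compc0 compc1 add0r. Qed.
Next Obligation. by move=> X Y h /=; rewrite compDr -!compA !bipE addr0. Qed.
Next Obligation. by move=> X Y h /=; rewrite compDr -!compA !bipE add0r. Qed.
Next Obligation. by apply: nat_transP => X; apply: prj1_inj1. Qed.
Next Obligation. by apply: nat_transP => X; apply: prj2_inj2. Qed.
Next Obligation. by apply: nat_transP => X; apply: prj1_inj2. Qed.
Next Obligation. by apply: nat_transP => X; apply: prj2_inj1. Qed.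
Next Obligation. by apply: nat_transP => X; apply: bip_id. Qed.

End BiproductFunctor.

Program Definition functor_abelian : abelian :=
  @Abelian FA fun_zero _ fun_bip fun_ker fun_coker _ _.
Next Obligation.
by move=> F; split=> f g; apply: nat_transP => X; case: (zero_objP (F X)) => ? ?.
Qed.
Next Obligation.
move=> F G f mf; exists (fun_coker_obj f), (fun_coker_map f).
by apply: pointwise_kernel => X; apply/mono_ker_coker/mono_pointwise.
Qed.
Next Obligation.
move=> F G f ef; exists (fun_ker_obj f), (fun_ker_map f).
by apply: pointwise_cokernel => X; apply/epi_coker_ker/epi_pointwise.
Qed.

End FunctorAbelian.

Program Definition poset_cat d (P : porderType d) : category :=
  @Category P (fun p q => (p <= q)%O) _ _ _ _ _.
Next Obligation. by move=> d P p; apply: lexx. Qed.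
Next Obligation. by move=> d P p q r qr pq; apply: le_trans pq qr. Qed.
Next Obligation. by move=> *; apply: bool_irrelevance. Qed.
Next Obligation. by move=> *; apply: bool_irrelevance. Qed.
Next Obligation. by move=> *; apply: bool_irrelevance. Qed.

Definition diagrams (A : abelian) d (P : porderType d) : abelian :=
  functor_abelian (poset_cat P) A.

Section Complexes.
Variable A : preadditive.

Record complex := Complex {
  cx :> int -> A;
  cd : forall n, hom (cx n) (cx (n + 1));
  cdd : forall n, cd (n + 1) \co cd n = 0
}.

Record chain_map (K L : complex) := ChainMap {
  cmap :> forall n, hom (K n) (L n);
  cmap_cd : forall n, cmap (n + 1) \co cd K n = cd L n \co cmap n
}.

Lemma chain_mapP K L (f g : chain_map K L) : (forall n, f n = g n) -> f = g.
Proof.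
case: f g => [f fd] [g gd] /= fg.
have E : f = g by apply: functional_extensionality_dep.
by subst g; congr ChainMap; apply: Prop_irrelevance.
Qed.

Program Definition cm_id K : chain_map K K := ChainMap (cmap := fun n => idc (K n)) _.
Next Obligation. by move=> *; rewrite comp1c compc1. Qed.

Program Definition cm_comp K L M (g : chain_map L M) (f : chain_map K L) :
  chain_map K M := ChainMap (cmap := fun n => g n \co f n) _.
Next Obligation. by move=> * /=; rewrite -compA cmap_cd !compA cmap_cd. Qed.

Program Definition complex_cat : category :=
  @Category complex chain_map cm_id cm_comp _ _ _.
Next Obligation. by move=> *; apply: chain_mapP => n /=; rewrite comp1c. Qed.
Next Obligation. by move=> *; apply: chain_mapP => n /=; rewrite compc1. Qed.
Next Obligation. by move=> *; apply: chain_mapP => n /=; rewrite compA. Qed.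

Program Definition shift_obj (K : complex) : complex :=
  Complex (cx := fun n => K (n + 1)) (cd := fun n => - cd K (n + 1)) _.
Next Obligation. by move=> *; rewrite compNl compNr cdd !oppr0. Qed.

Program Definition shift_map K L (f : chain_map K L) :
    chain_map (shift_obj K) (shift_obj L) :=
  ChainMap (cmap := fun n => f (n + 1)) _.
Next Obligation. by move=> * /=; rewrite compNl compNr cmap_cd. Qed.

Program Definition complex_shift : functor complex_cat complex_cat :=
  @Functor complex_cat complex_cat shift_obj shift_map _ _.
Next Obligation. by move=> *; apply: chain_mapP. Qed.
Next Obligation. by move=> *; apply: chain_mapP. Qed.

End Complexes.

Section Homology.
Variable A : abelian.

Section Map.
Variables (X Y Z X' Y' Z' : A).
Variables (a : hom X Y) (b : hom Y Z) (ba : b \co a = 0).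
Variables (a' : hom X' Y') (b' : hom Y' Z') (ba' : b' \co a' = 0).
Variables (x : hom X X') (y : hom Y Y') (z : hom Z Z').
Hypotheses (ya : y \co a = a' \co x) (zb : z \co b = b' \co y).

Definition homology : cokernel (ker_lift (ker b) ba) := coker _.

Fact cycles_map_subproof : b' \co (y \co ker_map (ker b)) = 0.
Proof. by rewrite compA -zb -compA (ker_mapP _).1 compc0. Qed.

Definition cycles_map : hom (ker b) (ker b') :=
  ker_lift (ker b') cycles_map_subproof.

Fact homology_map_subproof :
  (coker_map (coker (ker_lift (ker b') ba')) \co cycles_map)
    \co ker_lift (ker b) ba = 0.
Proof.
have e : cycles_map \co ker_lift (ker b) ba = ker_lift (ker b') ba' \co x.
  by apply: ker_inj; rewrite !compA !ker_liftK -compA ker_liftK.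
by rewrite -compA e compA (coker_mapP _).1 comp0c.
Qed.

Definition homology_map : hom homology (coker (ker_lift (ker b') ba')) :=
  coker_desc homology homology_map_subproof.

End Map.

Lemma homology_mapM X Y Z X' Y' Z' X'' Y'' Z''
    (a : hom X Y) (b : hom Y Z) (ba : b \co a = 0)
    (a' : hom X' Y') (b' : hom Y' Z') (ba' : b' \co a' = 0)
    (a'' : hom X'' Y'') (b'' : hom Y'' Z'') (ba'' : b'' \co a'' = 0)
    (x : hom X X') (y : hom Y Y') (z : hom Z Z')
    (ya : y \co a = a' \co x) (zb : z \co b = b' \co y)
    (x' : hom X' X'') (y' : hom Y' Y'') (z' : hom Z' Z'')
    (ya' : y' \co a' = a'' \co x') (zb' : z' \co b' = b'' \co y')
    (x'' : hom X X'') (y'' : hom Y Y'') (z'' : hom Z Z'')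
    (ya'' : y'' \co a = a'' \co x'') (zb'' : z'' \co b = b'' \co y'') :
  y'' = y' \co y ->
  homology_map ba ba'' ya'' zb'' =
  homology_map ba' ba'' ya' zb' \co homology_map ba ba' ya zb.
Proof.
move=> e; apply: coker_surj; rewrite coker_descK -compA coker_descK compA.
rewrite coker_descK -compA; congr (_ \co _); apply: ker_inj.
by rewrite compA !ker_liftK -compA ker_liftK compA e.
Qed.

Lemma homology_map1 X Y Z (a : hom X Y) (b : hom Y Z) (ba : b \co a = 0)
    (x : hom X X) (y : hom Y Y) (z : hom Z Z)
    (ya : y \co a = a \co x) (zb : z \co b = b \co y) :
  y = idc Y -> homology_map ba ba ya zb = idc (homology ba).
Proof.
move=> e; apply: coker_surj; rewrite coker_descK comp1c -[RHS]compc1.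
by congr (_ \co _); apply: ker_inj; rewrite ker_liftK e compc1 comp1c.
Qed.

(* The degree is n + 1, so that the incoming differential need not be
   transported along n - 1 + 1 = n; every degree is of this form. *)
Definition Hobj (K : complex A) (n : int) : A := homology (cdd K n).

Definition Hmap (K L : complex A) (f : chain_map K L) (n : int) :
    hom (Hobj K n) (Hobj L n) :=
  homology_map (cdd K n) (cdd L n) (cmap_cd f n) (cmap_cd f (n + 1)).

Definition quasi_iso (K L : complex_cat A) (f : hom K L) : Prop :=
  forall n, is_iso (Hmap f n).

Section ShiftHomology.
Variables (K : complex A) (n : int).

Fact shift_hlg_sq1 m : idc (K (m + 1 + 1)) \co - cd K (m + 1) =
  cd K (m + 1) \co - idc (K (m + 1)).
Proof. by rewrite comp1c compNr compc1. Qed.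

Fact shift_hlg_sq2 m : - idc (K (m + 1 + 1)) \co - cd K (m + 1) =
  cd K (m + 1) \co idc (K (m + 1)).
Proof. by rewrite compNr compNl opprK comp1c compc1. Qed.

Fact shift_hlg_sq3 m : idc (K (m + 1 + 1)) \co cd K (m + 1) =
  - cd K (m + 1) \co - idc (K (m + 1)).
Proof. by rewrite comp1c compNr compNl opprK compc1. Qed.

Fact shift_hlg_sq4 m : - idc (K (m + 1 + 1)) \co cd K (m + 1) =
  - cd K (m + 1) \co idc (K (m + 1)).
Proof. by rewrite !compNl comp1c compc1. Qed.

Definition shift_hlg : hom (Hobj (shift_obj K) n) (Hobj K (n + 1)) :=
  homology_map (cdd (shift_obj K) n) (cdd K (n + 1))
    (shift_hlg_sq1 n) (shift_hlg_sq2 (n + 1)).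

Definition shift_hlg_inv : hom (Hobj K (n + 1)) (Hobj (shift_obj K) n) :=
  homology_map (cdd K (n + 1)) (cdd (shift_obj K) n)
    (shift_hlg_sq3 n) (shift_hlg_sq4 (n + 1)).

Fact sq_id X Y (a : @hom A X Y) : idc Y \co a = a \co idc X.
Proof. by rewrite comp1c compc1. Qed.

Lemma shift_hlgK : shift_hlg_inv \co shift_hlg = idc _.
Proof.
rewrite -(homology_map1 _ (sq_id _) (sq_id _) erefl).
by apply/esym/homology_mapM; rewrite comp1c.
Qed.

Lemma shift_hlgVK : shift_hlg \co shift_hlg_inv = idc _.
Proof.
rewrite -(homology_map1 _ (sq_id _) (sq_id _) erefl).
by apply/esym/homology_mapM; rewrite comp1c.
Qed.

End ShiftHomology.

Lemma quasi_iso_shift (K L : complex_cat A) (f : hom K L) :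
  quasi_iso f -> quasi_iso (fmap (complex_shift A) f).
Proof.
move=> qf n.
have -> : Hmap (fmap (complex_shift A) f) n =
    shift_hlg_inv L n \co Hmap f (n + 1) \co shift_hlg K n.
  have sq m : f (m + 1 + 1) \co - cd K (m + 1) =
    cd L (m + 1) \co (- f (m + 1)) by rewrite !compNr cmap_cd.
  have sq' m : - f (m + 1 + 1) \co - cd K (m + 1) =
    cd L (m + 1) \co f (m + 1) by rewrite compNl compNr opprK cmap_cd.
  have e : homology_map (cdd (shift_obj K) n) (cdd L (n + 1)) (sq n) (sq' (n + 1)) =
      Hmap f (n + 1) \co shift_hlg K n.
    by apply: homology_mapM; rewrite compc1.
  by rewrite -compA -e; apply: homology_mapM; rewrite comp1c.
apply: is_iso_comp; first apply: is_iso_comp.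
- by exists (shift_hlg L n); split; rewrite ?shift_hlgK ?shift_hlgVK.
- exact: qf.
- by exists (shift_hlg_inv K n); split; rewrite ?shift_hlgK ?shift_hlgVK.
Qed.

End Homology.

Section Localization.
Local Open Scope quotient_scope.
Variables (C : category) (W : forall X Y : C, hom X Y -> Prop).

(* Formal composites of morphisms of C and inverses of morphisms of W; the
   localization is their quotient by the least congruence loc_eq making
   LocOf a functor and LocInv w inverse to w. *)
Inductive loc_word : C -> C -> Type :=
| LocOf X Y (f : hom X Y) : loc_word X Y
| LocInv X Y (w : hom X Y) : W w -> loc_word Y X
| LocComp X Y Z : loc_word Y Z -> loc_word X Y -> loc_word X Z.

Inductive loc_eq : forall X Y : C, loc_word X Y -> loc_word X Y -> Prop :=
| loc_refl X Y (a : loc_word X Y) : loc_eq a a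
| loc_sym X Y (a b : loc_word X Y) : loc_eq a b -> loc_eq b a
| loc_trans X Y (a b c : loc_word X Y) : loc_eq a b -> loc_eq b c -> loc_eq a c
| loc_congr X Y Z (b b' : loc_word Y Z) (a a' : loc_word X Y) :
    loc_eq b b' -> loc_eq a a' -> loc_eq (LocComp b a) (LocComp b' a')
| loc_assoc X Y Z T (c : loc_word Z T) (b : loc_word Y Z) (a : loc_word X Y) :
    loc_eq (LocComp c (LocComp b a)) (LocComp (LocComp c b) a)
| loc_1l X Y (a : loc_word X Y) : loc_eq (LocComp (LocOf (idc Y)) a) a
| loc_1r X Y (a : loc_word X Y) : loc_eq (LocComp a (LocOf (idc X))) a
| loc_of_comp X Y Z (g : hom Y Z) (f : hom X Y) :
    loc_eq (LocOf (g \co f)) (LocComp (LocOf g) (LocOf f))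
| loc_invl X Y (w : hom X Y) (Ww : W w) :
    loc_eq (LocComp (LocInv Ww) (LocOf w)) (LocOf (idc X))
| loc_invr X Y (w : hom X Y) (Ww : W w) :
    loc_eq (LocComp (LocOf w) (LocInv Ww)) (LocOf (idc Y)).

HB.instance Definition _ X Y := gen_eqMixin (loc_word X Y).
HB.instance Definition _ X Y := gen_choiceMixin (loc_word X Y).

Fact loc_equiv_subproof X Y :
  equiv_class_of (fun a b : loc_word X Y => `[< loc_eq a b >]).
Proof.
split=> [a|a b|b a c].
- by apply/asboolP; apply: loc_refl.
- by apply/asboolP/asboolP; apply: loc_sym.
- by move=> /asboolP ab /asboolP bc; apply/asboolP; apply: loc_trans ab bc.
Qed.

Canonical loc_equiv X Y : equiv_rel (loc_word X Y) :=
  EquivRelPack (loc_equiv_subproof X Y).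

Definition loc_hom X Y : Type := {eq_quot loc_equiv X Y}.
Definition loc_class X Y (a : loc_word X Y) : loc_hom X Y :=
  \pi_({eq_quot loc_equiv X Y}) a.
Definition loc_repr X Y (f : loc_hom X Y) : loc_word X Y :=
  repr (f : {eq_quot loc_equiv X Y}).

Lemma loc_reprK X Y (f : loc_hom X Y) : loc_class (loc_repr f) = f.
Proof. exact: reprK. Qed.

Lemma loc_classP X Y (a b : loc_word X Y) : loc_class a = loc_class b <-> loc_eq a b.
Proof. by split=> [/eqmodP/asboolP|?]; last apply/eqmodP/asboolP. Qed.

Lemma loc_classK X Y (a : loc_word X Y) : loc_eq (loc_repr (loc_class a)) a.
Proof. by apply/loc_classP; rewrite loc_reprK. Qed.

Program Definition localization : category :=
  @Category C loc_hom (fun X => loc_class (LocOf (idc X)))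
    (fun X Y Z g f => loc_class (LocComp (loc_repr g) (loc_repr f))) _ _ _.
Next Obligation.
move=> X Y f; rewrite -[RHS]loc_reprK; apply/loc_classP.
by apply: loc_trans (loc_1l _); apply: loc_congr; [apply: loc_classK|apply: loc_refl].
Qed.
Next Obligation.
move=> X Y f; rewrite -[RHS]loc_reprK; apply/loc_classP.
by apply: loc_trans (loc_1r _); apply: loc_congr; [apply: loc_refl|apply: loc_classK].
Qed.
Next Obligation.
move=> X Y Z T h g f; apply/loc_classP.
apply: (loc_trans (b := LocComp (loc_repr h) (LocComp (loc_repr g) (loc_repr f)))).
  by apply: loc_congr; [apply: loc_refl|apply: loc_classK].
apply: (loc_trans (loc_assoc _ _ _)).
by apply: loc_congr; [apply/loc_sym/loc_classK|apply: loc_refl].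
Qed.

Lemma loc_class_comp X Y Z (b : loc_word Y Z) (a : loc_word X Y) :
  (loc_class b : @hom localization Y Z) \co (loc_class a : @hom localization X Y) =
  loc_class (LocComp b a).
Proof. by apply/loc_classP; apply: loc_congr; apply: loc_classK. Qed.

Program Definition loc_functor : functor C localization :=
  @Functor C localization (fun X => X) (fun X Y f => loc_class (LocOf f)) _ _.
Next Obligation. by []. Qed.
Next Obligation.
by move=> X Y Z g f; rewrite loc_class_comp; apply/loc_classP; apply: loc_of_comp.
Qed.

End Localization.

Section LocalizedFunctor.
Variables (C D : category).
Variables (W : forall X Y : C, hom X Y -> Prop) (V : forall X Y : D, hom X Y -> Prop).
Variables (F : functor C D) (FW : forall (X Y : C) (f : hom X Y), W f -> V (fmap F f)).

Fixpoint loc_word_map X Y (a : loc_word W X Y) : loc_word V (F X) (F Y) :=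
  match a with
  | LocOf _ _ f => LocOf V (fmap F f)
  | LocInv _ _ w Ww => LocInv (FW Ww)
  | LocComp _ _ _ b a => LocComp (loc_word_map b) (loc_word_map a)
  end.

Lemma loc_word_map_eq X Y (a b : loc_word W X Y) :
  loc_eq a b -> loc_eq (loc_word_map a) (loc_word_map b).
Proof.
elim=> {X Y a b} /=.
- by move=> *; apply: loc_refl.
- by move=> X Y a b _; apply: loc_sym.
- by move=> X Y a b c _ ab _; apply: loc_trans.
- by move=> X Y Z b b' a a' _ bb' _; apply: loc_congr.
- by move=> *; apply: loc_assoc.
- by move=> *; rewrite fmap1; apply: loc_1l.
- by move=> *; rewrite fmap1; apply: loc_1r.
- by move=> *; rewrite fmapM; apply: loc_of_comp.
- by move=> *; rewrite fmap1; apply: loc_invl.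
- by move=> *; rewrite fmap1; apply: loc_invr.
Qed.

Program Definition localized_functor : functor (localization W) (localization V) :=
  @Functor (localization W) (localization V) F
    (fun X Y f => loc_class (loc_word_map (loc_repr f))) _ _.
Next Obligation.
move=> X; apply/loc_classP; rewrite -fmap1 -[LocOf V _]/(loc_word_map (LocOf W _)).
exact/loc_word_map_eq/loc_classK.
Qed.
Next Obligation.
move=> X Y Z g f; rewrite loc_class_comp; apply/loc_classP.
exact: loc_word_map_eq (loc_classK _).
Qed.

End LocalizedFunctor.

(* Only the data of a triangulated category: its axioms do not enter the notion
   of an equivalence of triangulated categories. *)
Record triangulated_data := Triangulated {
  tr_cat :> category;
  tr_shift : functor tr_cat tr_cat;
  tr_dist : forall X Y Z : tr_cat,
    hom X Y -> hom Y Z -> hom Z (tr_shift X) -> Prop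
}.

(* Neither the additivity of F nor the exactness of a quasi-inverse is required
   separately: both are automatic for an equivalence between triangulated
   categories that commutes with the shifts and preserves distinguished
   triangles. *)
Definition triangulated_equivalent (T T' : triangulated_data) : Prop :=
  exists (F : functor T T')
         (s : nat_trans (comp_functor F (tr_shift T)) (comp_functor (tr_shift T') F)),
    [/\ is_equivalence F,
        forall X, is_iso (s X)
      & forall (X Y Z : T) (u : hom X Y) (v : hom Y Z) (w : hom Z (tr_shift T X)),
          tr_dist u v w -> tr_dist (fmap F u) (fmap F v) (s X \co fmap F w)].

(* Sign conventions: d_(K[1]) = - d_K and d_(cone f) (k, l) = (- d k, f k + d l);
   the triangle of f is K -> L -> cone f -> K[1] with the plain inclusion and
   projection. *)
Section MappingCone.
Variables (A : abelian) (K L : complex A) (f : chain_map K L).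
Let B (n : int) := bip (K (n + 1)) (L n).

Program Definition cone : complex A :=
  Complex (cx := fun n => B n)
    (cd := fun n =>
       inj1 (B (n + 1)) \co - cd K (n + 1) \co prj1 (B n) +
       inj2 (B (n + 1)) \co (f (n + 1) \co prj1 (B n) + cd L n \co prj2 (B n))) _.
Next Obligation.
move=> n /=; rewrite !compDr !compDl -!compA !bipE.
rewrite !(compNl, compNr, compc0, comp0c, oppr0, opprK, addr0, add0r).
rewrite !compA -!(compA _ (cd K _) (cd K _)) cdd.
rewrite -!(compA _ (cd L _) (cd L _)) cdd !(compc0, comp0c, addr0, add0r).
by rewrite -!(compA (inj2 _) (f _)) cmap_cd !compA addNr.
Qed.

Program Definition cone_inj : chain_map L cone :=
  ChainMap (L := cone) (cmap := fun n => inj2 (B n)) _.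
Next Obligation.
by move=> n /=; rewrite !(compDl, compDr) -!compA !bipE !(compc0, compc1, add0r).
Qed.

Program Definition cone_prj : chain_map cone (shift_obj K) :=
  ChainMap (K := cone) (L := shift_obj K) (cmap := fun n => prj1 (B n)) _.
Next Obligation. by move=> n /=; rewrite !compDr -!compA !bipE !addr0. Qed.

End MappingCone.

Section Derived.
Variable A : abelian.

Definition derived_cat : category := localization (@quasi_iso A).

Definition quotient_functor : functor (complex_cat A) derived_cat :=
  loc_functor (@quasi_iso A).
Local Notation Q := quotient_functor.

Definition derived_shift : functor derived_cat derived_cat :=
  localized_functor (F := complex_shift A) (@quasi_iso_shift A).

Definition distinguished (X Y Z : derived_cat)
    (u : hom X Y) (v : hom Y Z) (w : hom Z (derived_shift X)) : Prop :=
  exists (K L : complex_cat A) (f : hom K L)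
         (a : hom (Q K) X) (b : hom (Q L) Y) (c : hom (Q (cone f)) Z),
    [/\ is_iso a, is_iso b & is_iso c] /\
    [/\ u \co a = b \co fmap Q f,
        v \co b = c \co fmap Q (cone_inj f : @hom (complex_cat A) L (cone f))
      & w \co c = fmap derived_shift a
          \co fmap Q (cone_prj f : @hom (complex_cat A) (cone f) (shift_obj K))].

Definition derived : triangulated_data := Triangulated distinguished.

End Derived.

Definition universally_derived_equivalent d d'
    (P : porderType d) (Q : porderType d') : Prop :=
  forall A : abelian,
    triangulated_equivalent (derived (diagrams A P)) (derived (diagrams A Q)).

Record is_partial_order (T : Type) (le : rel T) : Prop := IsPartialOrder {
  po_refl : reflexive le;
  po_anti : antisymmetric le;
  po_trans : transitive le
}.

Definition poset_of (T : choiceType) (le : rel T) of is_partial_order le : Type := T.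

Section PosetOf.
Variables (T : choiceType) (le : rel T) (le_po : is_partial_order le).

HB.instance Definition _ := Choice.on (poset_of le_po).
HB.instance Definition _ :=
  Order.Le_isPOrder.Build (Order.Disp tt tt) (poset_of le_po)
    (po_refl le_po) (po_anti le_po) (po_trans le_po).

End PosetOf.

Section Gluing.
Variables (dX dY : Order.disp_t) (X : finPOrderType dX) (Y : finPOrderType dY).

Definition upset (y : Y) : {set Y} := [set z | (y <= z)%O].
Definition downset (y : Y) : {set Y} := [set z | (z <= y)%O].

Variable Yx : X -> {set Y}.

Definition le_plus : rel (X + Y) := fun a b =>
  match a, b with
  | inl x, inl x' => (x <= x')%O
  | inr y, inr y' => (y <= y')%O
  | inl x, inr y => [exists yx in Yx x, (yx <= y)%O]
  | inr _, inl _ => false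
  end.

Definition le_minus : rel (X + Y) := fun a b =>
  match a, b with
  | inl x, inl x' => (x <= x')%O
  | inr y, inr y' => (y <= y')%O
  | inr y, inl x => [exists yx in Yx x, (y <= yx)%O]
  | inl _, inr _ => false
  end.

End Gluing.

(* Main.v *)
(** Call a diagram K over (X + Y, <=+) a pair of families with transition maps
    K x -> K x' and K x -> (+)_{z in Yx x} K z; over <=- the last map is replaced
    by (+)_{z in Yx x} L z -> L x.  The disjointness of up-sets and down-sets and
    the bijections Yx x ~ Yx x' make x |-> (+)_{z in Yx x} K z functorial.  Put
      F K := (x |-> cone (K x -> (+) K z), y |-> K y)  over <=-,
      G L := (x |-> cone ((+) L z -> L x), y |-> L y[1])  over <=+.
    Both are mapping cones of natural transformations between exact additive
    functors of diagrams, so on complexes they preserve quasi-isomorphisms,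
    commute with the shift and preserve mapping cones.  The composites G F and
    F G are naturally quasi-isomorphic to the shift: if one writes
    F = cone (F1 -> F0) and G = cone (G1 -> G0), then G1 F1 = 0, F0 G0 = 0 and
    there are short exact sequences
      0 -> Id -> G1 F0 (+) G0 F1 -> G0 F0 -> 0,
      0 -> F1 G1 -> F1 G0 (+) F0 G1 -> Id -> 0.
    Hence F descends to an equivalence of triangulated categories. *)
From mathcomp Require Import all_boot order ssralg ssrint.
From mathcomp Require Import boolp.
Require Import Defs.
Set Implicit Arguments.
Unset Strict Implicit.
Unset Printing Implicit Defensive.
Import Order.TTheory GRing.Theory.
Local Open Scope ring_scope.
#[local] Obligation Tactic := idtac.

(** * Exactness by generalized elements *)

Section Abelian.
Context {A : abelian}.

(** Why both composites are shifts: at a point [x] a complex of diagrams contains a map [K x -> S],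
    with [S] the sum of the [K z], hence a triangle [K x -> S -> C -> K x[1]]. [F] retains the arrow
    [S -> C], and [G] then retains [K x[1] -> S[1]], so the triangle is rotated until the original
    map returns, shifted. Cones in a derived category are not functorial; the rotation is therefore
    carried out on complexes, where the cone of a natural transformation is a functor, and exact
    functors with explicit short exact sequences stand in for triangles. The other obstacle is the
    functoriality of the sum. The bijections between the sets [Yx x] merely exist, with no
    compatibility along chains. Structure maps extended by zero form a canonical matrix instead, and
    a product of such matrices is again one as soon as every comparable pair of outer indices has
    exactly one index in between. Every functoriality and naturality statement about diagrams is
    reduced to this combinatorial condition. *)

Lemma is_epi0 (B : preadditive) (X Y : B) (f : hom X Y) :
  (forall (T : B) (g : hom Y T), g \co f = 0 -> g = 0) -> is_epi f.
Proof.
move=> fP T g h e; apply/eqP; rewrite -subr_eq0; apply/eqP/fP.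
by rewrite compDl compNl e subrr.
Qed.

Lemma is_mono0 (B : preadditive) (X Y : B) (f : hom X Y) :
  (forall (T : B) (g : hom T X), f \co g = 0 -> g = 0) -> is_mono f.
Proof.
move=> fP T g h e; apply/eqP; rewrite -subr_eq0; apply/eqP/fP.
by rewrite compDr compNr e subrr.
Qed.

Lemma epi0 (B : preadditive) (X Y : B) (f : hom X Y) T (g : hom Y T) :
  is_epi f -> g \co f = 0 -> g = 0.
Proof. by move=> ef gf; apply: ef; rewrite gf comp0c. Qed.

Lemma mono0 (B : preadditive) (X Y : B) (f : hom X Y) T (g : hom T X) :
  is_mono f -> f \co g = 0 -> g = 0.
Proof. by move=> mf fg; apply: mf; rewrite fg compc0. Qed.

Lemma is_epi_comp (B : category) (X Y Z : B) (g : hom Y Z) (f : hom X Y) :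
  is_epi g -> is_epi f -> is_epi (g \co f).
Proof. by move=> eg ef T a b e; apply/eg/ef; rewrite -!compA. Qed.

Lemma is_epi_compr (B : category) (X Y Z : B) (g : hom Y Z) (f : hom X Y) :
  is_epi (g \co f) -> is_epi g.
Proof. by move=> e T a b ab; apply: e; rewrite !compA ab. Qed.

Lemma is_iso_mono (B : category) (X Y : B) (f : hom X Y) : is_iso f -> is_mono f.
Proof.
by move=> [f' [f'f _]] T a b e; rewrite -[a]comp1c -[b]comp1c -f'f -!compA e.
Qed.

Lemma is_iso_epi (B : category) (X Y : B) (f : hom X Y) : is_iso f -> is_epi f.
Proof.
by move=> [f' [_ ff']] T a b e; rewrite -[a]compc1 -[b]compc1 -ff' !compA e.
Qed.

(** A monomorphism is the kernel of its cokernel, and the cokernel map of an epimorphism is zero, so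
    [idc Y] lifts through [f]. *)
Lemma mono_epi_iso (X Y : A) (f : hom X Y) : is_mono f -> is_epi f -> is_iso f.
Proof.
move=> mf ef; have [qf kP] := mono_ker_coker mf.
have [|u [fu _]] := kP Y (idc Y); first by rewrite compc1; apply: epi0 ef qf.
by exists u; split=> //; apply: mf; rewrite compA fu comp1c compc1.
Qed.

Lemma bip_ext_in (X Y : A) (B : biproduct X Y) T (f g : hom B T) :
  f \co inj1 B = g \co inj1 B -> f \co inj2 B = g \co inj2 B -> f = g.
Proof.
by move=> e1 e2; rewrite -[f]compc1 -[g]compc1 -(bip_id B) !compDr !compA e1 e2.
Qed.

(** Minimality of the image: a [g] killing [p] confines [b] to the subobject [m \co k]. That
    subobject is a kernel, so it contains all of [m]; hence [k] has a right inverse and [g = 0]. *)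
Lemma image_epi (X Y : A) (b : hom X Y) (qb : coker_map (coker b) \co b = 0) :
  is_epi (ker_lift (ker (coker_map (coker b))) qb).
Proof.
pose m := ker_map (ker (coker_map (coker b))); set p := ker_lift _ _.
have mp : m \co p = b by apply: ker_liftK.
apply: is_epi0 => T g gp.
pose k := ker_map (ker g).
have mmk : is_mono (m \co k).
  by move=> ? u v; rewrite -!compA => /ker_inj/ker_inj.
have [] := mono_ker_coker mmk; set c := coker_map (coker (m \co k)) => ck kP.
have cb : c \co b = 0.
  rewrite -[X in c \co X]mp -(ker_liftK (ker g) gp) -/k !compA -(compA c).
  by rewrite ck comp0c.
have [|u [mku _]] := kP _ m.
  rewrite -(coker_descK (coker b) cb) -compA (ker_mapP (ker (coker_map (coker b)))).1.
  by rewrite compc0.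
have ku : k \co u = idc _.
  by apply: (@ker_inj _ _ _ _ (ker (coker_map (coker b)))); rewrite compA mku compc1.
by rewrite -[g]compc1 -ku compA (ker_mapP (ker g)).1 comp0c.
Qed.

(* The epimorphism e is the base change of f along g. *)
Lemma epi_lift (X Y Z : A) (f : hom X Z) (g : hom Y Z) : is_epi f ->
  exists S (e : hom S Y) (x : hom S X), is_epi e /\ f \co x = g \co e.
Proof.
move=> ef; pose B := bip X Y.
pose phi := f \co prj1 B - g \co prj2 B.
have phi1 : phi \co inj1 B = f.
  by rewrite compDl compNl -!compA !bipE compc1 compc0 subr0.
pose k := ker_map (ker phi).
exists (ker phi), (prj2 B \co k), (prj1 B \co k); split; last first.
  apply/eqP; rewrite -subr_eq0; apply/eqP.
  by rewrite !compA -compNl -compDl (ker_mapP (ker phi)).1.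
have ephi : is_epi phi by apply: (is_epi_compr (f := inj1 B)); rewrite phi1.
(* The epimorphism [phi] is the cokernel of [k], so an [h] killing [prj2 B \co k] gives
   [h \co prj2 B = w \co phi]; restricting to the summand [X] yields [w \co f = 0]. *)
have [_ cP] := epi_coker_ker ephi.
apply: is_epi0 => T h hk; have [|w [wphi _]] := cP T (h \co prj2 B).
  by rewrite -compA.
have w0 : w = 0.
  apply: (epi0 ef); rewrite -phi1 compA wphi -compA bipE.
  by rewrite compc0.
by rewrite -[h]compc1 -(prj2_inj2 B) compA -wphi w0 !comp0c.
Qed.

(* Exactness at Y in terms of generalized elements, which may be lifted after
   passing to an epimorphic cover of their domain. *)
Definition exact (X Y Z : A) (a : hom X Y) (b : hom Y Z) : Prop :=
  b \co a = 0 /\ forall T (t : hom T Y), b \co t = 0 ->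
    exists S (e : hom S T) (s : hom S X), is_epi e /\ a \co s = t \co e.

(** In one direction it suffices to lift the universal element killed by [b], namely
    [ker_map (ker b)]; in the other, base change of the epimorphism provides every lift. *)
Lemma exactP (X Y Z : A) (a : hom X Y) (b : hom Y Z) (ba : b \co a = 0) :
  exact a b <-> is_epi (ker_lift (ker b) ba).
Proof.
split=> [[_ ex]|el].
  have [S [e [s [ee es]]]] := ex _ _ (ker_mapP (ker b)).1.
  apply: (is_epi_compr (f := s)).
  suff -> : ker_lift (ker b) ba \co s = e by [].
  by apply: ker_inj; rewrite compA ker_liftK.
split=> // T t bt; have [S [e [s [ee es]]]] := epi_lift (ker_lift (ker b) bt) el.
exists S, e, s; split=> //.
by rewrite -(ker_liftK (ker b) ba) -compA es compA ker_liftK.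
Qed.

Lemma exact_coker (X Y : A) (b : hom X Y) : exact b (coker_map (coker b)).
Proof. exact/(exactP (coker_mapP (coker b)).1)/image_epi. Qed.

Lemma exact_factor (X Y Z I : A) (a : hom X Y) (b : hom Y Z) (k : hom I Y) (p : hom X I) :
  is_kernel b k -> is_epi p -> a = k \co p -> exact a b.
Proof.
move=> [bk kP] ep ->; split; first by rewrite compA bk comp0c.
move=> T t /kP[u [ku _]]; have [S [e [s [ee es]]]] := epi_lift u ep.
by exists S, e, s; split=> //; rewrite -compA es compA ku.
Qed.

End Abelian.

(** * Quasi-isomorphisms and acyclic cones by diagram chasing *)

Section Homology.
Context {A : abelian}.
Implicit Types K L : complex A.

Definition acyclic K : Prop := forall n, exact (cd K n) (cd K (n + 1)).

Lemma Hmap_q K L (f : chain_map K L) n :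
  Hmap f n \co coker_map (homology (cdd K n)) =
  coker_map (homology (cdd L n)) \co
    cycles_map (cmap_cd f (n + 1)).
Proof. exact: coker_descK. Qed.

Lemma cycles_mapE (Y Z Y' Z' : A) (b : hom Y Z) (b' : hom Y' Z')
    (y : hom Y Y') (z : hom Z Z') (zb : z \co b = b' \co y) :
  ker_map (ker b') \co cycles_map zb = y \co ker_map (ker b).
Proof. exact: ker_liftK. Qed.

(** With its surjective counterpart [Hmap_epi], this removes cycle and homology objects from all
    later arguments: they become chases with generalized elements, each lift costing an epimorphic
    cover. [Hmap f n] concerns degree [n + 1]. *)
Lemma Hmap_mono K L (f : chain_map K L) n : is_mono (Hmap f n) <->
  forall T (k : hom T (K (n + 1))) (l : hom T (L n)),
    cd K (n + 1) \co k = 0 -> f (n + 1) \co k = cd L n \co l ->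
    exists S (e : hom S T) (k' : hom S (K n)), is_epi e /\ cd K n \co k' = k \co e.
Proof.
split=> [mf T k l dk fk|ex].
  pose z := ker_lift (ker (cd K (n + 1))) dk.
  have qz : coker_map (homology (cdd K n)) \co z = 0.
    apply: (mono0 mf); rewrite compA Hmap_q -compA.
    have -> : cycles_map (cmap_cd f (n + 1)) \co z =
        ker_lift (ker (cd L (n + 1))) (cdd L n) \co l.
      by apply: ker_inj; rewrite !compA cycles_mapE ker_liftK -compA ker_liftK.
    by rewrite compA (coker_mapP (homology _)).1 comp0c.
  have [S [e [s [ee es]]]] := (exact_coker _).2 _ _ qz.
  exists S, e, s; split=> //.
  by rewrite -(ker_liftK (ker (cd K (n+1))) (cdd K n)) -compA es compA ker_liftK.
apply: is_mono0 => T t ft.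
(* The class [t] is represented by a cycle [z] only over the cover [e]; the image of [z] has zero
   class, hence bounds over a further cover [e']. *)
have [S [e [z [ee qz]]]] := epi_lift t (@coker_surj _ _ _ _ (homology (cdd K n))).
have q0 : coker_map (homology (cdd L n)) \co (cycles_map (cmap_cd f (n + 1)) \co z) = 0.
  by rewrite compA -Hmap_q -compA qz compA ft comp0c.
have [S' [e' [l [ee' el]]]] := (exact_coker _).2 _ _ q0.
have [||S'' [e'' [k' [ee'' ek]]]] := ex S' (ker_map (ker (cd K (n + 1))) \co z \co e') l.
- by rewrite !compA (ker_mapP (ker _)).1 !comp0c.
- rewrite -(ker_liftK (ker (cd L (n+1))) (cdd L n)) -[RHS]compA el.
  by rewrite !compA -(cycles_mapE (cmap_cd f (n + 1))).
apply: (epi0 (is_epi_comp ee (is_epi_comp ee' ee''))).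
rewrite !compA -qz -!compA.
have -> : z \co (e' \co e'') = ker_lift (ker (cd K (n + 1))) (cdd K n) \co k'.
  by apply: ker_inj; rewrite !compA ker_liftK ek.
by rewrite compA (coker_mapP (homology _)).1 comp0c.
Qed.

Lemma Hmap_epi K L (f : chain_map K L) n : is_epi (Hmap f n) <->
  forall T (l : hom T (L (n + 1))), cd L (n + 1) \co l = 0 ->
    exists S (e : hom S T) (k : hom S (K (n + 1))) (l' : hom S (L n)),
      [/\ is_epi e, cd K (n + 1) \co k = 0 & l \co e = f (n + 1) \co k + cd L n \co l'].
Proof.
split=> [ef T l dl|ex].
  pose z := ker_lift (ker (cd L (n + 1))) dl.
  have [S [e [h [ee eh]]]] := epi_lift (coker_map (homology (cdd L n)) \co z) ef.
  have [S' [e' [y [ee' ey]]]] := epi_lift h (@coker_surj _ _ _ _ (homology (cdd K n))).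
  (* The cycle [z] and the image of [y] have the same class over the covers, so their difference
     bounds after one more. *)
  have q0 : coker_map (homology (cdd L n)) \co
      (z \co e \co e' - cycles_map (cmap_cd f (n + 1)) \co y) = 0.
    rewrite compDr compNr !compA -Hmap_q -(compA (Hmap f n)) ey.
    by rewrite -eh !compA subrr.
  have [S'' [e'' [l' [ee'' el']]]] := (exact_coker _).2 _ _ q0.
  exists S'', (e \co e' \co e''), (ker_map (ker (cd K (n+1))) \co y \co e''), l'; split.
  - by apply: is_epi_comp ee''; apply: is_epi_comp ee'.
  - by rewrite !compA (ker_mapP (ker _)).1 !comp0c.
  have <- : ker_map (ker (cd L (n + 1))) \co
      (ker_lift (ker (cd L (n + 1))) (cdd L n) \co l') = cd L n \co l'.
    by rewrite compA ker_liftK.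
  rewrite el' compDl compNl compDr compNr !compA ker_liftK.
  by rewrite (cycles_mapE (cmap_cd f (n + 1))) addrCA subrr addr0.
apply: is_epi0 => T g gH; apply: (epi0 (@coker_surj _ _ _ _ (homology (cdd L n)))).
have [S [e [k [l' [ee dk el]]]]] := ex _ _ (ker_mapP (ker (cd L (n+1)))).1.
apply: (epi0 ee).
have -> : e = cycles_map (cmap_cd f (n + 1)) \co ker_lift (ker (cd K (n + 1))) dk +
    ker_lift (ker (cd L (n + 1))) (cdd L n) \co l'.
  apply: ker_inj; rewrite compDr !compA (cycles_mapE (cmap_cd f (n + 1))).
  by rewrite -(compA (f _)) !ker_liftK.
rewrite compDr !compA -(compA g _ (cycles_map _)) -Hmap_q !compA gH !comp0c.
by rewrite -(compA g) (coker_mapP (homology _)).1 compc0 comp0c addr0.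
Qed.

Lemma cone_cdE K L (f : chain_map K L) n T (k : hom T (K (n + 1))) (l : hom T (L n)) :
  cd (cone f) n \co (inj1 (bip _ _) \co k + inj2 (bip _ _) \co l) =
  inj1 (bip _ _) \co - (cd K (n + 1) \co k) +
  inj2 (bip _ _) \co (f (n + 1) \co k + cd L n \co l).
Proof.
by rewrite /= !(compDl, compDr) -!compA !bipE !(compc0, addr0, add0r, compNl, compNr).
Qed.

Lemma bip_eq (X Y : A) (B : biproduct X Y) T (a a' : hom T X) (b b' : hom T Y) :
  inj1 B \co a + inj2 B \co b = inj1 B \co a' + inj2 B \co b' ->
  a = a' /\ b = b'.
Proof.
move=> e; split; [have := congr1 (comp (prj1 B)) e|have := congr1 (comp (prj2 B)) e].
  by rewrite !compDr !bipE !addr0.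
by rewrite !compDr !bipE !add0r.
Qed.

Lemma bip_split (X Y : A) (B : biproduct X Y) T (t : hom T B) :
  t = inj1 B \co (prj1 B \co t) + inj2 B \co (prj2 B \co t).
Proof. by rewrite !compA -compDl bip_id comp1c. Qed.

Lemma bip_eq0 (X Y : A) (B : biproduct X Y) T (a : hom T X) (b : hom T Y) :
  inj1 B \co a + inj2 B \co b = 0 -> a = 0 /\ b = 0.
Proof. by move=> e; apply: (@bip_eq _ _ B); rewrite e !compc0 addr0. Qed.

Lemma int_succ_ind (P : int -> Prop) : (forall n, P (n + 1)) -> forall n, P n.
Proof. by move=> P1 n; rewrite -(subrK 1 n). Qed.

(** A cycle [(k, l)] of the cone is a cycle [k] with [f k = - d l]: injectivity on homology makes
    [k] bound, and surjectivity disposes of the rest. Conversely, the cycles [(k, - l)] and [(0, l)]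
    of the cone recover the two homology criteria. *)
Lemma qiso_cone K L (f : hom (K : complex_cat A) L) :
  quasi_iso f <-> acyclic (cone f).
Proof.
split=> [qf n|ac].
  split=> [|T t dt]; first exact: cdd.
  move: dt; rewrite (bip_split t); move: (prj1 _ \co t) (prj2 _ \co t) => k l.
  rewrite cone_cdE => /bip_eq0[/eqP]; rewrite oppr_eq0 => /eqP dk.
  move=> /eqP; rewrite addr_eq0 => /eqP fk.
  have [||S [e [k' [ee ek]]]] := (Hmap_mono f (n + 1)).1 (is_iso_mono (qf (n + 1))) T k (- l).
  - exact: dk.
  - by rewrite compNr.
  (* [l + f k'] is a cycle because [d f k' = f d k' = f k = - d l] over the cover. The primitive is
     then [(k2 - k', l')], its sign matching the [- d] of the cone. *)
  have [|S' [e' [k2 [l' [ee' dk2 el']]]]] :=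
      (Hmap_epi f n).1 (is_iso_epi (qf n)) S (l \co e + f (n + 1) \co k').
    by rewrite compDr !compA -cmap_cd -(compA _ _ k') ek !compA fk compNl addrN.
  exists S', (e \co e'), (inj1 (bip _ _) \co (k2 - k' \co e') + inj2 (bip _ _) \co l').
  split; first exact: is_epi_comp.
  rewrite cone_cdE (compDr (cd K (n + 1))) (compNr (cd K (n + 1))) dk2 add0r opprK compDl.
  rewrite (compA _ k') ek -!compA; congr (_ + inj2 _ \co _).
  rewrite (compDr (f (n + 1))) (compNr (f (n + 1))) addrAC -el' compDl -!compA.
  by rewrite addrK.
suff [m s] : (forall n, is_mono (Hmap f n)) /\ (forall n, is_epi (Hmap f n)).
  by move=> n; apply: mono_epi_iso.
split.
  (* Degree [n + 1] of the cone contains [K (n + 1 + 1)], so its exactness gives injectivity for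
     [Hmap f (n + 1)], one degree above the surjectivity it gives below. *)
  apply: int_succ_ind => n; apply/Hmap_mono => T k l dk fk.
  have [|S [e [s [ee es]]]] := (ac n).2 T (inj1 (bip _ _) \co k + inj2 (bip _ _) \co - l).
    by rewrite cone_cdE dk oppr0 compc0 fk compNr subrr compc0 addr0.
  exists S, e, (- (prj1 (bip _ _) \co s)); split=> //.
  move: es; rewrite [s in LHS]bip_split cone_cdE compDl -!compA.
  by move=> /bip_eq[<- _]; rewrite compNr.
move=> n; apply/Hmap_epi => T l dl.
have [|S [e [s [ee es]]]] := (ac n).2 T (inj2 (bip _ _) \co l).
  have := cone_cdE f (0 : hom T (K (n + 1 + 1))) l.
  by rewrite !(dl, compc0, add0r, oppr0, addr0).
move: es; rewrite [s in LHS]bip_split cone_cdE -!compA.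
rewrite -[RHS]add0r -[X in _ = X + _](compc0 S (inj1 (bip (K (n + 1 + 1)) (L (n + 1))))).
move=> /bip_eq[/eqP]; rewrite oppr_eq0 => /eqP dk fl.
by exists S, e, (prj1 (bip _ _) \co s), (prj2 (bip _ _) \co s).
Qed.

End Homology.

Section HomGroup.
Context {A : preadditive} {X Y : A}.
Implicit Types f g h : hom X Y.
(* Restricted to hom-groups, so that rewriting does not act on degrees. *)
Lemma addcA f g h : f + (g + h) = f + g + h. Proof. exact: addrA. Qed.
Lemma addcC f g : f + g = g + f. Proof. exact: addrC. Qed.
Lemma addcAC f g h : f + g + h = f + h + g. Proof. exact: addrAC. Qed.
End HomGroup.

(** * The mapping cone of a natural transformation between additive functors *)

Section Additive.
Variables B B' : preadditive.

Record additive_functor := AdditiveFunctor {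
  af_fun :> functor B B';
  fmapD : forall X Y (f g : hom X Y), fmap af_fun (f + g) = fmap af_fun f + fmap af_fun g
}.

Variable F : additive_functor.

Lemma fmap0 X Y : fmap F (0 : hom X Y) = 0.
Proof. by apply: (addrI (fmap F (0 : hom X Y))); rewrite -fmapD !addr0. Qed.

Lemma fmapN X Y (f : hom X Y) : fmap F (- f) = - fmap F f.
Proof. by apply: (addrI (fmap F f)); rewrite -fmapD !subrr fmap0. Qed.

Program Definition mapc_obj (K : complex B) : complex B' :=
  Complex (cx := fun n => F (K n)) (cd := fun n => fmap F (cd K n)) _.
Next Obligation. by move=> K n /=; rewrite -fmapM cdd fmap0. Qed.

End Additive.

Lemma chain_iso (B : preadditive) (K L : complex_cat B) (f : hom K L) :
  (forall n, is_iso ((f : chain_map K L) n)) -> is_iso f.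
Proof.
move=> fI; pose g n := sval (cid (fI n)).
have gP n : g n \co (f : chain_map K L) n = idc _ /\ (f : chain_map K L) n \co g n = idc _.
  by rewrite /g; case: cid.
have gcd n : g (n + 1) \co cd L n = cd K n \co g n.
  rewrite -[LHS]compc1 -(gP n).2 -!compA (compA (cd L n)) -cmap_cd.
  by rewrite !compA (gP _).1 comp1c.
by exists (ChainMap gcd : chain_map L K); split; apply: chain_mapP => n;
  [apply: (gP n).1|apply: (gP n).2].
Qed.

Lemma iso_acyclic (A : abelian) (K L : complex_cat A) (f : hom K L) :
  is_iso f -> acyclic K -> acyclic L.
Proof.
move=> [g [gf fg]] aK n; split=> [|T t dt]; first exact: cdd.
have fgE m : (f : chain_map K L) m \co (g : chain_map L K) m = idc _.
  by rewrite -[LHS]/((f \co g : chain_map L L) m) fg.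
have [|S [e [s [ee es]]]] := (aK n).2 T ((g : chain_map L K) (n + 1) \co t).
  by rewrite compA -cmap_cd -compA dt compc0.
exists S, e, ((f : chain_map K L) n \co s); split=> //.
by rewrite compA -cmap_cd -compA es !compA fgE comp1c.
Qed.

Lemma iso_qiso (A : abelian) (K L : complex_cat A) (f : hom K L) :
  is_iso f -> quasi_iso f.
Proof.
move=> [g [gf fg]] n; exists (Hmap (g : chain_map L K) n).
have gfE m : (g : chain_map L K) m \co (f : chain_map K L) m = idc _.
  by rewrite -[LHS]/((g \co f : chain_map K K) m) gf.
have fgE m : (f : chain_map K L) m \co (g : chain_map L K) m = idc _.
  by rewrite -[LHS]/((f \co g : chain_map L L) m) fg.
split.
  rewrite -(homology_map1 (cdd K n) (sq_id _) (sq_id _) erefl).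
  by apply/esym/homology_mapM; rewrite gfE.
rewrite -(homology_map1 (cdd L n) (sq_id _) (sq_id _) erefl).
by apply/esym/homology_mapM; rewrite fgE.
Qed.

Lemma qiso_comp (A : abelian) (K L M : complex_cat A) (g : hom L M) (f : hom K L) :
  quasi_iso g -> quasi_iso f -> quasi_iso (g \co f).
Proof.
move=> qg qf n; rewrite (_ : Hmap _ n = Hmap g n \co Hmap f n).
  exact: is_iso_comp.
exact: homology_mapM.
Qed.

Lemma acyclic_qiso (A : abelian) (K L : complex_cat A) (f : hom K L) :
  acyclic K -> acyclic L -> quasi_iso f.
Proof.
move=> aK aL n; apply: mono_epi_iso.
  by apply/Hmap_mono => T k l dk _; apply: (aK n).2.
apply/Hmap_epi => T l dl; have [S [e [s [ee es]]]] := (aL n).2 _ _ dl.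
by exists S, e, 0, s; split=> //; rewrite !compc0 ?add0r.
Qed.

(** [F] of a chosen biproduct is not the chosen biproduct of the images; this second structure gives
    components to the former. *)
Program Definition fbip (A B : preadditive) (F : additive_functor A B) (X Y : A)
    (D : biproduct X Y) : biproduct (F X) (F Y) :=
  Biproduct (bip_obj := F D) (inj1 := fmap F (inj1 D)) (inj2 := fmap F (inj2 D))
    (prj1 := fmap F (prj1 D)) (prj2 := fmap F (prj2 D)) _ _ _ _ _.
Next Obligation. by move=> *; rewrite -fmapM bipE fmap1. Qed.
Next Obligation. by move=> *; rewrite -fmapM bipE fmap1. Qed.
Next Obligation. by move=> *; rewrite -fmapM bipE fmap0. Qed.
Next Obligation. by move=> *; rewrite -fmapM bipE fmap0. Qed.
Next Obligation. by move=> *; rewrite -!fmapM -fmapD bip_id fmap1. Qed.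

Section Bmap.
Context {A : preadditive} {X Y X' Y' : A}.
Variables (B : biproduct X Y) (B' : biproduct X' Y').

Definition bmap (f : hom X X') (g : hom Y Y') : hom B B' :=
  inj1 B' \co f \co prj1 B + inj2 B' \co g \co prj2 B.

Lemma bmap1E f g T (k : hom T X) : bmap f g \co (inj1 B \co k) = inj1 B' \co (f \co k).
Proof. by rewrite compDl -!compA !bipE !compc0 addr0. Qed.

Lemma bmap2E f g T (k : hom T Y) : bmap f g \co (inj2 B \co k) = inj2 B' \co (g \co k).
Proof. by rewrite compDl -!compA !bipE !compc0 add0r. Qed.

End Bmap.

(** Testing on an arbitrary [k], rather than on the bare injections, keeps goals in the right-nested
    form in which rules such as [bmap1E] rewrite. *)
Lemma bip_extT (A : preadditive) (X Y Z : A) (B : biproduct X Y) (f g : hom B Z) :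
  (forall T (k : hom T X), f \co (inj1 B \co k) = g \co (inj1 B \co k)) ->
  (forall T (k : hom T Y), f \co (inj2 B \co k) = g \co (inj2 B \co k)) -> f = g.
Proof.
move=> e1 e2; rewrite -[f]compc1 -[g]compc1 -(bip_id B) !compDr.
by congr (_ + _); [apply: e1|apply: e2].
Qed.

Section ConeDifferential.
Variables (A : abelian) (K L : complex A) (f : chain_map K L).
Local Notation CB n := (bip (cx K (n + 1)) (cx L n)).

Lemma cone_cd_inj1 n : cd (cone f) n \co inj1 (CB n) =
  inj1 (CB (n + 1)) \co - cd K (n + 1) + inj2 (CB (n + 1)) \co f (n + 1).
Proof. by rewrite /= !(compDl, compDr) -!compA !bipE !(compc0, addr0, compc1). Qed.

Lemma cone_cd_inj2 n : cd (cone f) n \co inj2 (CB n) = inj2 (CB (n + 1)) \co cd L n.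
Proof. by rewrite /= !(compDl, compDr) -!compA !bipE !(compc0, addr0, add0r, compc1). Qed.

Lemma cone_cd1 n T (k : hom T (K (n + 1))) : cd (cone f) n \co (inj1 (CB n) \co k) =
  - (inj1 (CB (n + 1)) \co (cd K (n + 1) \co k)) + inj2 (CB (n + 1)) \co (f (n + 1) \co k).
Proof. by have := cone_cdE f k (0 : hom T (L n)); rewrite !compc0 !addr0 compNr. Qed.

Lemma cone_cd2 n T (l : hom T (L n)) : cd (cone f) n \co (inj2 (CB n) \co l) =
  inj2 (CB (n + 1)) \co (cd L n \co l).
Proof.
by have := cone_cdE f (0 : hom T (K (n + 1))) l; rewrite !compc0 oppr0 compc0 !add0r.
Qed.

End ConeDifferential.

Section Total.
Variables (B B' : abelian) (F1 F0 : additive_functor B B') (eta : nat_trans F1 F0).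

Program Definition mapc_nat (K : complex B) : chain_map (mapc_obj F1 K) (mapc_obj F0 K) :=
  ChainMap (K := mapc_obj F1 K) (L := mapc_obj F0 K) (cmap := fun n => eta (K n)) _.
Next Obligation. by move=> K n /=; rewrite naturality. Qed.

(** The total complex of the two-column double complex [F1 K -> F0 K], with the column [F1 K] in
    degree -1. *)
Definition tot_obj (K : complex B) : complex B' := cone (mapc_nat K).

Local Notation TB K n := (bip (F1 (cx K (n + 1))) (F0 (cx K n))).

Lemma tot_cdE (K : complex B) n T (k : hom T (F1 (K (n + 1)))) (l : hom T (F0 (K n))) :
  cd (tot_obj K) n \co (inj1 (TB K n) \co k + inj2 (TB K n) \co l) =
  inj1 (TB K (n + 1)) \co - (fmap F1 (cd K (n + 1)) \co k) +
  inj2 (TB K (n + 1)) \co (eta _ \co k + fmap F0 (cd K n) \co l).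
Proof. exact: (cone_cdE (mapc_nat K)). Qed.

Lemma tot_cd1 (K : complex B) n T (k : hom T (F1 (K (n + 1)))) :
  cd (tot_obj K) n \co (inj1 (TB K n) \co k) =
  inj1 (TB K (n + 1)) \co - (fmap F1 (cd K (n + 1)) \co k) + inj2 (TB K (n + 1)) \co (eta _ \co k).
Proof.
by have := tot_cdE k (0 : hom T (F0 (K n))); rewrite !compc0 !addr0.
Qed.

Lemma tot_cd2 (K : complex B) n T (l : hom T (F0 (K n))) :
  cd (tot_obj K) n \co (inj2 (TB K n) \co l) =
  inj2 (TB K (n + 1)) \co (fmap F0 (cd K n) \co l).
Proof.
by have := tot_cdE (0 : hom T (F1 (K (n + 1)))) l; rewrite !compc0 oppr0 compc0 !add0r.
Qed.

Lemma tot_ext (K : complex B) n (Z : B') (f g : hom (tot_obj K n) Z) :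
  (forall T (k : hom T (F1 (K (n + 1)))),
    f \co (inj1 (TB K n) \co k) = g \co (inj1 (TB K n) \co k)) ->
  (forall T (k : hom T (F0 (K n))), f \co (inj2 (TB K n) \co k) = g \co (inj2 (TB K n) \co k)) ->
  f = g.
Proof.
move=> e1 e2; apply: (bip_ext_in (B := TB K n)).
  by have := e1 _ (idc _); rewrite compc1.
by have := e2 _ (idc _); rewrite compc1.
Qed.

Program Definition tot_map (K L : complex B) (f : chain_map K L) :
    chain_map (tot_obj K) (tot_obj L) :=
  ChainMap (K := tot_obj K) (L := tot_obj L) (cmap := fun n =>
    bmap (TB K n) (TB L n) (fmap F1 (f (n + 1))) (fmap F0 (f n))) _.
Next Obligation.
move=> K L f n; apply: tot_ext => T k; rewrite -!compA ?tot_cd1 ?tot_cd2.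
  rewrite bmap1E tot_cd1 compDr bmap1E bmap2E !compNr /=; congr (- _ + _).
    by congr (_ \co _); rewrite !compA -!fmapM cmap_cd.
  by congr (_ \co _); rewrite !compA naturality.
by rewrite !bmap2E tot_cd2 /=; congr (_ \co _); rewrite !compA -!fmapM cmap_cd.
Qed.

Program Definition tot : functor (complex_cat B) (complex_cat B') :=
  @Functor (complex_cat B) (complex_cat B') tot_obj tot_map _ _.
Next Obligation.
move=> K; apply: chain_mapP => n; apply: tot_ext => T k.
  by rewrite bmap1E fmap1 !comp1c.
by rewrite bmap2E fmap1 !comp1c.
Qed.
Next Obligation.
move=> K L M g f; apply: chain_mapP => n; apply: tot_ext => T k.
  by rewrite /= -!compA !bmap1E fmapM -compA.
by rewrite /= -!compA !bmap2E fmapM -compA.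
Qed.

(** The shift negates the whole differential of [tot_obj K], including [eta], whereas
    [tot_obj (shift_obj K)] contains [eta] unchanged; negating the [F1] summand reconciles the
    two. *)
Program Definition tot_shift (K : complex B) :
    chain_map (tot_obj (shift_obj K)) (shift_obj (tot_obj K)) :=
  ChainMap (K := tot_obj (shift_obj K)) (L := shift_obj (tot_obj K)) (cmap := fun n =>
    bmap (TB (shift_obj K) n) (TB K (n + 1)) (- idc _) (idc _)) _.
Next Obligation.
move=> K n; apply: tot_ext => T k; rewrite -!compA ?tot_cd1 ?tot_cd2.
  rewrite bmap1E compNl tot_cd1 compDr bmap1E bmap2E compNl !comp1c.
  by rewrite !(compNl, comp1c, compNr, fmapN, opprK, opprD).
by rewrite !bmap2E !comp1c compNl tot_cd2 fmapN compNl compNr.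
Qed.

Lemma tot_shift_iso (K : complex_cat B) :
  is_iso (tot_shift K : @hom (complex_cat B') _ _).
Proof.
apply: chain_iso => n; exists (bmap (TB K (n + 1)) (TB (shift_obj K) n) (- idc _) (idc _)).
by split; apply: bip_extT => T k; rewrite -compA ?(bmap1E, bmap2E)
  !(compNl, compNr, comp1c, opprK).
Qed.

Section Cone.
Variables (K L : complex B) (f : chain_map K L).
Local Notation CB n := (bip (cx K (n + 1)) (cx L n)).
Local Notation TC n := (bip (F1 (CB (n + 1))) (F0 (CB n))).
Local Notation CT n := (bip (bip_obj (TB K (n + 1))) (bip_obj (TB L n))).

(* With d_(cone f) = (- d, f + d), the sign on the summand F1 (K (n + 2)) is what
   makes the evident permutation of summands a chain map. *)
Definition tot_cone_map n : hom (TC n) (CT n) :=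
  inj1 (CT n) \co bmap (TC n) (TB K (n + 1)) (- fmap F1 (prj1 _)) (fmap F0 (prj1 _)) +
  inj2 (CT n) \co bmap (TC n) (TB L n) (fmap F1 (prj2 _)) (fmap F0 (prj2 _)).

Definition tot_cone_inv n : hom (CT n) (TC n) :=
  bmap (TB K (n + 1)) (TC n) (- fmap F1 (inj1 _)) (fmap F0 (inj1 _)) \co prj1 (CT n) +
  bmap (TB L n) (TC n) (fmap F1 (inj2 _)) (fmap F0 (inj2 _)) \co prj2 (CT n).

Lemma tot_cone_map11 n T (k : hom T (F1 (K (n + 1 + 1)))) :
  tot_cone_map n \co (inj1 (TC n) \co (fmap F1 (inj1 _) \co k)) =
  - (inj1 (CT n) \co (inj1 (TB K (n + 1)) \co k)).
Proof.
rewrite compDl -!compA !bmap1E compNl !(compA (fmap F1 _)) -!fmapM !bipE.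
by rewrite fmap1 fmap0 comp0c !compc0 addr0 comp1c !compNr.
Qed.

Lemma tot_cone_map12 n T (k : hom T (F1 (L (n + 1)))) :
  tot_cone_map n \co (inj1 (TC n) \co (fmap F1 (inj2 _) \co k)) =
  inj2 (CT n) \co (inj1 (TB L n) \co k).
Proof.
rewrite compDl -!compA !bmap1E compNl !(compA (fmap F1 _)) -!fmapM !bipE.
by rewrite fmap1 fmap0 comp0c oppr0 !compc0 add0r comp1c.
Qed.

Lemma tot_cone_map21 n T (k : hom T (F0 (K (n + 1)))) :
  tot_cone_map n \co (inj2 (TC n) \co (fmap F0 (inj1 _) \co k)) =
  inj1 (CT n) \co (inj2 (TB K (n + 1)) \co k).
Proof.
rewrite compDl -!compA !bmap2E !(compA (fmap F0 _)) -!fmapM !bipE.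
by rewrite fmap1 fmap0 comp0c !compc0 addr0 comp1c.
Qed.

Lemma tot_cone_map22 n T (k : hom T (F0 (L n))) :
  tot_cone_map n \co (inj2 (TC n) \co (fmap F0 (inj2 _) \co k)) =
  inj2 (CT n) \co (inj2 (TB L n) \co k).
Proof.
rewrite compDl -!compA !bmap2E !(compA (fmap F0 _)) -!fmapM !bipE.
by rewrite fmap1 fmap0 comp0c !compc0 add0r comp1c.
Qed.

Definition tot_cone_mapE :=
  (tot_cone_map11, tot_cone_map12, tot_cone_map21, tot_cone_map22).

Lemma tot_cone_inv1 n T (k : hom T (TB K (n + 1))) :
  tot_cone_inv n \co (inj1 (CT n) \co k) =
  bmap (TB K (n + 1)) (TC n) (- fmap F1 (inj1 _)) (fmap F0 (inj1 _)) \co k.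
Proof. by rewrite compDl -!compA !bipE !compc0 addr0. Qed.

Lemma tot_cone_inv2 n T (k : hom T (TB L n)) :
  tot_cone_inv n \co (inj2 (CT n) \co k) =
  bmap (TB L n) (TC n) (fmap F1 (inj2 _)) (fmap F0 (inj2 _)) \co k.
Proof. by rewrite compDl -!compA !bipE !compc0 add0r. Qed.

Lemma tot_cone_ext n (Z : B') (g h : hom (TC n) Z) :
  (forall T (k : hom T (F1 (K (n + 1 + 1)))),
    g \co (inj1 (TC n) \co (fmap F1 (inj1 _) \co k)) =
    h \co (inj1 (TC n) \co (fmap F1 (inj1 _) \co k))) ->
  (forall T (k : hom T (F1 (L (n + 1)))),
    g \co (inj1 (TC n) \co (fmap F1 (inj2 _) \co k)) =
    h \co (inj1 (TC n) \co (fmap F1 (inj2 _) \co k))) ->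
  (forall T (k : hom T (F0 (K (n + 1)))),
    g \co (inj2 (TC n) \co (fmap F0 (inj1 _) \co k)) =
    h \co (inj2 (TC n) \co (fmap F0 (inj1 _) \co k))) ->
  (forall T (k : hom T (F0 (L n))),
    g \co (inj2 (TC n) \co (fmap F0 (inj2 _) \co k)) =
    h \co (inj2 (TC n) \co (fmap F0 (inj2 _) \co k))) ->
  g = h.
Proof.
move=> e1 e2 e3 e4; apply: (bip_ext_in (B := TC n)).
all: [> apply: (bip_ext_in (B := fbip F1 (CB (n + 1))))|apply: (bip_ext_in (B := fbip F0 (CB n)))].
- by have := e1 _ (idc _); rewrite compc1 !compA.
- by have := e2 _ (idc _); rewrite compc1 !compA.
- by have := e3 _ (idc _); rewrite compc1 !compA.
- by have := e4 _ (idc _); rewrite compc1 !compA.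
Qed.

End Cone.

Program Definition tot_cone (K L : complex B) (f : chain_map K L) :
    chain_map (tot_obj (cone f)) (cone (tot_map f)) :=
  ChainMap (K := tot_obj (cone f)) (L := cone (tot_map f))
    (cmap := fun n => tot_cone_map K L n) _.
Next Obligation.
move=> K L f n.
have F_cd1 (F : additive_functor B B') m T (k : hom T (F (K (m + 1)))) :
    fmap F (cd (cone f) m) \co (fmap F (inj1 (bip (K (m + 1)) (L m))) \co k) =
    - (fmap F (inj1 (bip (K (m + 1 + 1)) (L (m + 1)))) \co (fmap F (cd K (m + 1)) \co k)) +
    fmap F (inj2 (bip (K (m + 1 + 1)) (L (m + 1)))) \co (fmap F (f (m + 1)) \co k).
  transitivity (fmap F (cd (cone f) m \co inj1 (bip (K (m + 1)) (L m))) \co k).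
    by rewrite fmapM -compA.
  by rewrite cone_cd_inj1 fmapD compNr fmapN compDl compNl !fmapM -!compA.
have F_cd2 (F : additive_functor B B') m T (k : hom T (F (L m))) :
    fmap F (cd (cone f) m) \co (fmap F (inj2 (bip (K (m + 1)) (L m))) \co k) =
    fmap F (inj2 (bip (K (m + 1 + 1)) (L (m + 1)))) \co (fmap F (cd L m) \co k).
  transitivity (fmap F (cd (cone f) m \co inj2 (bip (K (m + 1)) (L m))) \co k).
    by rewrite fmapM -compA.
  by rewrite cone_cd_inj2 fmapM -compA.
(* The differentials of both sides are restated on named biproducts, so that each of the four
   summands of [TC n] is settled by rewriting. *)
pose CB m := bip (K (m + 1)) (L m).
pose TC m := bip (F1 (CB (m + 1))) (F0 (CB m)).
pose TK := bip (F1 (K (n + 1 + 1))) (F0 (K (n + 1))).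
pose TL := bip (F1 (L (n + 1))) (F0 (L n)).
pose TK' := bip (F1 (K (n + 1 + 1 + 1))) (F0 (K (n + 1 + 1))).
pose TL' := bip (F1 (L (n + 1 + 1))) (F0 (L (n + 1))).
have tc1 T (k : hom T (F1 (CB (n + 1)))) : cd (tot_obj (cone f)) n \co (inj1 (TC n) \co k) =
    - (inj1 (TC (n + 1)) \co (fmap F1 (cd (cone f) (n + 1)) \co k)) +
    inj2 (TC (n + 1)) \co (eta (CB (n + 1)) \co k).
  by rewrite -compNr; apply: tot_cd1.
have tc2 T (k : hom T (F0 (CB n))) : cd (tot_obj (cone f)) n \co (inj2 (TC n) \co k) =
    inj2 (TC (n + 1)) \co (fmap F0 (cd (cone f) n) \co k).
  exact: tot_cd2.
have tt1 T (k : hom T TK) : cd (cone (tot_map f)) n \co (inj1 (bip TK TL) \co k) =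
    - (inj1 (bip TK' TL') \co (cd (tot_obj K) (n + 1) \co k)) +
    inj2 (bip TK' TL') \co (bmap TK TL' (fmap F1 (f (n + 1 + 1))) (fmap F0 (f (n + 1))) \co k).
  exact: (cone_cd1 (tot_map f)).
have tt2 T (k : hom T TL) : cd (cone (tot_map f)) n \co (inj2 (bip TK TL) \co k) =
    inj2 (bip TK' TL') \co (cd (tot_obj L) n \co k).
  exact: (cone_cd2 (tot_map f)).
have kd1 T (k : hom T (F1 (K (n + 1 + 1)))) : cd (tot_obj K) (n + 1) \co (inj1 TK \co k) =
    - (inj1 TK' \co (fmap F1 (cd K (n + 1 + 1)) \co k)) + inj2 TK' \co (eta _ \co k).
  by rewrite -compNr; apply: tot_cd1.
have kd2 T (k : hom T (F0 (K (n + 1)))) : cd (tot_obj K) (n + 1) \co (inj2 TK \co k) =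
    inj2 TK' \co (fmap F0 (cd K (n + 1)) \co k).
  exact: tot_cd2.
have ld1 T (k : hom T (F1 (L (n + 1)))) : cd (tot_obj L) n \co (inj1 TL \co k) =
    - (inj1 TL' \co (fmap F1 (cd L (n + 1)) \co k)) + inj2 TL' \co (eta _ \co k).
  by rewrite -compNr; apply: tot_cd1.
have ld2 T (k : hom T (F0 (L n))) : cd (tot_obj L) n \co (inj2 TL \co k) =
    inj2 TL' \co (fmap F0 (cd L n) \co k).
  exact: tot_cd2.
have eta1 T (k : hom T (F1 (K (n + 1 + 1)))) :
    eta (CB (n + 1)) \co (fmap F1 (inj1 (CB (n + 1))) \co k) =
    fmap F0 (inj1 (CB (n + 1))) \co (eta _ \co k).
  by rewrite !compA naturality.
have eta2 T (k : hom T (F1 (L (n + 1)))) :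
    eta (CB (n + 1)) \co (fmap F1 (inj2 (CB (n + 1))) \co k) =
    fmap F0 (inj2 (CB (n + 1))) \co (eta _ \co k).
  by rewrite !compA naturality.
apply: tot_cone_ext => T k; rewrite -!compA tot_cone_mapE ?compNr.
- rewrite tc1 F_cd1 eta1 tt1 kd1 bmap1E !(compDr, compNr) !tot_cone_mapE.
  by rewrite !(opprD, opprK) addcAC.
- rewrite tc1 F_cd2 eta2 tt2 ld1 !(compDr, compNr) !tot_cone_mapE.
  by [].
- rewrite tc2 F_cd1 tt1 kd2 bmap2E !(compDr, compNr) !tot_cone_mapE.
  by [].
by rewrite tc2 F_cd2 tt2 ld2 !tot_cone_mapE.
Qed.

Lemma tot_cone_iso (K L : complex_cat B) (f : hom K L) :
  is_iso (tot_cone f : @hom (complex_cat B') (tot_obj (cone f)) (cone (tot_map f))).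
Proof.
apply: chain_iso => n; exists (tot_cone_inv K L n); split.
  apply: tot_cone_ext => T k; rewrite -compA comp1c tot_cone_mapE
    ?compNr compDl -!compA !bipE !compc0 ?(bmap1E, bmap2E) ?addr0 ?add0r //.
  by rewrite compNl compNr opprK.
apply: (bip_ext_in (B := bip (bip_obj (TB K (n + 1))) (bip_obj (TB L n)))).
all: apply: bip_extT => T k; rewrite -!compA comp1c
  ?(tot_cone_inv1, tot_cone_inv2) ?(bmap1E, bmap2E) ?compNl ?compNr tot_cone_mapE ?opprK //.
Qed.

Lemma tot_cone_injE (K L : complex B) (f : chain_map K L) :
  cm_comp (tot_cone f) (tot_map (cone_inj f)) = cone_inj (tot_map f).
Proof.
apply: chain_mapP => n; apply: tot_ext => T k.
  by rewrite /= -compA bmap1E tot_cone_map12.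
by rewrite /= -compA bmap2E tot_cone_map22.
Qed.

(** The sign of [tot_cone_map] on the [F1] part of [K] is exactly that of [tot_shift]. With
    [tot_cone_injE] this carries the triangle of [f] to the triangle of [tot_map f] on the level of
    complexes. *)
Lemma tot_cone_prjE (K L : complex B) (f : chain_map K L) :
  cm_comp (cone_prj (tot_map f)) (tot_cone f) = cm_comp (tot_shift K) (tot_map (cone_prj f)).
Proof.
apply: chain_mapP => n; apply: tot_cone_ext => T k; rewrite /= -!compA tot_cone_mapE
  ?compNr !bipE !(bmap1E, bmap2E) (compA (fmap _ (prj1 _))) -fmapM bipE ?fmap1 ?fmap0
  ?compNl ?comp1c ?comp0c ?compc0 ?oppr0 ?compc0 ?compNr //.
Qed.

Definition preserves_exact (F : functor B B') : Prop :=
  forall (X Y Z : B) (a : hom X Y) (b : hom Y Z), exact a b -> exact (fmap F a) (fmap F b).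

(** Up to isomorphism the cone of [fmap tot f] is [tot (cone f)], which is itself the cone of a map
    from [F1 (cone f)] to [F0 (cone f)]. Both are acyclic, and any map of acyclic complexes is a
    quasi-isomorphism. *)
Lemma tot_qiso (K L : complex_cat B) (f : hom K L) :
  preserves_exact F1 -> preserves_exact F0 -> quasi_iso f -> quasi_iso (fmap tot f).
Proof.
move=> e1 e0 /qiso_cone ac; apply/qiso_cone.
apply: (iso_acyclic (tot_cone_iso f)); apply/qiso_cone/acyclic_qiso => n.
  exact: e1.
exact: e0.
Qed.

Lemma tot_shift_natural (K L : complex B) (f : chain_map K L) :
  cm_comp (shift_map (tot_map f)) (tot_shift K) =
  cm_comp (tot_shift L) (tot_map (shift_map f)).
Proof.
apply: chain_mapP => n; apply: tot_ext => T k; rewrite /= -!compA.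
  by rewrite !bmap1E !compNl !comp1c compNr.
by rewrite !bmap2E !comp1c.
Qed.

End Total.

Lemma fmap2_eq0 (A B C : preadditive) (H : additive_functor B C) (F : additive_functor A B)
    (X Y Z : A) (g : hom Y Z) (f : hom X Y) T (u : hom T _) : g \co f = 0 ->
  fmap H (fmap F g) \co (fmap H (fmap F f) \co u) = 0.
Proof. by move=> gf; rewrite compA -(fmapM H) -(fmapM F) gf !fmap0 comp0c. Qed.

(* Exactness of 0 -> X -> Y (+) Z -> W -> 0. *)
Definition short_exact (A : abelian) (X Y Z W : A)
    (a : hom X Y) (b : hom X Z) (c : hom Y W) (d : hom Z W) : Prop :=
  is_kernel (c \co prj1 (bip Y Z) + d \co prj2 (bip Y Z))
    (inj1 (bip Y Z) \co a + inj2 (bip Y Z) \co b) /\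
  is_epi (c \co prj1 (bip Y Z) + d \co prj2 (bip Y Z)).

Section ShortExact.
Context {A : abelian} {X Y Z W : A}.
Context {a : hom X Y} {b : hom X Z} {c : hom Y W} {d : hom Z W}.
Hypothesis ex : short_exact a b c d.

Lemma short_exact_inj T (s t : hom T X) :
  a \co s = a \co t -> b \co s = b \co t -> s = t.
Proof.
move=> e1 e2; apply: (kernel_mono ex.1); rewrite !compDl -!compA e1 e2.
by [].
Qed.

Lemma short_exact_lift T (u : hom T Y) (v : hom T Z) :
  c \co u + d \co v = 0 -> exists t : hom T X, u = a \co t /\ v = b \co t.
Proof.
move=> e; have [|t [et _]] := ex.1.2 T (inj1 (bip Y Z) \co u + inj2 (bip Y Z) \co v).
  by rewrite compDl !compDr -!compA !bipE !compc0 addr0 add0r.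
by exists t; move: et; rewrite compDl -!compA => /esym/bip_eq.
Qed.

Lemma short_exact_surj T (w : hom T W) :
  exists S (e : hom S T) (u : hom S Y) (v : hom S Z),
    is_epi e /\ w \co e = c \co u + d \co v.
Proof.
have [S [e [t [ee et]]]] := epi_lift w ex.2.
exists S, e, (prj1 (bip Y Z) \co t), (prj2 (bip Y Z) \co t); split=> //.
by rewrite -et compDl -!compA.
Qed.

End ShortExact.

Lemma addc_cancel (A : preadditive) (X Y : A) (a b c d e : hom X Y) :
  a + (b + (c + (d + (- b + (- d + e))))) = a + (c + e).
Proof. by rewrite (addrCA d) addNKr (addrCA c) addNKr. Qed.

Section FmapTot.
Variables (B B' B'' : abelian) (F1 F0 : additive_functor B B') (eta : nat_trans F1 F0).
Variables (G : additive_functor B' B'') (K : complex B).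
Local Notation TB n := (bip (F1 (cx K (n + 1))) (F0 (cx K n))).

Lemma fmap_tot_cd1 n T (u : hom T (G (F1 (K (n + 1))))) :
  fmap G (cd (tot_obj eta K) n) \co (fmap G (inj1 (TB n)) \co u) =
  fmap G (inj1 (TB (n + 1))) \co - (fmap G (fmap F1 (cd K (n + 1))) \co u) +
  fmap G (inj2 (TB (n + 1))) \co (fmap G (eta _) \co u).
Proof.
transitivity (fmap G (cd (tot_obj eta K) n \co (inj1 (TB n) \co idc _)) \co u).
  by rewrite compc1 fmapM -compA.
by rewrite tot_cd1 !compc1 fmapD !fmapM fmapN compDl -!compA compNl.
Qed.

Lemma fmap_tot_cd2 n T (u : hom T (G (F0 (K n)))) :
  fmap G (cd (tot_obj eta K) n) \co (fmap G (inj2 (TB n)) \co u) =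
  fmap G (inj2 (TB (n + 1))) \co (fmap G (fmap F0 (cd K n)) \co u).
Proof.
transitivity (fmap G (cd (tot_obj eta K) n \co (inj2 (TB n) \co idc _)) \co u).
  by rewrite compc1 fmapM -compA.
by rewrite tot_cd2 !compc1 !fmapM -!compA.
Qed.

End FmapTot.

Lemma fmap_bmap1 (B B' : preadditive) (G : additive_functor B B') (X Y X' Y' : B)
    (D : biproduct X Y) (D' : biproduct X' Y') f g T (u : hom T (G X)) :
  fmap G (bmap D D' f g) \co (fmap G (inj1 D) \co u) = fmap G (inj1 D') \co (fmap G f \co u).
Proof.
rewrite !compA -!fmapM; congr (fmap _ _ \co _).
by rewrite -[inj1 D]compc1 bmap1E compc1.
Qed.

Lemma fmap_bmap2 (B B' : preadditive) (G : additive_functor B B') (X Y X' Y' : B)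
    (D : biproduct X Y) (D' : biproduct X' Y') f g T (u : hom T (G Y)) :
  fmap G (bmap D D' f g) \co (fmap G (inj2 D) \co u) = fmap G (inj2 D') \co (fmap G g \co u).
Proof.
rewrite !compA -!fmapM; congr (fmap _ _ \co _).
by rewrite -[inj2 D]compc1 bmap2E compc1.
Qed.

(** * Comparison of the two composites with the shift *)

Section Adjoint.
Variables (B B' : abelian).
Variables (F1 F0 : additive_functor B B') (eps : nat_trans F1 F0).
Variables (G1 G0 : additive_functor B' B) (del : nat_trans G1 G0).

Section Theta.
Variable r : nat_trans (id_functor B) (comp_functor G1 F0).
Variable s : nat_trans (id_functor B) (comp_functor G0 F1).
Hypothesis G1F1 : forall X, idc (G1 (F1 X)) = 0.
Hypothesis ex : forall X, short_exact (W := G0 (F0 X))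
  (r X) (s X) (del (F0 X)) (fmap G0 (eps X)).

Lemma theta_square X : del (F0 X) \co r X + fmap G0 (eps X) \co s X = 0.
Proof.
by have := (ex X).1.1; rewrite compDl !compDr -!compA !bipE !compc0 addr0 add0r.
Qed.

Section Complex.
Variable K : complex B.
Local Notation TB n := (bip (F1 (cx K (n + 1))) (F0 (cx K n))).
Local Notation TT n := (bip (G1 (TB (n + 1))) (G0 (TB n))).
Local Notation FK := (tot_obj eps K).
Local Notation GFK := (tot_obj del FK).

(* GFK has only three nonzero summands, since G1 (F1 X) = 0. *)
Definition gf1 n : hom (G1 (F0 (K (n + 1)))) (TT n) :=
  inj1 (TT n) \co fmap G1 (inj2 (TB (n + 1))).
Definition gf2 n : hom (G0 (F1 (K (n + 1)))) (TT n) :=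
  inj2 (TT n) \co fmap G0 (inj1 (TB n)).
Definition gf3 n : hom (G0 (F0 (K n))) (TT n) :=
  inj2 (TT n) \co fmap G0 (inj2 (TB n)).

Lemma gf_split n T (t : hom T (TT n)) :
  exists u v w, t = gf1 n \co u + gf2 n \co v + gf3 n \co w.
Proof.
pose t1 := prj1 (TT n) \co t; pose t2 := prj2 (TT n) \co t.
exists (fmap G1 (prj2 (TB (n + 1))) \co t1), (fmap G0 (prj1 (TB n)) \co t2),
  (fmap G0 (prj2 (TB n)) \co t2).
rewrite -addcA -!compA -compDr -(bip_split (B := fbip G0 (TB n))).
rewrite [LHS](bip_split (B := TT n)) -/t1 -/t2; congr (_ \co _ + _).
rewrite [LHS](bip_split (B := fbip G1 (TB (n + 1)))) /=.
rewrite -[fmap G1 (prj1 _)]comp1c G1F1 !comp0c compc0 add0r.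
by [].
Qed.

Lemma gf_inj n T u v w u' v' w' :
  gf1 n \co u + gf2 n \co v + gf3 n \co w = gf1 n \co u' + gf2 n \co v' + gf3 n \co w' ->
  [/\ u = u' :> hom T _, v = v' & w = w'].
Proof.
rewrite -!addcA -!compA -!compDr => /bip_eq[e1 /(bip_eq (B := fbip G0 (TB n)))[-> ->]].
split=> //; have := congr1 (comp (fmap G1 (prj2 (TB (n + 1))))) e1.
by rewrite !compA -fmapM bipE fmap1 !comp1c.
Qed.

Lemma gf1_cd n T (u : hom T _) : cd GFK n \co (gf1 n \co u) =
  gf1 (n + 1) \co - (fmap G1 (fmap F0 (cd K (n + 1))) \co u) +
  gf3 (n + 1) \co (del (F0 (K (n + 1))) \co u).
Proof.
rewrite -!compA [LHS](tot_cd1 del (K := FK)) fmap_tot_cd2 /= (compNr (fmap G1 _)).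
congr (_ + _ \co _).
by rewrite !compA; congr (_ \co _); apply: naturality.
Qed.

Lemma gf2_cd n T (u : hom T _) : cd GFK n \co (gf2 n \co u) =
  gf2 (n + 1) \co - (fmap G0 (fmap F1 (cd K (n + 1))) \co u) +
  gf3 (n + 1) \co (fmap G0 (eps (K (n + 1))) \co u).
Proof. by rewrite -!compA [LHS](tot_cd2 del (K := FK)) fmap_tot_cd1 compDr. Qed.

Lemma gf3_cd n T (u : hom T _) : cd GFK n \co (gf3 n \co u) =
  gf3 (n + 1) \co (fmap G0 (fmap F0 (cd K n)) \co u).
Proof. by rewrite -!compA [LHS](tot_cd2 del (K := FK)) fmap_tot_cd2. Qed.

Lemma gf_cd n T u v w :
  cd GFK n \co (gf1 n \co u + gf2 n \co v + gf3 n \co w : hom T _) =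
  gf1 (n + 1) \co - (fmap G1 (fmap F0 (cd K (n + 1))) \co u) +
  gf2 (n + 1) \co - (fmap G0 (fmap F1 (cd K (n + 1))) \co v) +
  gf3 (n + 1) \co (del (F0 (K (n + 1))) \co u + fmap G0 (eps (K (n + 1))) \co v +
    fmap G0 (fmap F0 (cd K n)) \co w).
Proof.
rewrite !compDr gf1_cd gf2_cd gf3_cd !addcA; congr (_ + _ + _); exact: addcAC.
Qed.

Lemma gf_eq0 n T u v w :
  gf1 n \co u + gf2 n \co v + gf3 n \co w = 0 :> hom T _ -> [/\ u = 0, v = 0 & w = 0].
Proof. by move=> e; apply: gf_inj; rewrite e !compc0 !addr0. Qed.

(** By naturality of [del] and [eps], correcting [(u, v)] by the differentials of [u'] and [v']
    changes its image in [G0 F0] by the differential of the image of [(u', v')]. This is how the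
    third component [w] is absorbed in [theta_qiso]. *)
Lemma lift_sum n T u u' v v' :
  del (F0 (K (n + 1))) \co (u + fmap G1 (fmap F0 (cd K n)) \co u') +
  fmap G0 (eps (K (n + 1))) \co (v + fmap G0 (fmap F1 (cd K n)) \co v') =
  del (F0 (K (n + 1))) \co u + fmap G0 (eps (K (n + 1))) \co v +
  fmap G0 (fmap F0 (cd K n)) \co (del (F0 (K n)) \co u' + fmap G0 (eps (K n)) \co v')
  :> hom T _.
Proof.
rewrite !compDr !addcA; congr (_ + _); last first.
  by rewrite !compA -!fmapM naturality.
rewrite addcAC; congr (_ + _ + _); rewrite !compA; congr (_ \co _).
by rewrite naturality.
Qed.

Lemma r_nat X Y (f : hom X Y) T (k : hom T X) :
  fmap G1 (fmap F0 f) \co (r X \co k) = r Y \co (f \co k).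
Proof. by rewrite !compA -(naturality r f). Qed.

Lemma s_nat X Y (f : hom X Y) T (k : hom T X) :
  fmap G0 (fmap F1 f) \co (s X \co k) = s Y \co (f \co k).
Proof. by rewrite !compA -(naturality s f). Qed.

(** By [gf_cd], [GFK] is the cone of [G1 F0 K (+) G0 F1 K -> G0 F0 K], an epimorphism with kernel
    [K]. The map is the inclusion of that kernel; the shift appears because the cone places its
    source in degree -1. *)
Program Definition theta_obj : chain_map (shift_obj K) GFK :=
  ChainMap (K := shift_obj K) (L := GFK) (cmap := fun n =>
    gf1 n \co r (K (n + 1)) + gf2 n \co s (K (n + 1))) _.
Next Obligation.
move=> n; have := gf_cd (r (K (n + 1))) (s (K (n + 1))) (0 : hom _ (G0 (F0 (K n)))).
rewrite !compc0 !addr0 => ->; rewrite theta_square compc0 addr0 /=.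
rewrite compDl -(compA (gf1 _)) -(compA (gf2 _)) !compNr.
have -> : fmap G1 (fmap F0 (cd K (n + 1))) \co r (K (n + 1)) = r _ \co cd K (n + 1).
  exact/esym/(naturality r).
have -> : fmap G0 (fmap F1 (cd K (n + 1))) \co s (K (n + 1)) = s _ \co cd K (n + 1).
  exact/esym/(naturality s).
by [].
Qed.

Lemma theta_qiso : quasi_iso (theta_obj : @hom (complex_cat B) (shift_obj K) GFK).
Proof.
have thE m T (k : hom T (K (m + 1))) : theta_obj m \co k =
    gf1 m \co (r (K (m + 1)) \co k) + gf2 m \co (s (K (m + 1)) \co k) + gf3 m \co 0.
  by rewrite compDl -(compA (gf1 _)) -(compA (gf2 _)) compc0 addr0.
move=> n; apply: mono_epi_iso.
  apply/Hmap_mono => T k l dk; rewrite thE; have [u [v [w ->]]] := gf_split l.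
  rewrite gf_cd => /gf_inj[ru sv /esym uvw].
  (* Once [w] is the image of [(u', v')], the corrected pair lies in the kernel, that is, in [K],
     and the resulting [k0] is the desired primitive of [k]. *)
  have [S [e [u' [v' [ee ew]]]]] := short_exact_surj (ex (K n)) w.
  have [|k0 [uE vE]] := short_exact_lift (ex (K (n + 1)))
     (u := u \co e + fmap G1 (fmap F0 (cd K n)) \co u')
     (v := v \co e + fmap G0 (fmap F1 (cd K n)) \co v').
    by rewrite lift_sum -ew !compA -!compDl uvw comp0c.
  exists S, e, k0; split=> //=; apply: (short_exact_inj (ex _)).
    rewrite compNl compNr -r_nat -uE compDr (fmap2_eq0 _ (cdd _ _)).
    by rewrite addr0 !compA ru compNl.
  rewrite compNl compNr -s_nat -vE compDr (fmap2_eq0 _ (cdd _ _)).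
  by rewrite addr0 !compA sv compNl.
apply/Hmap_epi => T l; have [u [v [w ->]]] := gf_split l.
rewrite gf_cd => /gf_eq0[/eqP du /eqP dv uvw].
have [S [e [u' [v' [ee ew]]]]] := short_exact_surj (ex (K (n + 1))) w.
have [|k0 [uE vE]] := short_exact_lift (ex (K (n + 1 + 1)))
   (u := u \co e + fmap G1 (fmap F0 (cd K (n + 1))) \co u')
   (v := v \co e + fmap G0 (fmap F1 (cd K (n + 1))) \co v').
  by rewrite lift_sum -ew !compA -!compDl uvw comp0c.
rewrite oppr_eq0 in du; rewrite oppr_eq0 in dv.
(* The boundary of [(u', v', 0)] has third component [w] and undoes the correction made to [u] and
   [v]. *)
exists S, e, k0, (gf1 n \co u' + gf2 n \co v' + gf3 n \co 0); split=> //.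
  rewrite /= compNl; apply/eqP; rewrite oppr_eq0; apply/eqP.
  apply: (short_exact_inj (ex _)); rewrite compc0.
    rewrite -r_nat -uE compDr (fmap2_eq0 _ (cdd _ _)).
    by rewrite !compA (eqP du) comp0c addr0.
  rewrite -s_nat -vE compDr (fmap2_eq0 _ (cdd _ _)).
  by rewrite !compA (eqP dv) comp0c addr0.
rewrite thE gf_cd -uE -vE compc0 !compc0 !addr0 -ew.
rewrite [RHS](_ : _ = gf1 (n + 1) \co (u \co e) + gf2 (n + 1) \co (v \co e) +
  gf3 (n + 1) \co (w \co e)).
  by rewrite !compDl -!compA.
by rewrite !compDr !compNr -!addcA addc_cancel.
Qed.

End Complex.

Local Notation TB K n := (bip (F1 (cx K (n + 1))) (F0 (cx K n))).
Local Notation TT K n := (bip (G1 (TB K (n + 1))) (G0 (TB K n))).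

Lemma theta_natural (K L : complex B) (f : chain_map K L) :
  cm_comp (tot_map del (tot_map eps f)) (theta_obj K) =
  cm_comp (theta_obj L) (shift_map f).
Proof.
apply: chain_mapP => n.
have e1 : bmap (TT K n) (TT L n) (fmap G1 (tot_map eps f (n + 1))) (fmap G0 (tot_map eps f n))
    \co (gf1 K n \co r (K (n + 1))) = gf1 L n \co r (L (n + 1)) \co f (n + 1).
  rewrite -!compA bmap1E fmap_bmap2; congr (_ \co (_ \co _)).
  exact/esym/(naturality r).
have e2 : bmap (TT K n) (TT L n) (fmap G1 (tot_map eps f (n + 1))) (fmap G0 (tot_map eps f n))
    \co (gf2 K n \co s (K (n + 1))) = gf2 L n \co s (L (n + 1)) \co f (n + 1).
  rewrite -!compA bmap2E fmap_bmap1; congr (_ \co (_ \co _)).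
  exact/esym/(naturality s).
transitivity (bmap (TT K n) (TT L n) (fmap G1 (tot_map eps f (n + 1)))
  (fmap G0 (tot_map eps f n)) \co (gf1 K n \co r (K (n + 1)) + gf2 K n \co s (K (n + 1)))) => //.
by rewrite compDr e1 e2 -compDl.
Qed.

End Theta.

Section Psi.
Variable a : nat_trans (comp_functor F1 G0) (id_functor B').
Variable b : nat_trans (comp_functor F0 G1) (id_functor B').
Hypothesis F0G0 : forall X, idc (F0 (G0 X)) = 0.
Hypothesis ex : forall X, short_exact (X := F1 (G1 X))
  (- fmap F1 (del X)) (eps (G1 X)) (a X) (b X).

Lemma psi_square X : a X \co fmap F1 (del X) = b X \co eps (G1 X).
Proof.
have := (ex X).1.1; rewrite compDl !compDr -!compA !bipE !compc0 addr0 add0r compNr.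
by move=> /eqP; rewrite addcC subr_eq0 => /eqP.
Qed.

Section Complex.
Variable K : complex B'.
Local Notation TB n := (bip (G1 (cx K (n + 1))) (G0 (cx K n))).
Local Notation TT n := (bip (F1 (TB (n + 1))) (F0 (TB n))).
Local Notation GK := (tot_obj del K).
Local Notation FGK := (tot_obj eps GK).

(* FGK has only three nonzero summands, since F0 (G0 X) = 0. *)
Definition fg1 n : hom (F1 (G1 (K (n + 1 + 1)))) (TT n) :=
  inj1 (TT n) \co fmap F1 (inj1 (TB (n + 1))).
Definition fg2 n : hom (F1 (G0 (K (n + 1)))) (TT n) :=
  inj1 (TT n) \co fmap F1 (inj2 (TB (n + 1))).
Definition fg3 n : hom (F0 (G1 (K (n + 1)))) (TT n) :=
  inj2 (TT n) \co fmap F0 (inj1 (TB n)).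

Lemma fg_split n T (t : hom T (TT n)) :
  exists m l k, t = fg1 n \co m + fg2 n \co l + fg3 n \co k.
Proof.
pose t1 := prj1 (TT n) \co t; pose t2 := prj2 (TT n) \co t.
exists (fmap F1 (prj1 (TB (n + 1))) \co t1), (fmap F1 (prj2 (TB (n + 1))) \co t1),
  (fmap F0 (prj1 (TB n)) \co t2).
rewrite -!compA -compDr -(bip_split (B := fbip F1 (TB (n + 1)))).
rewrite [LHS](bip_split (B := TT n)) -/t1 -/t2; congr (_ + _ \co _).
rewrite [LHS](bip_split (B := fbip F0 (TB n))) /=.
rewrite -[fmap F0 (prj2 _)]comp1c F0G0 !comp0c compc0 addr0.
by [].
Qed.

Lemma fg_inj n T u v w u' v' w' :
  fg1 n \co u + fg2 n \co v + fg3 n \co w = fg1 n \co u' + fg2 n \co v' + fg3 n \co w' ->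
  [/\ u = u' :> hom T _, v = v' & w = w'].
Proof.
rewrite -!compA -!compDr => /bip_eq[/(bip_eq (B := fbip F1 (TB (n + 1))))[-> ->] e1].
split=> //; have := congr1 (comp (fmap F0 (prj1 (TB n)))) e1.
by rewrite !compA -fmapM bipE fmap1 !comp1c.
Qed.

Lemma fg_eq0 n T u v w :
  fg1 n \co u + fg2 n \co v + fg3 n \co w = 0 :> hom T _ -> [/\ u = 0, v = 0 & w = 0].
Proof. by move=> e; apply: fg_inj; rewrite e !compc0 !addr0. Qed.

Lemma fg1_cd n T (u : hom T _) : cd FGK n \co (fg1 n \co u) =
  fg1 (n + 1) \co (fmap F1 (fmap G1 (cd K (n + 1 + 1))) \co u) -
  fg2 (n + 1) \co (fmap F1 (del (K (n + 1 + 1))) \co u) +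
  fg3 (n + 1) \co (eps (G1 (K (n + 1 + 1))) \co u).
Proof.
rewrite -!compA [LHS](tot_cd1 eps (K := GK)) fmap_tot_cd1 /= opprD !compNr opprK compDr compNr.
congr (_ - _ + _ \co _).
by rewrite !compA; congr (_ \co _); apply: naturality.
Qed.

Lemma fg2_cd n T (u : hom T _) : cd FGK n \co (fg2 n \co u) =
  - (fg2 (n + 1) \co (fmap F1 (fmap G0 (cd K (n + 1))) \co u)).
Proof.
rewrite -!compA [LHS](tot_cd1 eps (K := GK)) fmap_tot_cd2 /= compNr.
rewrite (compA (eps _)).
have -> : eps (GK (n + 1)) \co fmap F1 (inj2 (TB (n + 1))) =
    fmap F0 (inj2 (TB (n + 1))) \co (idc _ \co eps _).
  by rewrite comp1c; apply: naturality.
by rewrite F0G0 comp0c compc0 comp0c compc0 addr0.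
Qed.

Lemma fg3_cd n T (u : hom T _) : cd FGK n \co (fg3 n \co u) =
  - (fg3 (n + 1) \co (fmap F0 (fmap G1 (cd K (n + 1))) \co u)).
Proof.
rewrite -!compA [LHS](tot_cd2 eps (K := GK)) fmap_tot_cd1 /=.
rewrite -[fmap F0 (del _)]comp1c F0G0 !comp0c compc0 addr0 !compNr.
by [].
Qed.

Lemma fg_cd n T u v w :
  cd FGK n \co (fg1 n \co u + fg2 n \co v + fg3 n \co w : hom T _) =
  fg1 (n + 1) \co (fmap F1 (fmap G1 (cd K (n + 1 + 1))) \co u) +
  fg2 (n + 1) \co - (fmap F1 (del (K (n + 1 + 1))) \co u +
    fmap F1 (fmap G0 (cd K (n + 1))) \co v) +
  fg3 (n + 1) \co (eps (G1 (K (n + 1 + 1))) \co u -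
    fmap F0 (fmap G1 (cd K (n + 1))) \co w).
Proof.
rewrite !compDr fg1_cd fg2_cd fg3_cd opprD !compDr !compNr !addcA.
congr (_ - _); exact: addcAC.
Qed.

(** Up to sign, [FGK] is the shifted cone of [F1 G1 K -> F1 G0 K (+) F0 G1 K], a monomorphism with
    cokernel [K] by exactness; this is the projection to that cokernel, zero on [fg1]. *)
Definition psi_map n : hom (TT n) (K (n + 1)) :=
  a (K (n + 1)) \co (fmap F1 (prj2 (TB (n + 1))) \co prj1 (TT n)) +
  b (K (n + 1)) \co (fmap F0 (prj1 (TB n)) \co prj2 (TT n)).

Lemma psi_mapE m T u v w : psi_map m \co (fg1 m \co u + fg2 m \co v + fg3 m \co w) =
  a _ \co v + b _ \co w :> hom T _.
Proof.
rewrite compDl !compDr -!compA !bipE !(compA (fmap F1 _) (fmap F1 _)).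
rewrite !(compA (fmap F0 _) (fmap F0 _)) -!fmapM !bipE !fmap1 fmap0 comp0c.
by rewrite !compc0 !comp1c !add0r addr0.
Qed.

Lemma fg_ext n (Z : B') (f g : hom (TT n) Z) :
  (forall T u v w, f \co (fg1 n \co u + fg2 n \co v + fg3 n \co w : hom T _) =
    g \co (fg1 n \co u + fg2 n \co v + fg3 n \co w)) -> f = g.
Proof.
move=> e; rewrite -[f]compc1 -[g]compc1.
by have [u [v [w ->]]] := fg_split (idc (TT n)); apply: e.
Qed.

Lemma a_nat X Y (f : hom X Y) T (k : hom T _) :
  f \co (a X \co k) = a Y \co (fmap F1 (fmap G0 f) \co k).
Proof. by rewrite !compA (naturality a f). Qed.

Lemma b_nat X Y (f : hom X Y) T (k : hom T _) :
  f \co (b X \co k) = b Y \co (fmap F0 (fmap G1 f) \co k).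
Proof. by rewrite !compA (naturality b f). Qed.

Lemma del_nat X Y (f : hom X Y) T (k : hom T _) :
  fmap F1 (del Y) \co (fmap F1 (fmap G1 f) \co k) =
  fmap F1 (fmap G0 f) \co (fmap F1 (del X) \co k).
Proof. by rewrite !compA -!(fmapM F1) naturality. Qed.

Lemma eps_nat X Y (f : hom X Y) T (k : hom T _) :
  eps (G1 Y) \co (fmap F1 (fmap G1 f) \co k) =
  fmap F0 (fmap G1 f) \co (eps (G1 X) \co k).
Proof. by rewrite !compA naturality. Qed.

Lemma psi_square_map X T (k : hom T _) :
  a X \co (fmap F1 (del X) \co k) = b X \co (eps (G1 X) \co k).
Proof. by rewrite !compA psi_square. Qed.

Program Definition psi_obj : chain_map FGK (shift_obj K) :=
  ChainMap (K := FGK) (L := shift_obj K) (cmap := psi_map) _.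
Next Obligation.
move=> n; apply: fg_ext => T u v w.
rewrite -[LHS]compA fg_cd -[RHS]compA !psi_mapE /= compNr compNl !compDr compNr.
rewrite psi_square_map a_nat b_nat opprD opprD addcA (addcAC (- _)).
by rewrite addNr add0r.
Qed.

Lemma psi_qiso : quasi_iso (psi_obj : @hom (complex_cat B') FGK (shift_obj K)).
Proof.
move=> n; apply: mono_epi_iso.
  apply/Hmap_mono => T g z; have [m [l [k ->]]] := fg_split g.
  rewrite fg_cd => /fg_eq0[dm /eqP dl /eqP dk]; rewrite psi_mapE => zE.
  have dlE : fmap F1 (del (K (n + 1 + 1 + 1))) \co m =
      - (fmap F1 (fmap G0 (cd K (n + 1 + 1))) \co l).
    by apply/eqP; rewrite -addr_eq0 -oppr_eq0.
  have dkE : eps (G1 (K (n + 1 + 1 + 1))) \co m =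
      fmap F0 (fmap G1 (cd K (n + 1 + 1))) \co k.
    by apply/eqP; rewrite -subr_eq0.
  (* Lifting [z] to [(l0, k0)] and adding its differential to [(l, k)] gives a pair killed by
     [(a, b)], hence coming from some [m0]; the primitive of [(m, l, k)] is [(m0, l0, k0)]. *)
  have [S [e [l0 [k0 [ee ez]]]]] := short_exact_surj (ex (K (n + 1))) z.
  have [|m0 [lE kE]] := short_exact_lift (ex (K (n + 1 + 1)))
      (u := l \co e + fmap F1 (fmap G0 (cd K (n + 1))) \co l0)
      (v := k \co e + fmap F0 (fmap G1 (cd K (n + 1))) \co k0).
    rewrite !compDr -a_nat -b_nat !addcA (addcAC (a _ \co _)).
    rewrite -addcA -compDr -ez !compA -compDl zE.
    by rewrite !(compNl, compA) addNr.
  exists S, e, (fg1 n \co m0 + fg2 n \co l0 + fg3 n \co k0); split=> //.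
  rewrite fg_cd.
  (* The component in [F1 G1] is forced: [(- del, eps)] is injective, and both sides have the same
     image because [(m, l, k)] is a cycle. *)
  have mE : fmap F1 (fmap G1 (cd K (n + 1 + 1))) \co m0 = m \co e.
    apply: (short_exact_inj (ex _)).
      rewrite compNl del_nat -compNr -compNl -lE compDr (fmap2_eq0 _ (cdd _ _)) addr0.
      rewrite compNl (compA _ m) dlE compNl opprK.
      by rewrite compA.
    rewrite eps_nat -kE compDr (fmap2_eq0 _ (cdd _ _)) addr0 (compA _ m) dkE.
    by rewrite compA.
  rewrite mE !compDl -!(compA _ _ e).
  have -> : l \co e =
      - (fmap F1 (del (K (n + 1 + 1))) \co m0 + fmap F1 (fmap G0 (cd K (n + 1))) \co l0).
    by rewrite opprD -compNl -lE addrK.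
  have -> // : k \co e =
      eps (G1 (K (n + 1 + 1))) \co m0 - fmap F0 (fmap G1 (cd K (n + 1))) \co k0.
  by rewrite -kE addrK.
apply/Hmap_epi => T z dz.
(* Since [z] is a cycle, the differential of its lift [(l0, k0)] comes from some [m0]. Then
   [(m0, l0, k0)] is a cycle mapping exactly to [z] over the cover, whence the zero boundary
   term. *)
have [S [e [l0 [k0 [ee ez]]]]] := short_exact_surj (ex (K (n + 1 + 1))) z.
have [|m0 [lE kE]] := short_exact_lift (ex (K (n + 1 + 1 + 1)))
    (u := fmap F1 (fmap G0 (cd K (n + 1 + 1))) \co l0)
    (v := fmap F0 (fmap G1 (cd K (n + 1 + 1))) \co k0).
  rewrite -a_nat -b_nat -compDr -ez compA; move: dz.
  by rewrite /= compNl => /eqP; rewrite oppr_eq0 => /eqP ->; rewrite comp0c.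
exists S, e, (fg1 (n + 1) \co m0 + fg2 (n + 1) \co l0 + fg3 (n + 1) \co k0), 0.
rewrite compc0 addr0 psi_mapE fg_cd; split=> //.
have -> : fmap F1 (fmap G1 (cd K (n + 1 + 1 + 1))) \co m0 = 0.
  apply: (short_exact_inj (ex _)); rewrite compc0.
    rewrite compNl del_nat -compNr -compNl -lE.
    by rewrite (fmap2_eq0 _ (cdd _ _)).
  rewrite eps_nat -kE.
  by rewrite (fmap2_eq0 _ (cdd _ _)).
by rewrite lE kE compNl !addrN oppr0 !compc0 !addr0.
Qed.
End Complex.

Local Notation TB K n := (bip (G1 (cx K (n + 1))) (G0 (cx K n))).
Local Notation TT K n := (bip (F1 (TB K (n + 1))) (F0 (TB K n))).

Lemma fg_map (K L : complex B') (f : chain_map K L) n T u v w :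
  bmap (TT K n) (TT L n) (fmap F1 (tot_map del f (n + 1))) (fmap F0 (tot_map del f n)) \co
    (fg1 K n \co u + fg2 K n \co v + fg3 K n \co w) =
  fg1 L n \co (fmap F1 (fmap G1 (f (n + 1 + 1))) \co u) +
  fg2 L n \co (fmap F1 (fmap G0 (f (n + 1))) \co v) +
  fg3 L n \co (fmap F0 (fmap G1 (f (n + 1))) \co w) :> hom T _.
Proof.
rewrite !(compDr (bmap _ _ _ _)) -!compA !bmap1E bmap2E.
by rewrite !(fmap_bmap1, fmap_bmap2).
Qed.

Lemma psi_natural (K L : complex B') (f : chain_map K L) :
  cm_comp (psi_obj L) (tot_map eps (tot_map del f)) =
  cm_comp (shift_map f) (psi_obj K).
Proof.
apply: chain_mapP => n; apply: fg_ext => T u v w.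
rewrite -[RHS]compA psi_mapE -[LHS]compA [X in _ \co X]fg_map psi_mapE.
by rewrite compDr a_nat b_nat.
Qed.

End Psi.
End Adjoint.

(** * Localization and distinguished triangles *)

Lemma comp_fmapE (C D E : category) (G : functor D E) (F : functor C D) X Y (f : hom X Y) :
  fmap (comp_functor G F) f = fmap G (fmap F f).
Proof. by []. Qed.

Lemma id_fmapE (C : category) (X Y : C) (f : hom X Y) : fmap (id_functor C) f = f.
Proof. by []. Qed.

Lemma fmap_square (C D : category) (F : functor C D) (X Y Y' Z : C)
    (a : hom X Y) (b : hom Y Z) (c : hom X Y') (d : hom Y' Z) :
  b \co a = d \co c -> fmap F b \co fmap F a = fmap F d \co fmap F c.
Proof. by rewrite -!fmapM => ->. Qed.

Section NaturalIso.

Lemma fmap_iso (C D : category) (F : functor C D) (X Y : C) (f : hom X Y) :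
  is_iso f -> is_iso (fmap F f).
Proof. by move=> [g [gf fg]]; exists (fmap F g); rewrite -!fmapM gf fg !fmap1. Qed.

Lemma nat_iso_sym (C D : category) (F G : functor C D) :
  naturally_isomorphic F G -> naturally_isomorphic G F.
Proof.
move=> [a aI]; pose b X := sval (cid (aI X)).
have bP X : b X \co a X = idc _ /\ a X \co b X = idc _ by rewrite /b; case: cid.
have bN X Y (f : hom X Y) : b Y \co fmap G f = fmap F f \co b X.
  rewrite -[LHS]compc1 -(bP X).2 compA -(compA (b Y)) -naturality.
  by rewrite !compA (bP Y).1 comp1c.
by exists (NatTrans b bN) => X; exists (a X); case: (bP X).
Qed.

Lemma nat_iso_trans (C D : category) (F G H : functor C D) :
  naturally_isomorphic F G -> naturally_isomorphic G H -> naturally_isomorphic F H.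
Proof.
move=> [a aI] [b bI]; exists (nt_comp b a) => X; exact: is_iso_comp.
Qed.

Lemma nat_isoE (C D : category) (F G : functor C D) (a : forall X, hom (F X) (G X)) :
  (forall X Y (f : hom X Y), a Y \co fmap F f = fmap G f \co a X) ->
  (forall X, is_iso (a X)) -> naturally_isomorphic F G.
Proof. by move=> aN aI; exists (NatTrans a aN). Qed.

Variables (D D' : category) (S U : functor D D) (S' U' : functor D' D').
Variables (F : functor D D') (G : functor D' D).

(** The quasi-inverse is [U G]. Up to natural isomorphism, [U G F = U S = 1] and [F U G = U' S' F U
    G = U' F S U G = U' F G = U' S' = 1]; inserting [U' S'] means that only commutation of [F] with
    the shifts is called upon. *)
Lemma equivalence_up_to_shift :
  naturally_isomorphic (comp_functor U S) (id_functor D) ->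
  naturally_isomorphic (comp_functor U' S') (id_functor D') ->
  naturally_isomorphic (comp_functor S U) (id_functor D) ->
  naturally_isomorphic (comp_functor S' F) (comp_functor F S) ->
  naturally_isomorphic (comp_functor G F) S ->
  naturally_isomorphic (comp_functor F G) S' -> is_equivalence F.
Proof.
move=> US US' SU SF GF FG; exists (comp_functor U G); split.
  apply: nat_iso_trans US; case: GF => a aI.
  apply: (@nat_isoE _ _ (comp_functor (comp_functor U G) F) (comp_functor U S)
    (fun X => fmap U (a X))) => [X Y f|X] /=.
    by rewrite -!fmapM -(naturality a).
  exact/fmap_iso/aI.
pose E := comp_functor F (comp_functor U G).
apply: (@nat_iso_trans _ _ _ (comp_functor U' (comp_functor S' E))).
  case: (nat_iso_sym US') => u uI.
  apply: (@nat_isoE _ _ E (comp_functor U' (comp_functor S' E)) (fun X => u (E X))) => [X Y f|X].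
    exact: (naturality u).
  exact: uI.
pose H := comp_functor U' F.
apply: (@nat_iso_trans _ _ _ (comp_functor H (comp_functor S (comp_functor U G)))).
  case: SF => v vI.
  apply: (@nat_isoE _ _ (comp_functor U' (comp_functor S' E))
    (comp_functor H (comp_functor S (comp_functor U G)))
    (fun X => fmap U' (v (U (G X))))) => [X Y f|X] /=.
    by rewrite -!fmapM -(naturality v).
  exact/fmap_iso/vI.
apply: (@nat_iso_trans _ _ _ (comp_functor H G)).
  case: SU => w wI.
  apply: (@nat_isoE _ _ (comp_functor H (comp_functor S (comp_functor U G)))
    (comp_functor H G) (fun X => fmap H (w (G X)))) => [X Y f|X].
    by rewrite /= -!fmapM -(naturality w).
  exact: (fmap_iso H (wI (G X))).
apply: nat_iso_trans US'; case: FG => a aI.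
apply: (@nat_isoE _ _ (comp_functor H G) (comp_functor U' S')
  (fun X => fmap U' (a X))) => [X Y f|X] /=.
  by rewrite -!fmapM -(naturality a).
exact/fmap_iso/aI.
Qed.
End NaturalIso.

Section Localization.
Variables (C : category) (W : forall X Y : C, hom X Y -> Prop).
Local Notation Q := (loc_functor W).

Lemma loc_iso X Y (w : hom X Y) : W w -> is_iso (fmap Q w).
Proof.
move=> Ww; exists (loc_class (LocInv Ww) : @hom (localization W) Y X).
by split; rewrite loc_class_comp; apply/loc_classP; [apply: loc_invl|apply: loc_invr].
Qed.

(** Morphisms of the localization are classes of words, so naturality is checked on generators: it
    is assumed on maps of [C], and it passes to inverses and composites. *)
Lemma loc_natural (E : category) (P R : functor (localization W) E)
    (a : forall X : C, hom (P X) (R X)) :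
  (forall (X Y : C) (f : hom X Y), a Y \co fmap P (fmap Q f) = fmap R (fmap Q f) \co a X) ->
  forall (X Y : localization W) (f : hom X Y), a Y \co fmap P f = fmap R f \co a X.
Proof.
move=> aQ X Y f; rewrite -(loc_reprK f); elim: (loc_repr f) => {X Y f}.
- exact: aQ.
- move=> X Y w Ww; set i : @hom (localization W) Y X := loc_class _.
  have qi : fmap Q w \co i = idc _.
    by rewrite loc_class_comp; apply/loc_classP/loc_invr.
  have iq : i \co fmap Q w = idc _.
    by rewrite loc_class_comp; apply/loc_classP/loc_invl.
  rewrite -[LHS]comp1c -fmap1 -iq fmapM -!compA (compA (fmap R (fmap Q w))) -aQ.
  by rewrite -!compA -fmapM qi fmap1 compc1.
move=> X Y Z b IHb c IHc.
by rewrite -loc_class_comp !fmapM compA IHb -compA IHc compA.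
Qed.

End Localization.

Lemma localized_of (C D : category) (W : forall X Y : C, hom X Y -> Prop)
    (V : forall X Y : D, hom X Y -> Prop) (F : functor C D)
    (FW : forall (X Y : C) (f : hom X Y), W X Y f -> V _ _ (fmap F f)) X Y (f : hom X Y) :
  fmap (localized_functor FW) (fmap (loc_functor W) f) = fmap (loc_functor V) (fmap F f).
Proof.
apply/loc_classP; rewrite -[LocOf V _]/(loc_word_map FW (LocOf W f)).
exact/loc_word_map_eq/loc_classK.
Qed.

Section Cast.
Variables (C : category) (I : Type) (x : I -> C).

(** Transport along an equality of indices: [n - 1 + 1] equals [n] but is not convertible to it, and
    an inverse of the shift has to move between these degrees. *)
Definition castc n m (e : n = m) : hom (x n) (x m) :=
  match e in _ = m return hom (x n) (x m) with erefl => idc (x n) end.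

Lemma castc_comp n m p (e : n = m) (e' : m = p) : castc e' \co castc e = castc (etrans e e').
Proof. by case: p / e'; case: m / e; rewrite /= comp1c. Qed.

Lemma castc_id n (e : n = n) : castc e = idc (x n).
Proof. by rewrite (Prop_irrelevance e erefl). Qed.

Lemma castc_iso n m (e : n = m) : is_iso (castc e).
Proof. by exists (castc (esym e)); rewrite !castc_comp !castc_id. Qed.

End Cast.

Lemma castc_nat (C : category) (x y : int -> C) (f : forall n, hom (x n) (y n)) n m (e : n = m) :
  f m \co castc x e = castc y e \co f n.
Proof. by case: m / e; rewrite /= comp1c compc1. Qed.

(** * An inverse of the shift on complexes *)

Section Unshift.
Variable A : abelian.
Local Notation Ch := (complex_cat A).

Lemma cd_castc (K : complex A) n m (e : n = m) (e1 : n + 1 = m + 1) :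
  cd K m \co castc K e = castc K e1 \co cd K n.
Proof. by case: m / e e1 => e1; rewrite !castc_id comp1c compc1. Qed.

Fact unshift_deg (n : int) : n - 1 + 1 = n + 1 - 1.
Proof. by rewrite addrAC. Qed.

Program Definition unshift_obj (K : complex A) : complex A :=
  Complex (cx := fun n => K (n - 1))
    (cd := fun n => - (castc K (unshift_deg n) \co cd K (n - 1))) _.
Next Obligation.
move=> K n; rewrite compNl compNr opprK -!compA (compA (cd K _)).
rewrite (cd_castc _ _ (congr1 (fun m => m + 1) (unshift_deg n))) -compA cdd.
by rewrite !compc0.
Qed.

Program Definition unshift_map (K L : complex A) (f : chain_map K L) :
    chain_map (unshift_obj K) (unshift_obj L) :=
  ChainMap (K := unshift_obj K) (L := unshift_obj L) (cmap := fun n => f (n - 1)) _.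
Next Obligation.
move=> K L f n; rewrite /= compNl compNr compA (castc_nat f) -!compA.
by rewrite cmap_cd.
Qed.

Program Definition unshift : functor Ch Ch := @Functor Ch Ch unshift_obj unshift_map _ _.
Next Obligation. by move=> K; apply: chain_mapP. Qed.
Next Obligation. by move=> *; apply: chain_mapP. Qed.

Lemma castc_shift (K : complex A) n m (e : n = m) (e1 : n + 1 = m + 1) :
  castc (shift_obj K) e = castc K e1.
Proof. by case: m / e e1 => e1; rewrite !castc_id. Qed.

Program Definition shiftK (K : complex A) : chain_map (unshift_obj (shift_obj K)) K :=
  ChainMap (K := unshift_obj (shift_obj K)) (L := K) (cmap := fun n => castc K (subrK 1 n)) _.
Next Obligation.
move=> K n; rewrite (cd_castc _ _ (congr1 (fun m => m + 1) (subrK 1 n))) /= !compNr opprK.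
rewrite (castc_shift _ _ (congr1 (fun m => m + 1) (unshift_deg n))) compA castc_comp.
by congr (castc K _ \co _); apply: Prop_irrelevance.
Qed.

Program Definition unshiftK (K : complex A) : chain_map (shift_obj (unshift_obj K)) K :=
  ChainMap (K := shift_obj (unshift_obj K)) (L := K) (cmap := fun n => castc K (addrK 1 n)) _.
Next Obligation.
move=> K n; rewrite (cd_castc _ _ (congr1 (fun m => m + 1) (addrK 1 n))) /= opprK.
rewrite compA castc_comp.
by congr (castc K _ \co _); apply: Prop_irrelevance.
Qed.

Lemma shiftK_natural (K L : complex A) (f : chain_map K L) :
  cm_comp (shiftK L) (unshift_map (shift_map f)) = cm_comp f (shiftK K).
Proof. by apply: chain_mapP => n /=; rewrite (castc_nat f). Qed.

Lemma unshiftK_natural (K L : complex A) (f : chain_map K L) :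
  cm_comp (unshiftK L) (shift_map (unshift_map f)) = cm_comp f (unshiftK K).
Proof. by apply: chain_mapP => n /=; rewrite (castc_nat f). Qed.

Lemma shiftK_iso (K : Ch) : is_iso (shiftK K : @hom Ch (unshift_obj (shift_obj K)) K).
Proof. by apply: chain_iso => n; apply: castc_iso. Qed.

Lemma unshiftK_iso (K : Ch) : is_iso (unshiftK K : @hom Ch (shift_obj (unshift_obj K)) K).
Proof. by apply: chain_iso => n; apply: castc_iso. Qed.

(** In the elementwise criteria the shift only negates differentials, which is absorbed by negating
    the elements that they are applied to. *)
Lemma qiso_of_shift (K L : Ch) (f : hom K L) :
  quasi_iso (fmap (complex_shift A) f) -> quasi_iso f.
Proof.
move=> qf; apply: int_succ_ind => n; apply: mono_epi_iso.
  have /Hmap_mono m := is_iso_mono (qf n); apply/Hmap_mono => T k l dk fk.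
  have [||S [e [k' [ee ek]]]] := m T k (- l).
  - by rewrite /= compNl dk oppr0.
  - by rewrite /= compNl compNr opprK.
  by exists S, e, (- k'); split=> //; rewrite compNr -ek /= compNl.
have /Hmap_epi m := is_iso_epi (qf n); apply/Hmap_epi => T l dl.
have [|S [e [k [l' [ee dk el]]]]] := m T l; first by rewrite /= compNl dl oppr0.
exists S, e, k, (- l'); split=> //; last by rewrite el /= compNl compNr.
by apply/eqP; rewrite -oppr_eq0 -compNl; apply/eqP.
Qed.

(** Shifted back, [fmap unshift f] is conjugate to [f] by the isomorphisms [unshiftK], and the shift
    reflects quasi-isomorphisms. *)
Lemma qiso_unshift (K L : Ch) (f : hom K L) : quasi_iso f -> quasi_iso (fmap unshift f).
Proof.
move=> qf; apply: qiso_of_shift.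
have [v [vu uv]] := unshiftK_iso L.
suff -> : fmap (complex_shift A) (fmap unshift f) =
    v \co (f \co (unshiftK K : @hom Ch (shift_obj (unshift_obj K)) K)).
  apply: qiso_comp (qiso_comp qf _); last exact/iso_qiso/unshiftK_iso.
  by apply: iso_qiso; exists (unshiftK L).
have := unshiftK_natural f; rewrite -[cm_comp f _]/(f \co (unshiftK K : @hom Ch _ K)) => <-.
rewrite -[cm_comp _ _]/((unshiftK L : @hom Ch _ L) \co fmap (complex_shift A) (fmap unshift f)).
by rewrite compA vu comp1c.
Qed.

End Unshift.

(** * Descent from complexes to derived categories *)

Section Triangulated.
Variables (B B' : abelian).
Local Notation Ch := (complex_cat B).
Local Notation Ch' := (complex_cat B').
Local Notation Q := (quotient_functor B).
Local Notation Q' := (quotient_functor B').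
Variables (F : functor Ch Ch') (G : functor Ch' Ch).
Hypothesis Fq : forall (K L : Ch) (f : hom K L), quasi_iso f -> quasi_iso (fmap F f).
Hypothesis Gq : forall (K L : Ch') (f : hom K L), quasi_iso f -> quasi_iso (fmap G f).
Variable sh : forall K : Ch, @hom Ch' (F (shift_obj K)) (shift_obj (F K)).
Hypothesis sh_natural : forall (K L : Ch) (f : hom K L),
  fmap (complex_shift B') (fmap F f) \co sh K = sh L \co fmap F (fmap (complex_shift B) f).
Hypothesis sh_iso : forall K, is_iso (sh K).
Variable co : forall (K L : Ch) (f : hom K L), @hom Ch' (F (cone f)) (cone (fmap F f)).
Hypothesis co_iso : forall (K L : Ch) (f : hom K L), is_iso (co f).
Hypothesis co_inj : forall (K L : Ch) (f : hom K L),
  co f \co fmap F (cone_inj f : @hom Ch L (cone f)) = cone_inj (fmap F f).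
Hypothesis co_prj : forall (K L : Ch) (f : hom K L),
  (cone_prj (fmap F f) : @hom Ch' (cone (fmap F f)) (shift_obj (F K))) \co co f =
  sh K \co fmap F (cone_prj f : @hom Ch (cone f) (shift_obj K)).
Variable theta : forall K : Ch, @hom Ch (shift_obj K) (G (F K)).
Hypothesis theta_natural : forall (K L : Ch) (f : hom K L),
  fmap G (fmap F f) \co theta K = theta L \co fmap (complex_shift B) f.
Hypothesis theta_qiso : forall K, quasi_iso (theta K).
Variable psi : forall K : Ch', @hom Ch' (F (G K)) (shift_obj K).
Hypothesis psi_natural : forall (K L : Ch') (f : hom K L),
  psi L \co fmap F (fmap G f) = fmap (complex_shift B') f \co psi K.
Hypothesis psi_qiso : forall K, quasi_iso (psi K).

Local Notation LF := (localized_functor Fq).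
Local Notation LG := (localized_functor Gq).

Lemma quasi_iso_loc (A : abelian) (K L : complex_cat A) (f : hom K L) :
  quasi_iso f -> is_iso (fmap (quotient_functor A) f).
Proof. exact: loc_iso. Qed.

Lemma loc_nat_isoE (A : abelian) (E : category) (P R : functor (derived_cat A) E)
    (a : forall K : complex_cat A, hom (P K) (R K)) :
  (forall (K L : complex_cat A) (f : hom K L),
    a L \co fmap P (fmap (quotient_functor A) f) =
    fmap R (fmap (quotient_functor A) f) \co a K) ->
  (forall K, is_iso (a K)) -> naturally_isomorphic P R.
Proof. by move=> aN; apply: (@nat_isoE (derived_cat A) E P R a); apply: loc_natural. Qed.

Definition derived_unshift (A : abelian) : functor (derived_cat A) (derived_cat A) :=
  localized_functor (@qiso_unshift A).

Lemma derived_shift_of (A : abelian) (K L : complex_cat A) (f : hom K L) :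
  fmap (derived_shift A) (fmap (quotient_functor A) f) =
  fmap (quotient_functor A) (fmap (complex_shift A) f).
Proof. exact: localized_of. Qed.

Lemma derived_unshift_of (A : abelian) (K L : complex_cat A) (f : hom K L) :
  fmap (derived_unshift A) (fmap (quotient_functor A) f) =
  fmap (quotient_functor A) (fmap (unshift A) f).
Proof. exact: localized_of. Qed.

Lemma LF_of (K L : Ch) (f : hom K L) : fmap LF (fmap Q f) = fmap Q' (fmap F f).
Proof. exact: localized_of. Qed.

Lemma LG_of (K L : Ch') (f : hom K L) : fmap LG (fmap Q' f) = fmap Q (fmap G f).
Proof. exact: localized_of. Qed.

Let derived_of := (derived_shift_of, derived_unshift_of, LF_of, LG_of).

Lemma derived_shiftK (A : abelian) :
  naturally_isomorphic (comp_functor (derived_unshift A) (derived_shift A))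
    (id_functor (derived_cat A)).
Proof.
apply: (@loc_nat_isoE _ _ (comp_functor (derived_unshift A) (derived_shift A))
  (id_functor (derived_cat A))
  (fun K => fmap (quotient_functor A)
    (shiftK K : @hom (complex_cat A) (unshift_obj (shift_obj K)) K))) => [K L f|K].
  rewrite ?comp_fmapE ?id_fmapE !derived_of.
  exact: (fmap_square (quotient_functor A) (shiftK_natural f)).
exact/quasi_iso_loc/iso_qiso/shiftK_iso.
Qed.

Lemma derived_unshiftK (A : abelian) :
  naturally_isomorphic (comp_functor (derived_shift A) (derived_unshift A))
    (id_functor (derived_cat A)).
Proof.
apply: (@loc_nat_isoE _ _ (comp_functor (derived_shift A) (derived_unshift A))
  (id_functor (derived_cat A))
  (fun K => fmap (quotient_functor A)
    (unshiftK K : @hom (complex_cat A) (shift_obj (unshift_obj K)) K))) => [K L f|K].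
  rewrite ?comp_fmapE ?id_fmapE !derived_of.
  exact: (fmap_square (quotient_functor A) (unshiftK_natural f)).
exact/quasi_iso_loc/iso_qiso/unshiftK_iso.
Qed.

Lemma localized_shift_natural (K L : derived_cat B) (f : hom K L) :
  fmap Q' (sh L) \co fmap LF (fmap (derived_shift B) f) =
  fmap (derived_shift B') (fmap LF f) \co fmap Q' (sh K).
Proof.
move: K L f; apply: (@loc_natural _ _ _ (comp_functor LF (derived_shift B))
  (comp_functor (derived_shift B') LF) (fun K => fmap Q' (sh K))) => K L f.
rewrite !comp_fmapE !derived_of; exact/esym/(fmap_square Q' (sh_natural f)).
Qed.

Lemma localized_equivalence : is_equivalence LF.
Proof.
apply: (equivalence_up_to_shift (S := derived_shift B) (U := derived_unshift B)
  (S' := derived_shift B') (U' := derived_unshift B') (G := LG)).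
- exact: derived_shiftK.
- exact: derived_shiftK.
- exact: derived_unshiftK.
- apply: nat_iso_sym; apply: (@nat_isoE _ _ (comp_functor LF (derived_shift B))
    (comp_functor (derived_shift B') LF) (fun K => fmap Q' (sh K))) => [K L f|K].
    exact: localized_shift_natural.
  exact: (fmap_iso Q' (sh_iso K)).
- apply: nat_iso_sym; apply: (@loc_nat_isoE _ _ (derived_shift B) (comp_functor LG LF)
    (fun K => fmap Q (theta K))) => [K L f|K].
    by rewrite !comp_fmapE !derived_of; exact/esym/(fmap_square Q (theta_natural f)).
  exact/quasi_iso_loc/theta_qiso.
apply: (@loc_nat_isoE _ _ (comp_functor LF LG) (derived_shift B')
  (fun K => fmap Q' (psi K))) => [K L f|K].
  by rewrite !comp_fmapE !derived_of; exact: (fmap_square Q' (psi_natural f)).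
exact/quasi_iso_loc/psi_qiso.
Qed.

Lemma localized_triangulated_equivalence : triangulated_equivalent (derived B) (derived B').
Proof.
exists LF, (@NatTrans _ _ (comp_functor LF (derived_shift B))
  (comp_functor (derived_shift B') LF) (fun K => fmap Q' (sh K)) localized_shift_natural).
split; first exact: localized_equivalence.
  by move=> K; exact: (fmap_iso Q' (sh_iso K)).
move=> X Y Z u v w [K [L [f [a [b [c [[aI bI cI] [ua vb wc]]]]]]]].
(* Inverting the comparison from [F (cone f)] to [cone (fmap F f)] exhibits the image triangle as
   isomorphic to the standard triangle of [fmap F f]. *)
have [d [dc cd]] := fmap_iso Q' (co_iso f).
exists (F K), (F L), (fmap F f), (fmap LF a), (fmap LF b), (fmap LF c \co d).
split; first split.
- exact: fmap_iso.
- exact: fmap_iso.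
- by apply: is_iso_comp; [apply: fmap_iso|exists (fmap Q' (co f))].
split.
- by have := congr1 (fun g => fmap LF g) ua; rewrite !fmapM LF_of.
- have := congr1 (fun g => fmap LF g) vb; rewrite !fmapM LF_of => e.
  rewrite [LHS]e -compA; congr (_ \co _).
  by rewrite -co_inj fmapM compA dc comp1c.
have := congr1 (fun g => fmap LF g) wc; rewrite !fmapM LF_of => e.
have e1 : fmap Q' (cone_prj (fmap F f) : @hom Ch' (cone (fmap F f)) (shift_obj (F K))) =
    fmap Q' (sh K) \co fmap Q' (fmap F (cone_prj f : @hom Ch (cone f) (shift_obj K))) \co d.
  by rewrite -fmapM -co_prj fmapM -compA cd compc1.
rewrite e1 !compA -[X in X \co _ \co d](localized_shift_natural a) -!compA.
by congr (_ \co _); have := congr1 (fun g => g \co d) e; rewrite -!compA.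
Qed.

End Triangulated.

Lemma tot_triangulated_equivalence (B B' : abelian)
    (F1 F0 : additive_functor B B') (eps : nat_trans F1 F0)
    (G1 G0 : additive_functor B' B) (del : nat_trans G1 G0)
    (r : nat_trans (id_functor B) (comp_functor G1 F0))
    (s : nat_trans (id_functor B) (comp_functor G0 F1))
    (a : nat_trans (comp_functor F1 G0) (id_functor B'))
    (b : nat_trans (comp_functor F0 G1) (id_functor B')) :
  [/\ preserves_exact F1, preserves_exact F0, preserves_exact G1 & preserves_exact G0] ->
  (forall X, idc (G1 (F1 X)) = 0) -> (forall X, idc (F0 (G0 X)) = 0) ->
  (forall X, short_exact (W := G0 (F0 X)) (r X) (s X) (del (F0 X)) (fmap G0 (eps X))) ->
  (forall X, short_exact (X := F1 (G1 X)) (- fmap F1 (del X)) (eps (G1 X)) (a X) (b X)) ->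
  triangulated_equivalent (derived B) (derived B').
Proof.
move=> [eF1 eF0 eG1 eG0] GF0 FG0 rs ab.
have Fq K L (f : @hom (complex_cat B) K L) : quasi_iso f -> quasi_iso (fmap (tot eps) f).
  exact: tot_qiso.
have Gq K L (f : @hom (complex_cat B') K L) : quasi_iso f -> quasi_iso (fmap (tot del) f).
  exact: tot_qiso.
apply: (@localized_triangulated_equivalence _ _ (tot eps) (tot del) Fq Gq
  (tot_shift eps) _ _ (fun K L f => tot_cone eps f) _ _ _
  (theta_obj rs) _ _ (psi_obj FG0 ab)).
- exact: tot_shift_natural.
- exact: tot_shift_iso.
- exact: tot_cone_iso.
- exact: tot_cone_injE.
- exact: tot_cone_prjE.
- exact: theta_natural.
- exact: theta_qiso.
- exact: psi_natural.
- exact: psi_qiso.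
Qed.

(** * Diagrams over a poset as matrices *)

Section BigComp.
Context {A : preadditive} {X Y Z : A} {I : Type}.

Lemma comp_suml (r : seq I) (P : pred I) (g : I -> hom Y Z) (f : hom X Y) :
  (\sum_(i <- r | P i) g i) \co f = \sum_(i <- r | P i) (g i \co f).
Proof. by apply: (big_morph (fun g => g \co f)) => [a b|]; rewrite ?compDl ?comp0c. Qed.

Lemma comp_sumr (r : seq I) (P : pred I) (g : hom Y Z) (f : I -> hom X Y) :
  g \co (\sum_(i <- r | P i) f i) = \sum_(i <- r | P i) (g \co f i).
Proof. by apply: (big_morph (fun f => g \co f)) => [a b|]; rewrite ?compDr ?compc0. Qed.

End BigComp.

Record nbiproduct (A : preadditive) (I : finType) (V : I -> A) := NBiproduct {
  nbip_obj :> A;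
  nin : forall i, hom (V i) nbip_obj;
  npr : forall i, hom nbip_obj (V i);
  npr_in : forall i, npr i \co nin i = idc (V i);
  npr_in0 : forall i j, i != j -> npr i \co nin j = 0;
  nbip_id : \sum_i nin i \co npr i = idc nbip_obj
}.
Arguments nin {A I V} n i.
Arguments npr {A I V} n i.

(** The object is [V tt] itself, so a functor built from it takes the value [K y] on the nose, and
    values of iterated functors can be compared by conversion. *)
Program Definition nbip_unit (A : preadditive) (V : unit -> A) : nbiproduct V :=
  @NBiproduct A unit V (V tt) (fun 'tt => idc _) (fun 'tt => idc _) _ _ _.
Next Obligation. by move=> A V []; rewrite comp1c. Qed.
Next Obligation. by move=> A V [] []. Qed.
Next Obligation. by move=> A V; rewrite (bigD1 tt) //= big1 ?addr0 ?comp1c => [|[]]. Qed.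

Program Definition nbip_void (A : abelian) (V : void -> A) : nbiproduct V :=
  @NBiproduct A void V (zero_obj A) (fun v => match v with end) (fun v => match v with end) _ _ _.
Next Obligation. by move=> A V []. Qed.
Next Obligation. by move=> A V []. Qed.
Next Obligation. by move=> A V; case: (zero_objP (zero_obj A)). Qed.

Lemma nbip_exists (A : abelian) (I : finType) (V : I -> A) : exists B : nbiproduct V, True.
Proof.
(* All indices are kept throughout the induction: those outside the list get zero injections and
   projections, and [p_ i \co i_ i = idc _] is required only for listed ones. *)
suff [O [i_ [p_ [pi1 pi0 sum_ip _]]]] : exists (O : A) (i_ : forall i, hom (V i) O)
    (p_ : forall i, hom O (V i)), [/\ forall i, i \in index_enum I -> p_ i \co i_ i = idc _,
      forall i j, i != j -> p_ i \co i_ j = 0, \sum_(i <- index_enum I) i_ i \co p_ i = idc O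
      & forall i, i \notin index_enum I -> i_ i = 0 /\ p_ i = 0].
  by exists (NBiproduct (fun i => pi1 i (mem_index_enum i)) pi0 sum_ip).
elim: (index_enum I) (index_enum_uniq I) => [_|x s IHs /=/andP[xs us]].
  exists (zero_obj A), (fun=> 0), (fun=> 0); split=> //.
  - by move=> *; rewrite comp0c.
  - by rewrite big_nil; case: (zero_objP (zero_obj A)) => + _.
have [O [i_ [p_ [pi1 pi0 sum_ip ip0]]]] := IHs us; pose B := bip (V x) O.
(* [t] and [t'] are the identity at the new index [x] and zero elsewhere; the transport is needed
   because [V i] and [V x] agree only through the equality of indices. *)
pose t i : hom (V i) (V x) := if i =P x is ReflectT e then castc V e else 0.
pose t' i : hom (V x) (V i) := if x =P i is ReflectT e then castc V e else 0.
have tx : t x = idc _ by rewrite /t; case: eqP => // e; rewrite castc_id.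
have tx' : t' x = idc _ by rewrite /t'; case: eqP => // e; rewrite castc_id.
have t0 i : i != x -> t i = 0 by rewrite /t; case: eqP.
have t0' i : i != x -> t' i = 0 by rewrite eq_sym /t'; case: eqP.
exists B, (fun i => inj1 B \co t i + inj2 B \co i_ i), (fun i => t' i \co prj1 B + p_ i \co prj2 B).
have E i j : (t' i \co prj1 B + p_ i \co prj2 B) \co (inj1 B \co t j + inj2 B \co i_ j) =
    t' i \co t j + p_ i \co i_ j.
  by rewrite compDl !compDr -!compA !bipE !compc0 addr0 add0r.
split.
- move=> i; rewrite E in_cons; have [->|ix] /= := eqVneq i x => [_|].
    by rewrite tx tx' comp1c (ip0 x xs).1 compc0 addr0.
  by move=> si; rewrite t0 // compc0 add0r pi1.
- move=> i j ij; rewrite E pi0 // addr0; have [ix|ix] := eqVneq i x.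
    by rewrite t0 ?compc0 // -ix eq_sym.
  by rewrite t0' // comp0c.
- rewrite big_cons tx tx' (ip0 x xs).1 (ip0 x xs).2 comp0c compc0 !addr0 compc1 comp1c -[RHS]bip_id.
  congr (_ + _); transitivity (inj2 B \co (\sum_(i <- s) i_ i \co p_ i) \co prj2 B).
    rewrite comp_sumr comp_suml; apply: eq_big_seq => i si.
    have ix : i != x by apply: contraNneq xs => <-.
    by rewrite t0 // t0' // comp0c compc0 !add0r !compA.
  by rewrite sum_ip compc1.
move=> i; rewrite in_cons negb_or => /andP[ix si].
by rewrite t0 // t0' // (ip0 i si).1 (ip0 i si).2 !comp0c !compc0 !addr0.
Qed.

Definition nbip (A : abelian) (I : finType) (V : I -> A) : nbiproduct V :=
  sval (cid (nbip_exists V)).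

Section NbiproductExt.
Context {A : preadditive} {I : finType} {V : I -> A} (B : nbiproduct V).

Lemma nbip_ext_in T (f g : hom B T) : (forall i, f \co nin B i = g \co nin B i) -> f = g.
Proof.
move=> e; rewrite -[f]compc1 -[g]compc1 -(nbip_id B) !comp_sumr.
by apply: eq_bigr => i _; rewrite !compA e.
Qed.

Lemma nbip_ext_out T (f g : hom T B) : (forall i, npr B i \co f = npr B i \co g) -> f = g.
Proof.
move=> e; rewrite -[f]comp1c -[g]comp1c -(nbip_id B) !comp_suml.
by apply: eq_bigr => i _; rewrite -!compA e.
Qed.

End NbiproductExt.

Section Matrix.
Context {A : preadditive} {I J : finType} {V : I -> A} {W : J -> A}.
Implicit Types (B : nbiproduct V) (C : nbiproduct W).

Definition mx B C (m : forall i j, hom (V i) (W j)) : hom B C :=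
  \sum_i \sum_j nin C j \co m i j \co npr B i.

Lemma mx_pr B C m j : npr C j \co mx B C m = \sum_i m i j \co npr B i.
Proof.
rewrite /mx comp_sumr; apply: eq_bigr => i _; rewrite comp_sumr (bigD1 j) //=.
rewrite big1 ?addr0 => [|k kj]; first by rewrite !compA npr_in comp1c.
by rewrite !compA npr_in0 ?comp0c // eq_sym.
Qed.

Lemma mxE B C m i j : npr C j \co mx B C m \co nin B i = m i j.
Proof.
rewrite mx_pr comp_suml (bigD1 i) //= big1 ?addr0 => [|k ki].
  by rewrite -compA npr_in compc1.
by rewrite -compA npr_in0 // compc0.
Qed.

Lemma mx_ext B C (f g : hom B C) :
  (forall i j, npr C j \co f \co nin B i = npr C j \co g \co nin B i) -> f = g.
Proof. by move=> e; apply: nbip_ext_in => i; apply: nbip_ext_out => j; rewrite !compA. Qed.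

End Matrix.

Lemma mx_comp (A : preadditive) (I J L : finType) (V : I -> A) (W : J -> A) (U : L -> A)
    (B : nbiproduct V) (C : nbiproduct W) (D : nbiproduct U) m m' :
  mx C D m' \co mx B C m = mx B D (fun i l => \sum_j m' j l \co m i j).
Proof.
apply: mx_ext => i l; rewrite mxE compA mx_pr comp_suml comp_suml.
by apply: eq_bigr => j _; rewrite -!compA (compA (npr C j)) mxE.
Qed.

Section Diagonal.
Context {A : preadditive} {I : finType}.

Definition dg (V W : I -> A) (B : nbiproduct V) (C : nbiproduct W)
    (f : forall i, hom (V i) (W i)) : hom B C :=
  \sum_i nin C i \co f i \co npr B i.

Lemma dg_in (V W : I -> A) (B : nbiproduct V) (C : nbiproduct W) f i :
  dg B C f \co nin B i = nin C i \co f i.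
Proof.
rewrite /dg comp_suml (bigD1 i) //= big1 ?addr0 => [|k ki].
  by rewrite -compA npr_in compc1.
by rewrite -compA npr_in0 ?compc0.
Qed.

Lemma dg_pr (V W : I -> A) (B : nbiproduct V) (C : nbiproduct W) f i :
  npr C i \co dg B C f = f i \co npr B i.
Proof.
rewrite /dg comp_sumr (bigD1 i) //= big1 ?addr0 => [|k ki].
  by rewrite !compA npr_in comp1c.
by rewrite !compA npr_in0 ?comp0c // eq_sym.
Qed.

Lemma dg_comp (V W U : I -> A) (B : nbiproduct V) (C : nbiproduct W) (D : nbiproduct U) g f :
  dg C D g \co dg B C f = dg B D (fun i => g i \co f i).
Proof. by apply: nbip_ext_in => i; rewrite -compA !dg_in compA dg_in compA. Qed.

Lemma dg1 (V : I -> A) (B : nbiproduct V) : dg B B (fun i => idc _) = idc _.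
Proof. by apply: nbip_ext_in => i; rewrite dg_in compc1 comp1c. Qed.

Lemma dgD (V W : I -> A) (B : nbiproduct V) (C : nbiproduct W) f g :
  dg B C (fun i => f i + g i) = dg B C f + dg B C g.
Proof. by apply: nbip_ext_in => i; rewrite compDl !dg_in compDr. Qed.

End Diagonal.

Section DiagonalExact.
Context {A : abelian} {I : finType}.
Variables (V W U : I -> A) (B : nbiproduct V) (C : nbiproduct W) (D : nbiproduct U).

Lemma dg_epi f : (forall i, is_epi (f i)) -> is_epi (dg B C f).
Proof.
move=> ef; apply: is_epi0 => T g gf; apply: nbip_ext_in => i; rewrite comp0c.
apply: (epi0 (ef i)); have := congr1 (fun h => h \co nin B i) gf.
by rewrite -!compA dg_in comp0c.
Qed.

Lemma dg_kernel (b : forall i, hom (W i) (U i)) (k : forall i, hom (V i) (W i)) :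
  (forall i, is_kernel (b i) (k i)) -> is_kernel (dg C D b) (dg B C k).
Proof.
move=> kP; split.
  apply: nbip_ext_in => i; rewrite -compA !dg_in compA dg_in.
  by rewrite -compA (kP i).1 compc0 comp0c.
move=> T t bt; have bti i : b i \co (npr C i \co t) = 0.
  by rewrite compA -(dg_pr C D) -compA bt compc0.
pose u i := sval (cid ((kP i).2 _ _ (bti i))).
have uE i : k i \co u i = npr C i \co t by rewrite /u; case: cid => v [].
have e : dg B C k \co (\sum_i nin B i \co u i) = t.
  rewrite comp_sumr -[RHS]comp1c -(nbip_id C) comp_suml; apply: eq_bigr => i _.
  by rewrite compA dg_in -!compA uE.
exists (\sum_i nin B i \co u i); split=> // v kv.
apply: nbip_ext_out => i; apply: (kernel_mono (kP i)).
by rewrite !compA -(dg_pr B C) -!compA e kv.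
Qed.

End DiagonalExact.

Lemma dg_exact (A : abelian) (I : finType) (V W U : I -> A)
    (B : nbiproduct V) (C : nbiproduct W) (D : nbiproduct U) a b :
  (forall i, exact (a i) (b i)) -> exact (dg B C a) (dg C D b).
Proof.
move=> ex; have ba i := (ex i).1.
apply: (exact_factor (k := dg (nbip _) C (fun i => ker_map (ker (b i))))
  (p := dg B _ (fun i => ker_lift (ker (b i)) (ba i)))).
- by apply: dg_kernel => i; apply: ker_mapP.
- by apply: dg_epi => i; apply/exactP.
by rewrite dg_comp; congr dg; apply: functional_extensionality_dep => i; rewrite ker_liftK.
Qed.

(** * Exactness of diagrams, point by point *)

Section Pointwise.
Variables (C : category) (A : abelian).
Local Notation FA := (functor_abelian C A).

Lemma epi_of_pointwise (F G : FA) (f : hom F G) :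
  (forall X, is_epi ((f : nat_trans _ _) X)) -> is_epi f.
Proof.
move=> ef T g h e; apply: nat_transP => X; apply: (ef X).
by have := congr1 (fun t : nat_trans _ _ => t X) e.
Qed.

(** Kernels of diagrams are pointwise by construction, so [exactP] reduces the claim to epimorphisms
    of diagrams, which are pointwise as well. *)
Lemma exact_pointwise (F G H : FA) (a : hom F G) (b : hom G H) :
  exact a b <-> forall X, exact ((a : nat_trans _ _) X) ((b : nat_trans _ _) X).
Proof.
have E (ba : b \co a = 0) X (baX : (b : nat_trans _ _) X \co (a : nat_trans _ _) X = 0) :
    (ker_lift (ker b) ba : nat_trans _ _) X = ker_lift (ker ((b : nat_trans _ _) X)) baX.
  apply: ker_inj; rewrite ker_liftK.
  have := congr1 (fun t : nat_trans _ _ => t X) (ker_liftK (ker b) ba).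
  by [].
have Z (e : b \co a = 0) X : (b : nat_trans _ _) X \co (a : nat_trans _ _) X = 0.
  by have := congr1 (fun t : nat_trans _ _ => t X) e.
split=> [ex X|ex].
  have ba := ex.1; apply/(exactP (Z ba X)); rewrite -(E ba).
  exact: (epi_pointwise (X := X) ((exactP ba).1 ex)).
have ba : b \co a = 0 by apply: nat_transP => X; exact: (ex X).1.
apply/(exactP ba)/epi_of_pointwise => X; rewrite (E ba X (Z ba X)).
exact/exactP.
Qed.

Lemma short_exact_pointwise (X Y Z W : FA) (a : hom X Y) (b : hom X Z)
    (c : hom Y W) (d : hom Z W) :
  (forall p, short_exact ((a : nat_trans _ _) p) ((b : nat_trans _ _) p)
    ((c : nat_trans _ _) p) ((d : nat_trans _ _) p)) -> short_exact a b c d.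
Proof.
move=> ex; split.
  by apply: pointwise_kernel => p; apply: (ex p).1.
by apply: epi_of_pointwise => p; apply: (ex p).2.
Qed.

End Pointwise.

Section ShortExactCases.
Context {A : abelian} {X Y Z W : A}.
Variables (a : hom X Y) (b : hom X Z) (c : hom Y W) (d : hom Z W).
Hypothesis square : c \co a + d \co b = 0.

(** The shape at a point of [X]: an element [(u, v)] killed by [(c, d)] is determined by [v] since
    [c] is invertible, and [v] is arbitrary and comes from [X] through [b]. *)
Lemma short_exact_iso : is_iso c -> is_iso b -> short_exact a b c d.
Proof.
move=> [c' [c'c cc']] [b' [b'b bb']]; split; last first.
  apply: (is_epi_compr (f := inj1 (bip Y Z))).
  rewrite compDl -!compA !bipE compc0 addr0 compc1.
  by apply: is_iso_epi; exists c'.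
split; first by rewrite compDl !compDr -!compA !bipE !compc0 addr0 add0r.
move=> T t; rewrite (bip_split t); move: (prj1 _ \co t) (prj2 _ \co t) => u v.
rewrite compDl !compDr -!compA !bipE !compc0 addr0 add0r => cd.
exists (b' \co v); split=> [|w].
  rewrite compDl -!compA (compA b) bb' comp1c; congr (_ \co _ + _).
  have : c \co (a \co (b' \co v)) = c \co u.
    apply/eqP; rewrite -subr_eq0; apply/eqP.
    have /eqP := congr1 (fun f => f \co (b' \co v)) square.
    rewrite comp0c compDl -!compA (compA b) bb' comp1c addr_eq0 => /eqP ->.
    by rewrite -opprD addrC cd oppr0.
  by move=> e; rewrite -[LHS]comp1c -[RHS]comp1c -c'c -!compA e.
rewrite compDl -!compA => /bip_eq[_ <-].
by rewrite compA b'b comp1c.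
Qed.

(** The shape of the first sequence at a point of [Y], where only [Id -> G1 F0] survives. *)
Lemma short_exact_left : idc Z = 0 -> idc W = 0 -> is_iso a -> short_exact a b c d.
Proof.
move=> Z0 W0 [a' [a'a aa']].
have W00 T (f : hom T W) : f = 0 by rewrite -[f]comp1c W0 comp0c.
have W01 T (f : hom W T) : f = 0 by rewrite -[f]compc1 W0 compc0.
have Z00 T (f : hom T Z) : f = 0 by rewrite -[f]comp1c Z0 comp0c.
split; last by apply: is_epi0 => T g _; apply: W01.
split=> [|T t _]; first exact: W00.
rewrite (bip_split t) [prj2 _ \co t]Z00; move: (prj1 _ \co t) => u.
exists (a' \co u); rewrite [b]Z00 compc0 addr0.
split=> [|w]; first by rewrite compc0 addr0 -compA (compA a) aa' comp1c.
rewrite -compA -[X in X + _]addr0 => e.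
have := congr1 (comp (prj1 (bip Y Z))) e; rewrite !compDr !bipE.
by rewrite !compc0 !addr0 => <-; rewrite compA a'a comp1c.
Qed.

(** The shape of the second sequence at a point of [Y], where only [F0 G1 -> Id] survives. *)
Lemma short_exact_right : idc X = 0 -> idc Y = 0 -> is_iso d -> short_exact a b c d.
Proof.
move=> X0 Y0 dI.
have Y00 T (f : hom T Y) : f = 0 by rewrite -[f]comp1c Y0 comp0c.
have X01 T (f : hom X T) : f = 0 by rewrite -[f]compc1 X0 compc0.
split; last first.
  apply: (is_epi_compr (f := inj2 (bip Y Z))).
  by rewrite compDl -!compA !bipE compc0 add0r compc1; apply: is_iso_epi.
split=> [|T t]; first by rewrite [X in _ \co X]X01 compc0.
rewrite (bip_split t) [prj1 _ \co t]Y00; move: (prj2 _ \co t) => v.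
rewrite compDl !compDr -!compA !bipE !compc0 addr0 !add0r => /(mono0 (is_iso_mono dI)) ->.
exists 0; split=> [|w _]; first by rewrite [LHS]compc0 compc0.
by rewrite -[w]comp1c X0 comp0c.
Qed.

End ShortExactCases.

Section Entries.
Variables (A : abelian) (d : Order.disp_t) (Q : porderType d).
Implicit Types K L : functor (poset_cat Q) A.

(** Extension by zero to incomparable pairs makes structure maps available as entries of matrices
    over arbitrary index families. *)
Definition ent K (q q' : Q) : hom (K q) (K q') :=
  if pselect (is_true (q <= q')%O) is left h then fmap K (h : @hom (poset_cat Q) q q') else 0.

Lemma entT K q q' (h : @hom (poset_cat Q) q q') : ent K q q' = fmap K h.
Proof. by rewrite /ent; case: pselect => // h'; congr fmap; apply: bool_irrelevance. Qed.

Lemma entF K q q' : ~~ (q <= q')%O -> ent K q q' = 0.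
Proof. by rewrite /ent; case: pselect => //= + /negP. Qed.

Lemma ent1 K q : ent K q q = idc _.
Proof. by rewrite (entT K (idc (q : poset_cat Q))) fmap1. Qed.

Lemma ent_comp K q q' q'' : (q <= q')%O -> (q' <= q'')%O ->
  ent K q' q'' \co ent K q q' = ent K q q''.
Proof.
move=> h h'; rewrite (entT K (h : @hom (poset_cat Q) _ _)).
rewrite (entT K (h' : @hom (poset_cat Q) _ _)) -fmapM.
by rewrite (entT K ((h' : @hom (poset_cat Q) _ _) \co (h : @hom (poset_cat Q) _ _))).
Qed.

Lemma ent_nat K L (f : nat_trans K L) q q' : f q' \co ent K q q' = ent L q q' \co f q.
Proof. by rewrite /ent; case: pselect => h; rewrite ?naturality // compc0 comp0c. Qed.

Definition mat K (I J : finType) (i_ : I -> Q) (j_ : J -> Q)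
    (B : nbiproduct (fun i => K (i_ i))) (C : nbiproduct (fun j => K (j_ j))) : hom B C :=
  mx B C (fun i j => ent K (i_ i) (j_ j)).

End Entries.

(* Matrices of structure maps from the family i_ to j_ to l_ multiply to the
   matrix from i_ to l_ when each comparable pair (i, l) has exactly one j in
   between; all other summands of the product vanish. *)
Definition interpolates (T : Type) (le : rel T) (I J L : Type)
    (i_ : I -> T) (j_ : J -> T) (l_ : L -> T) : Prop :=
  forall i l, le (i_ i) (l_ l) -> exists j, [/\ le (i_ i) (j_ j), le (j_ j) (l_ l)
    & forall k, le (i_ i) (j_ k) -> le (j_ k) (l_ l) -> k = j].

Section MatrixFunctor.
Variables (A : abelian) (d d' : Order.disp_t) (Q : porderType d) (P : porderType d').
Implicit Types K L : functor (poset_cat Q) A.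
Local Notation leQ := (fun q q' : Q => (q <= q')%O).

Lemma mat_comp K (I J L : finType) (i_ : I -> Q) (j_ : J -> Q) (l_ : L -> Q)
    (B : nbiproduct (fun i => fobj K (i_ i))) (C : nbiproduct (fun j => fobj K (j_ j)))
    (D : nbiproduct (fun l => fobj K (l_ l))) : interpolates leQ i_ j_ l_ ->
  mat C D \co mat B C = @mat A d Q K _ _ _ _ B D.
Proof.
move=> int; rewrite mx_comp; congr mx.
apply: functional_extensionality_dep => i; apply: functional_extensionality_dep => l.
have [/int[j [ij jl ju]]|il] := boolP (i_ i <= l_ l)%O; last first.
  rewrite (entF K il) big1 // => j _.
  have [ij|ij] := boolP (i_ i <= j_ j)%O; last by rewrite (entF K ij) compc0.
  rewrite [ent K (j_ j) _]entF ?comp0c //; apply: contra il; exact: le_trans.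
rewrite (bigD1 j) //= big1 ?addr0 ?ent_comp // => k kj.
have [ik|ik] := boolP (i_ i <= j_ k)%O; last by rewrite (entF K ik) compc0.
rewrite [ent K (j_ k) _]entF ?comp0c //; apply: contraNN kj => kl.
exact/eqP/ju.
Qed.

Lemma mat1 K (I : finType) (i_ : I -> Q) (B : nbiproduct (fun i => fobj K (i_ i))) :
  (forall i j, (i_ i <= i_ j)%O -> i = j) -> @mat A d Q K _ _ _ _ B B = idc B.
Proof.
move=> anti; rewrite -dg1; apply: mx_ext => i j; rewrite mxE dg_pr comp1c.
have [<-|ij] := eqVneq i j; first by rewrite npr_in ent1.
rewrite npr_in0 1?eq_sym // entF //; apply: contraNN ij => /anti ->.
by [].
Qed.

Lemma mat_unit K (q q' : Q) (h : @hom (poset_cat Q) q q') :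
  mat (nbip_unit (fun _ => K q)) (nbip_unit (fun _ => K q')) = @fmap (poset_cat Q) A K _ _ h.
Proof.
apply: (mx_ext (B := nbip_unit _) (C := nbip_unit _)) => [[] []].
by rewrite mxE /= comp1c compc1 (entT _ h).
Qed.

Lemma mat_dg K L (f : nat_trans K L) (I J : finType) (i_ : I -> Q) (j_ : J -> Q)
    (B : nbiproduct (fun i => fobj K (i_ i))) (C : nbiproduct (fun j => fobj K (j_ j)))
    (B' : nbiproduct (fun i => fobj L (i_ i))) (C' : nbiproduct (fun j => fobj L (j_ j))) :
  dg C C' (fun j => f (j_ j)) \co mat B C =
  mat B' C' \co dg B B' (fun i => f (i_ i)) :> @hom A _ _.
Proof.
apply: mx_ext => i j; transitivity (f (j_ j) \co ent K (i_ i) (j_ j)).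
  by rewrite compA dg_pr -!compA (compA (npr C j)) mxE.
by rewrite -!compA dg_in (compA (mat _ _)) (compA (npr _ _)) (compA (npr _ _)) mxE ent_nat.
Qed.

Section Functor.
Variables (idx : P -> finType) (iota : forall p, idx p -> Q).
Variable (bp : forall (V : Q -> A) p, nbiproduct (fun i : idx p => V (iota i))).
Hypothesis anti : forall p (i j : idx p), (iota i <= iota j)%O -> i = j.
Hypothesis inter : forall p q r, (p <= q)%O -> (q <= r)%O ->
  interpolates leQ (@iota p) (@iota q) (@iota r).

Program Definition mfun_obj K : functor (poset_cat P) A :=
  @Functor (poset_cat P) A (fun p => bp K p)
    (fun p q _ => mat (bp K p) (bp K q)) _ _.
Next Obligation. by move=> K p; apply/mat1/anti. Qed.
Next Obligation. by move=> K p q r h g; rewrite mat_comp //; apply: inter. Qed.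

Program Definition mfun_map K L (f : nat_trans K L) : nat_trans (mfun_obj K) (mfun_obj L) :=
  @NatTrans _ _ (mfun_obj K) (mfun_obj L)
    (fun p => dg (bp K p) (bp L p) (fun i => f (iota i))) _.
Next Obligation. by move=> K L f p q h; apply: mat_dg. Qed.

Program Definition mfun_functor : functor (diagrams A Q) (diagrams A P) :=
  @Functor (diagrams A Q) (diagrams A P) mfun_obj mfun_map _ _.
Next Obligation. by move=> K; apply: nat_transP => p; apply: dg1. Qed.
Next Obligation. by move=> K L M g f; apply: nat_transP => p; rewrite /= dg_comp. Qed.

Program Definition mfun : additive_functor (diagrams A Q) (diagrams A P) :=
  @AdditiveFunctor (diagrams A Q) (diagrams A P) mfun_functor _.
Next Obligation. by move=> K L f g; apply: nat_transP => p; apply: dgD. Qed.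

Lemma mfun_exact : preserves_exact mfun.
Proof.
move=> K L M a b /exact_pointwise ex; apply/exact_pointwise => p.
by apply: dg_exact => i; apply: ex.
Qed.

End Functor.

Section Natural.
Variables (idx idx' : P -> finType).
Variables (iota : forall p, idx p -> Q) (iota' : forall p, idx' p -> Q).
Variable (bp : forall (V : Q -> A) p, nbiproduct (fun i : idx p => V (iota i))).
Variable (bp' : forall (V : Q -> A) p, nbiproduct (fun i : idx' p => V (iota' i))).
Hypothesis anti : forall p (i j : idx p), (iota i <= iota j)%O -> i = j.
Hypothesis inter : forall p q r, (p <= q)%O -> (q <= r)%O ->
  interpolates leQ (@iota p) (@iota q) (@iota r).
Hypothesis anti' : forall p (i j : idx' p), (iota' i <= iota' j)%O -> i = j.
Hypothesis inter' : forall p q r, (p <= q)%O -> (q <= r)%O ->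
  interpolates leQ (@iota' p) (@iota' q) (@iota' r).
Hypothesis left : forall p q, (p <= q)%O -> interpolates leQ (@iota p) (@iota q) (@iota' q).
Hypothesis right : forall p q, (p <= q)%O -> interpolates leQ (@iota p) (@iota' p) (@iota' q).

(** Both ways around the naturality square equal the single matrix from [iota p] to [iota' q];
    [left] and [right] are the interpolation conditions at its two intermediate corners. *)
Program Definition mnat_obj K :
    nat_trans (mfun_obj bp anti inter K) (mfun_obj bp' anti' inter' K) :=
  @NatTrans _ _ (mfun_obj bp anti inter K) (mfun_obj bp' anti' inter' K)
    (fun p => mat (bp K p) (bp' K p)) _.
Next Obligation.
move=> K p q h; rewrite mat_comp; last exact: left.
by rewrite [RHS]mat_comp //; apply: right.
Qed.

Program Definition mnat : nat_trans (mfun bp anti inter) (mfun bp' anti' inter') :=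
  @NatTrans _ _ (mfun bp anti inter) (mfun bp' anti' inter') mnat_obj _.
Next Obligation.
move=> K L f; apply: nat_transP => p; apply/esym.
exact: mat_dg.
Qed.

End Natural.
End MatrixFunctor.

(** * The two gluings *)

Section Gluing.
Variables (dX dY : Order.disp_t) (X : finPOrderType dX) (Y : finPOrderType dY).
Variable Yx : X -> {set Y}.
Hypothesis Yx_disjoint : forall (x : X) (y y' : Y),
  y \in Yx x -> y' \in Yx x -> y <> y' ->
  upset y :&: upset y' = set0 /\ downset y :&: downset y' = set0.
Hypothesis Yx_iso : forall x x' : X, (x <= x')%O ->
  exists phi : {y : Y | y \in Yx x} -> {y : Y | y \in Yx x'},
    [/\ bijective phi,
        forall y1 y2, (val (phi y1) <= val (phi y2))%O = (val y1 <= val y2)%O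
      & forall y, (val y <= val (phi y))%O].

Lemma Yx_above x y : forall z w, z \in Yx x -> w \in Yx x ->
  (z <= y)%O -> (w <= y)%O -> z = w.
Proof.
move=> z w zx wx zy wy; have [//|/eqP/(Yx_disjoint zx wx)[/setP/(_ y) e _]] := eqVneq z w.
by move: e; rewrite !inE zy wy.
Qed.

Lemma Yx_below x y : forall z w, z \in Yx x -> w \in Yx x ->
  (y <= z)%O -> (y <= w)%O -> z = w.
Proof.
move=> z w zx wx zy wy; have [//|/eqP/(Yx_disjoint zx wx)[_ /setP/(_ y) e]] := eqVneq z w.
by move: e; rewrite !inE zy wy.
Qed.

Lemma Yx_up x x' z : (x <= x')%O -> z \in Yx x -> exists2 z', z' \in Yx x' & (z <= z')%O.
Proof.
move=> /Yx_iso[phi [_ _ phi_le]] zx; exists (val (phi (exist _ z zx))); first exact: valP.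
exact: (phi_le (exist _ z zx)).
Qed.

Lemma Yx_down x x' z' : (x <= x')%O -> z' \in Yx x' -> exists2 z, z \in Yx x & (z <= z')%O.
Proof.
move=> /Yx_iso[phi [[psi _ psiK] _ phi_le]] zx; exists (val (psi (exist _ z' zx))).
  exact: valP.
by have := phi_le (psi (exist _ z' zx)); rewrite psiK.
Qed.

Lemma le_plusP x y : reflect (exists2 z, z \in Yx x & (z <= y)%O) (le_plus Yx (inl x) (inr y)).
Proof. exact: exists_inP. Qed.

Lemma le_minusP y x : reflect (exists2 z, z \in Yx x & (y <= z)%O) (le_minus Yx (inr y) (inl x)).
Proof. exact: exists_inP. Qed.

(** Transitivity across the two parts is where the bijections enter: an element of [Yx x'] is
    carried down to [Yx x] here, and up from [Yx x] to [Yx x'] for [le_minus]. *)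
Lemma le_plus_po : is_partial_order (le_plus Yx).
Proof.
split.
- by case=> ? /=.
- by case=> x [] y //= => [/le_anti->|/andP[_]//|/le_anti->].
move=> [x2|y2] [x1|y1] [x3|y3] //=; try exact: le_trans.
- move=> h /le_plusP[z zx zy]; have [w wx wz] := Yx_down h zx.
  by apply/le_plusP; exists w => //; apply: le_trans zy.
- move=> /le_plusP[z zx zy] h; apply/le_plusP; exists z => //.
  exact: le_trans h.
Qed.

Lemma le_minus_po : is_partial_order (le_minus Yx).
Proof.
split.
- by case=> ? /=.
- by case=> x [] y //= => [/le_anti->|/andP[]//|/le_anti->].
move=> [x2|y2] [x1|y1] [x3|y3] //=; try exact: le_trans.
- move=> /le_minusP[z zx zy] h; have [w wx wz] := Yx_up h zx.
  by apply/le_minusP; exists w => //; apply: le_trans wz.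
- move=> h /le_minusP[z zx zy]; apply/le_minusP; exists z => //.
  exact: le_trans zy.
Qed.

(** The boolean treats both orders at once, so that one construction yields the functors in both
    directions. *)
Definition glue (b : bool) : rel (X + Y) := if b then le_plus Yx else le_minus Yx.

Lemma glue_po b : is_partial_order (glue b).
Proof. by case: b; [exact: le_plus_po|exact: le_minus_po]. Qed.

Lemma glueX b x x' : glue b (inl x) (inl x') = (x <= x')%O.
Proof. by case: b. Qed.

Lemma glueY b y y' : glue b (inr y) (inr y') = (y <= y')%O.
Proof. by case: b. Qed.

(* sum_idx and sum_val encode x |-> Yx x, y |-> {y}; ext_idx and ext_val encode
   x |-> {x}, y |-> the empty family. *)
Definition sum_idx (p : X + Y) : finType :=
  match p with inl x => {y : Y | y \in Yx x} | inr _ => unit end.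
Definition sum_val (p : X + Y) : sum_idx p -> X + Y :=
  match p with inl x => fun z => inr (val z) | inr y => fun _ => inr y end.
Definition ext_idx (p : X + Y) : finType := match p with inl _ => unit | inr _ => void end.
Definition ext_val (p : X + Y) : ext_idx p -> X + Y := fun _ => p.
Definition self_val (p : X + Y) : unit -> X + Y := fun _ => p.

Lemma sum_anti b p (i j : sum_idx p) : glue b (sum_val i) (sum_val j) -> i = j.
Proof.
case: p i j => [x|y] i j /=; last by case: i j => [] [].
by rewrite glueY => ij; apply/val_inj/(Yx_below (valP i) (valP j) (lexx _) ij).
Qed.

Lemma ext_anti b p (i j : ext_idx p) : glue b (ext_val i) (ext_val j) -> i = j.
Proof. by case: p i j => [x|y] [] []. Qed.

(** This is the functoriality of the sum; [b] orders the source diagrams and [b'] the resulting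
    ones. [Yx_up] or [Yx_down] carries an index along the chain, disjointness identifies its end
    with the given outer index, and disjointness again makes the middle index unique. *)
Lemma sum_interp b b' p q r : glue b' p q -> glue b' q r ->
  interpolates (glue b) (@sum_val p) (@sum_val q) (@sum_val r).
Proof.
move=> pq qr i l.
case: p pq i => [x|y] pq i; case: q pq qr => [x'|y'] pq qr; case: r qr l => [x''|y''] qr l;
  rewrite /= glueY => il.
- rewrite !glueX in pq qr.
  have [z zx iz] := Yx_up pq (valP i); have [w wx zw] := Yx_up qr zx.
  have wE := Yx_below wx (valP l) (le_trans iz zw) il; rewrite wE in zw.
  exists (exist _ z zx); rewrite !glueY; split=> // k; rewrite !glueY => ik _.
  exact/val_inj/(Yx_below (valP k) zx ik iz).
- rewrite glueX in pq; case: b' qr {pq} (pq) => //= /le_plusP[z zx zy] pq.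
  have [w wx wz] := Yx_down pq zx; have wE := Yx_above wx (valP i) (le_trans wz zy) il.
  rewrite wE in wz; exists (exist _ z zx); rewrite !glueY; split=> // k; rewrite !glueY => _ ky.
  exact/val_inj/(Yx_above (valP k) zx ky zy).
(* A chain from [X] to [Y] and back to [X] would need relations of both gluings at once. *)
- by case: b' pq qr.
- rewrite glueY in qr; case: b' pq => //= /le_plusP[z zx zy].
  have zE := Yx_above zx (valP i) (le_trans zy qr) il; rewrite zE in zy.
  by exists tt; rewrite !glueY; split=> // [] [].
- rewrite glueX in qr; case: b' pq => //= /le_minusP[z zx yz].
  have [w wx zw] := Yx_up qr zx; have wE := Yx_below wx (valP l) (le_trans yz zw) il.
  rewrite wE in zw; exists (exist _ z zx); rewrite !glueY; split=> // k; rewrite !glueY => yk _.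
  exact/val_inj/(Yx_below (valP k) zx yk yz).
- by case: b' pq qr.
- rewrite glueY in pq; case: b' qr => //= /le_minusP[z zx yz].
  have zE := Yx_below zx (valP l) (le_trans pq yz) il; rewrite zE in yz.
  by exists tt; rewrite !glueY; split=> // [] [].
- rewrite !glueY in pq qr; by exists tt; rewrite !glueY; split=> // [] [].
Qed.

(** In either gluing, anything between two elements of [X] lies in [X], which makes extension by
    zero functorial. *)
Lemma ext_interp b b' p q r : glue b' p q -> glue b' q r ->
  interpolates (glue b) (@ext_val p) (@ext_val q) (@ext_val r).
Proof.
case: p => [x|y]; last by move=> _ _ [].
case: r => [x''|y'']; last by move=> _ _ _ [].
case: q => [x'|y']; last by case: b'.
rewrite !glueX => xx' xx'' i l _; exists tt; rewrite /ext_val !glueX; split=> //.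
by case.
Qed.

(** In these conditions the suffix names the side of a naturality square: [_r] passes through the
    target family at [p], [_l] through the source family at [q]. The pair [p], [q] is compared in
    the order of the resulting diagrams, the interpolation takes place in that of the original
    ones. *)
Lemma ext_to_sum_interp_r p q : glue false p q ->
  interpolates (glue true) (@ext_val p) (@sum_val p) (@sum_val q).
Proof.
case: p => [x|y]; last by move=> _ [].
case: q => [x'|y'] //= xx' i l /= /le_plusP[z zx zl]; have [w wx wz] := Yx_down xx' (valP l).
exists (exist _ w wx); split=> //=; first by apply/le_plusP; exists w.
by move=> k _ kl; apply/val_inj/(Yx_above (valP k) wx kl wz).
Qed.

Lemma ext_to_sum_interp_l p q : glue false p q ->
  interpolates (glue true) (@ext_val p) (@ext_val q) (@sum_val q).
Proof.
case: p => [x|y]; last by move=> _ [].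
case: q => [x'|y'] //= xx' i l _; exists tt; split=> //= [|[]//].
by apply/le_plusP; exists (val l); first exact: valP.
Qed.

Lemma sum_to_ext_interp_r p q : glue true p q ->
  interpolates (glue false) (@sum_val p) (@ext_val p) (@ext_val q).
Proof.
case: q => [x'|y']; last by move=> _ ? [].
case: p => [x|y] //= xx' i l _; exists tt; split=> //= [|[]//].
by apply/le_minusP; exists (val i); first exact: valP.
Qed.

Lemma sum_to_ext_interp_l p q : glue true p q ->
  interpolates (glue false) (@sum_val p) (@sum_val q) (@ext_val q).
Proof.
case: q => [x'|y']; last by move=> _ ? [].
case: p => [x|y] //= xx' i l _; have [w wx wz] := Yx_up xx' (valP i).
exists (exist _ w wx); split=> //=; first by apply/le_minusP; exists w.
by move=> k ik _; apply/val_inj/(Yx_below (valP k) wx ik wz).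
Qed.

Lemma unit_sum_interp_r p q : glue true p q ->
  interpolates (glue true) (self_val p) (@sum_val p) (@sum_val q).
Proof.
case: p q => [x|y] [x'|y'] //= xx' i l; last by exists tt; split=> //= [] [].
  move=> _; have [w wx wz] := Yx_down xx' (valP l).
  exists (exist _ w wx); split=> //=; first by apply/le_plusP; exists w.
  by move=> k _ kl; apply/val_inj/(Yx_above (valP k) wx kl wz).
move=> /le_plusP[w wx wy]; exists (exist _ w wx); split=> //=.
  by apply/le_plusP; exists w.
by move=> k _ kl; apply/val_inj/(Yx_above (valP k) wx kl wy).
Qed.

Lemma unit_sum_interp_l p q : glue true p q ->
  interpolates (glue true) (self_val p) (self_val q) (@sum_val q).
Proof.
move=> pq i l _; exists tt; split=> // [|[]//]; case: q {pq} l => [x|y] l //=.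
by apply/le_plusP; exists (val l); first exact: valP.
Qed.

Lemma unit_ext_interp_r p q : glue true p q ->
  interpolates (glue true) (self_val p) (@ext_val p) (@ext_val q).
Proof.
case: q => [x'|y']; last by move=> _ _ [].
by case: p => [x|y] //= xx' i l _; exists tt; split=> //= [] [].
Qed.

Lemma unit_ext_interp_l p q : glue true p q ->
  interpolates (glue true) (self_val p) (self_val q) (@ext_val q).
Proof.
by move=> pq i l _; exists tt; split=> // [|[]//]; apply: (po_refl (glue_po true)).
Qed.

Lemma counit_ext_interp_r p q : glue false p q ->
  interpolates (glue false) (@ext_val p) (self_val p) (self_val q).
Proof.
by move=> pq i l _; exists tt; split=> // [|[]//]; apply: (po_refl (glue_po false)).
Qed.

Lemma counit_ext_interp_l p q : glue false p q ->
  interpolates (glue false) (@ext_val p) (@ext_val q) (self_val q).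
Proof.
case: p => [x|y]; last by move=> _ [].
by case: q => [x'|y'] //= xx' i l _; exists tt; split=> //= [] [].
Qed.

Lemma counit_sum_interp_r p q : glue false p q ->
  interpolates (glue false) (@sum_val p) (self_val p) (self_val q).
Proof.
move=> pq i l _; exists tt; split=> // [|[]//]; case: p {pq} i => [x|y] i //=.
by apply/le_minusP; exists (val i); first exact: valP.
Qed.

Lemma counit_sum_interp_l p q : glue false p q ->
  interpolates (glue false) (@sum_val p) (@sum_val q) (self_val q).
Proof.
case: p q => [x|y] [x'|y'] //= xx' i l; last by exists tt; split=> //= [] [].
  move=> _; have [w wx wz] := Yx_up xx' (valP i).
  exists (exist _ w wx); split=> //=; first by apply/le_minusP; exists w.
  by move=> k kl _; apply/val_inj/(Yx_below (valP k) wx kl wz).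
move=> /le_minusP[w wx wy]; exists (exist _ w wx); split=> //=.
  by apply/le_minusP; exists w.
by move=> k kl _; apply/val_inj/(Yx_below (valP k) wx kl wy).
Qed.

(** * The four functors, and the units and counits of their composites *)

Definition gpos (b : bool) := poset_of (glue_po b).

Variable A : abelian.
Local Notation D b := (diagrams A (gpos b)).

Definition sum_bip (V : X + Y -> A) p : nbiproduct (fun i : sum_idx p => V (sum_val i)) :=
  match p return nbiproduct (fun i : sum_idx p => V (sum_val i)) with
  | inl x => nbip (fun z : {y : Y | y \in Yx x} => V (inr (val z)))
  | inr y => nbip_unit (fun _ => V (inr y))
  end.

Definition ext_bip (V : X + Y -> A) p : nbiproduct (fun i : ext_idx p => V (ext_val i)) :=
  match p return nbiproduct (fun i : ext_idx p => V (ext_val i)) with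
  | inl x => nbip_unit (fun _ => V (inl x))
  | inr y => nbip_void (fun _ => V (inr y))
  end.

Definition self_bip (V : X + Y -> A) p : nbiproduct (fun i : unit => V (self_val p i)) :=
  nbip_unit (fun _ => V p).

(** In the notation of the overview, [F1] is [extF true false], [F0] is [sumF true false], [G1] is
    [sumF false true] and [G0] is [extF false true]. *)
Definition sumF b b' : additive_functor (D b) (D b') :=
  mfun (Q := gpos b) (P := gpos b') sum_bip (@sum_anti b) (@sum_interp b b').
Definition extF b b' : additive_functor (D b) (D b') :=
  mfun (Q := gpos b) (P := gpos b') ext_bip (@ext_anti b) (@ext_interp b b').

Definition ext_to_sum : nat_trans (extF true false) (sumF true false) :=
  mnat (Q := gpos true) (P := gpos false) ext_bip sum_bip (@ext_anti true) (@ext_interp true false)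
    (@sum_anti true) (@sum_interp true false) ext_to_sum_interp_l ext_to_sum_interp_r.
Definition sum_to_ext : nat_trans (sumF false true) (extF false true) :=
  mnat (Q := gpos false) (P := gpos true) sum_bip ext_bip (@sum_anti false) (@sum_interp false true)
    (@ext_anti false) (@ext_interp false true) sum_to_ext_interp_l sum_to_ext_interp_r.

Section Entries.
Variables (b b' : bool) (K : D b).
Notation entK := (@ent A _ (gpos b) K).

(** It turns matrices over [sumF b b' K] into matrices over [K], so that the structure maps of an
    iterated functor can be computed over [K]. *)
Lemma ent_sumF y y' :
  @ent A _ (gpos b') (sumF b b' K) (inr y) (inr y') =
  entK (inr y) (inr y') :> hom (K (inr y)) (K (inr y')).
Proof.
have [h|h] := boolP (y <= y')%O; last first.
  by rewrite !entF //; rewrite /Order.le /= glueY.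
have hb c : (inr y <= inr y' :> gpos c)%O by rewrite /Order.le /= glueY.
rewrite (entT _ (hb b')) (entT _ (hb b)) /=.
exact: (mat_unit (Q := gpos b)).
Qed.

Lemma ent_extF x x' :
  @ent A _ (gpos b') (extF b b' K) (inl x) (inl x') =
  entK (inl x) (inl x') :> hom (K (inl x)) (K (inl x')).
Proof.
have [h|h] := boolP (x <= x')%O; last first.
  by rewrite !entF //; rewrite /Order.le /= glueX.
have hb c : (inl x <= inl x' :> gpos c)%O by rewrite /Order.le /= glueX.
rewrite (entT _ (hb b')) (entT _ (hb b)) /=.
exact: (mat_unit (Q := gpos b)).
Qed.

End Entries.

Lemma mx_eq (I J : finType) (V : I -> A) (W : J -> A) (B : nbiproduct V) (C : nbiproduct W) m m' :
  (forall i j, m i j = m' i j) -> mx B C m = mx B C m'.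
Proof. by move=> e; apply: mx_ext => i j; rewrite !mxE. Qed.

Lemma hom_to_zero T (f g : hom T (zero_obj A)) : f = g.
Proof. by case: (zero_objP T). Qed.

Lemma hom_from_zero T (f g : hom (zero_obj A) T) : f = g.
Proof. by case: (zero_objP T). Qed.

Lemma dg_unit (V W : unit -> A) (f : forall i, hom (V i) (W i)) :
  dg (nbip_unit V) (nbip_unit W) f = f tt.
Proof.
by apply: (nbip_ext_in (B := nbip_unit V)) => [[]]; rewrite dg_in /= comp1c compc1.
Qed.

Lemma dg_eq (I : finType) (V W : I -> A) (B : nbiproduct V) (C : nbiproduct W) f g :
  (forall i, f i = g i) -> dg B C f = dg B C g.
Proof. by move=> e; apply: nbip_ext_in => i; rewrite !dg_in e. Qed.

Local Notation FP K := (fobj K : X + Y -> A).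
Local Notation matg b K := (@mat A _ (gpos b) K _ _ _ _).
Local Notation gcat b := (poset_cat (gpos b)).

Section UnitSum.
Local Notation EE K := (sumF false true (sumF true false K)).

(* Both branches are the same expression: once p is a constructor, EE K p reduces
   to a biproduct of values of K. *)
Definition unit_sum_map (K : D true) p : hom (K p) (EE K p) :=
  match p return hom (K p) (EE K p) with
  | inl x => matg true K (self_bip (FP K) (inl x)) (sum_bip (FP K) (inl x))
  | inr y => matg true K (self_bip (FP K) (inr y)) (sum_bip (FP K) (inr y))
  end.

Lemma unit_sum_map_natural (K : D true) p q (h : @hom (gcat true) p q) :
  unit_sum_map K q \co fmap K h = fmap (EE K) h \co unit_sum_map K p.
Proof.
(* Over [K] itself the square is an identity of matrices; what remains is to recognize
   [fmap (EE K) h] as such a matrix, entry by entry. *)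
have e : matg true K (self_bip (FP K) q) (sum_bip (FP K) q) \co
      matg true K (self_bip (FP K) p) (self_bip (FP K) q) =
    matg true K (sum_bip (FP K) p) (sum_bip (FP K) q) \co
      matg true K (self_bip (FP K) p) (sum_bip (FP K) p).
  rewrite (mat_comp (Q := gpos true) _ _ _ (unit_sum_interp_l h)).
  by rewrite (mat_comp (Q := gpos true) _ _ _ (unit_sum_interp_r h)).
rewrite -(mat_unit (Q := gpos true) K h).
case: p q h e => [x|y] [x'|y'] h e //.
all: rewrite [LHS]e; congr (_ \co _); apply: mx_eq => i j; apply/esym.
all: exact: ent_sumF.
Qed.

Definition unit_sum_obj (K : D true) : nat_trans K (EE K) :=
  NatTrans (unit_sum_map K) (@unit_sum_map_natural K).

Lemma unit_sum_natural (K L : D true) (f : hom K L) :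
  (unit_sum_obj L : @hom (D true) _ _) \co f =
  fmap (sumF false true) (fmap (sumF true false) f) \co (unit_sum_obj K : @hom (D true) _ _).
Proof.
apply: nat_transP => p.
have e := mat_dg (Q := gpos true) f
  (self_bip (FP K) p) (sum_bip (FP K) p)
  (self_bip (FP L) p) (sum_bip (FP L) p).
rewrite [dg (self_bip _ _) _ _]dg_unit in e.
case: p e => [x|y] e.
all: rewrite -[LHS]e; congr (_ \co _); apply: dg_eq => i; apply/esym.
all: exact: dg_unit.
Qed.

End UnitSum.

Section UnitExt.
Local Notation EE K := (extF false true (extF true false K)).

Definition unit_ext_map (K : D true) p : hom (K p) (EE K p) :=
  match p return hom (K p) (EE K p) with
  | inl x => matg true K (self_bip (FP K) (inl x)) (ext_bip (FP K) (inl x))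
  | inr y => matg true K (self_bip (FP K) (inr y)) (ext_bip (FP K) (inr y))
  end.

Lemma unit_ext_map_natural (K : D true) p q (h : @hom (gcat true) p q) :
  unit_ext_map K q \co fmap K h = fmap (EE K) h \co unit_ext_map K p.
Proof.
have e : matg true K (self_bip (FP K) q) (ext_bip (FP K) q) \co
      matg true K (self_bip (FP K) p) (self_bip (FP K) q) =
    matg true K (ext_bip (FP K) p) (ext_bip (FP K) q) \co
      matg true K (self_bip (FP K) p) (ext_bip (FP K) p).
  rewrite (mat_comp (Q := gpos true) _ _ _ (unit_ext_interp_l h)).
  by rewrite (mat_comp (Q := gpos true) _ _ _ (unit_ext_interp_r h)).
rewrite -(mat_unit (Q := gpos true) K h).
case: p q h e => [x|y] [x'|y'] h e //.
- rewrite [LHS]e; congr (_ \co _); apply: mx_eq => i j; apply/esym.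
  exact: ent_extF.
- exact: hom_to_zero.
- exact: hom_to_zero.
Qed.

Definition unit_ext_obj (K : D true) : nat_trans K (EE K) :=
  NatTrans (unit_ext_map K) (@unit_ext_map_natural K).

Lemma unit_ext_natural (K L : D true) (f : hom K L) :
  (unit_ext_obj L : @hom (D true) _ _) \co f =
  fmap (extF false true) (fmap (extF true false) f) \co (unit_ext_obj K : @hom (D true) _ _).
Proof.
apply: nat_transP => p.
have e := mat_dg (Q := gpos true) f
  (self_bip (FP K) p) (ext_bip (FP K) p)
  (self_bip (FP L) p) (ext_bip (FP L) p).
rewrite [dg (self_bip _ _) _ _]dg_unit in e.
case: p e => [x|y] e; last exact: hom_to_zero.
rewrite -[LHS]e; congr (_ \co _); apply: dg_eq => i; apply/esym.
exact: dg_unit.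
Qed.

End UnitExt.

Section CounitExt.
Local Notation EE K := (extF true false (extF false true K)).

Definition counit_ext_map (K : D false) p : hom (EE K p) (K p) :=
  match p return hom (EE K p) (K p) with
  | inl x => matg false K (ext_bip (FP K) (inl x)) (self_bip (FP K) (inl x))
  | inr y => matg false K (ext_bip (FP K) (inr y)) (self_bip (FP K) (inr y))
  end.

Lemma counit_ext_map_natural (K : D false) p q (h : @hom (gcat false) p q) :
  counit_ext_map K q \co fmap (EE K) h = fmap K h \co counit_ext_map K p.
Proof.
have e : matg false K (ext_bip (FP K) q) (self_bip (FP K) q) \co
      matg false K (ext_bip (FP K) p) (ext_bip (FP K) q) =
    matg false K (self_bip (FP K) p) (self_bip (FP K) q) \co
      matg false K (ext_bip (FP K) p) (self_bip (FP K) p).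
  rewrite (mat_comp (Q := gpos false) _ _ _ (counit_ext_interp_l h)).
  by rewrite (mat_comp (Q := gpos false) _ _ _ (counit_ext_interp_r h)).
rewrite -(mat_unit (Q := gpos false) K h).
case: p q h e => [x|y] [x'|y'] h e //.
- rewrite -[RHS]e; congr (_ \co _); apply: mx_eq => i j.
  exact: (@ent_extF false true K x x').
- exact: hom_from_zero.
- exact: hom_from_zero.
Qed.

Definition counit_ext_obj (K : D false) : nat_trans (EE K) K :=
  NatTrans (counit_ext_map K) (@counit_ext_map_natural K).

Lemma counit_ext_natural (K L : D false) (f : hom K L) :
  (counit_ext_obj L : @hom (D false) _ _) \co fmap (extF true false) (fmap (extF false true) f) =
  f \co (counit_ext_obj K : @hom (D false) _ _).
Proof.
apply: nat_transP => p.
have e := mat_dg (Q := gpos false) f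
  (ext_bip (FP K) p) (self_bip (FP K) p)
  (ext_bip (FP L) p) (self_bip (FP L) p).
rewrite [dg (self_bip _ _) _ _]dg_unit in e.
case: p e => [x|y] e; last exact: hom_from_zero.
apply: etrans (esym e); congr (_ \co _); apply: dg_eq => i.
exact: dg_unit.
Qed.

End CounitExt.

Section CounitSum.
Local Notation EE K := (sumF true false (sumF false true K)).

Definition counit_sum_map (K : D false) p : hom (EE K p) (K p) :=
  match p return hom (EE K p) (K p) with
  | inl x => matg false K (sum_bip (FP K) (inl x)) (self_bip (FP K) (inl x))
  | inr y => matg false K (sum_bip (FP K) (inr y)) (self_bip (FP K) (inr y))
  end.

Lemma counit_sum_map_natural (K : D false) p q (h : @hom (gcat false) p q) :
  counit_sum_map K q \co fmap (EE K) h = fmap K h \co counit_sum_map K p.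
Proof.
have e : matg false K (sum_bip (FP K) q) (self_bip (FP K) q) \co
      matg false K (sum_bip (FP K) p) (sum_bip (FP K) q) =
    matg false K (self_bip (FP K) p) (self_bip (FP K) q) \co
      matg false K (sum_bip (FP K) p) (self_bip (FP K) p).
  rewrite (mat_comp (Q := gpos false) _ _ _ (counit_sum_interp_l h)).
  by rewrite (mat_comp (Q := gpos false) _ _ _ (counit_sum_interp_r h)).
rewrite -(mat_unit (Q := gpos false) K h).
case: p q h e => [x|y] [x'|y'] h e //.
all: rewrite -[RHS]e; congr (_ \co _); apply: mx_eq => i j.
all: exact: (@ent_sumF false true K).
Qed.

Definition counit_sum_obj (K : D false) : nat_trans (EE K) K :=
  NatTrans (counit_sum_map K) (@counit_sum_map_natural K).

Lemma counit_sum_natural (K L : D false) (f : hom K L) :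
  (counit_sum_obj L : @hom (D false) _ _) \co fmap (sumF true false) (fmap (sumF false true) f) =
  f \co (counit_sum_obj K : @hom (D false) _ _).
Proof.
apply: nat_transP => p.
have e := mat_dg (Q := gpos false) f
  (sum_bip (FP K) p) (self_bip (FP K) p)
  (sum_bip (FP L) p) (self_bip (FP L) p).
rewrite [dg (self_bip _ _) _ _]dg_unit in e.
case: p e => [x|y] e.
all: apply: etrans (esym e); congr (_ \co _); apply: dg_eq => i.
all: exact: dg_unit.
Qed.

End CounitSum.

Definition unit_sum_nat_trans : nat_trans (id_functor (D true))
    (comp_functor (sumF false true) (sumF true false)) :=
  @NatTrans _ _ (id_functor (D true)) (comp_functor (sumF false true) (sumF true false))
    unit_sum_obj unit_sum_natural.
Definition unit_ext_nat_trans : nat_trans (id_functor (D true))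
    (comp_functor (extF false true) (extF true false)) :=
  @NatTrans _ _ (id_functor (D true)) (comp_functor (extF false true) (extF true false))
    unit_ext_obj unit_ext_natural.
Definition counit_ext_nat_trans : nat_trans (comp_functor (extF true false) (extF false true))
    (id_functor (D false)) :=
  @NatTrans _ _ (comp_functor (extF true false) (extF false true)) (id_functor (D false))
    counit_ext_obj counit_ext_natural.
Definition counit_sum_nat_trans : nat_trans (comp_functor (sumF true false) (sumF false true))
    (id_functor (D false)) :=
  @NatTrans _ _ (comp_functor (sumF true false) (sumF false true)) (id_functor (D false))
    counit_sum_obj counit_sum_natural.

(** [sumF] only sees values at points of [Y], where [extF] is zero. *)
Lemma sumF_extF b b' (K : D b) : idc (sumF b' b (extF b b' K)) = 0.
Proof.
apply: nat_transP => [[x|y]]; last exact: hom_to_zero.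
apply: (nbip_ext_in (B := sum_bip (extF b b' K) (inl x))) => z.
exact: hom_from_zero.
Qed.

Lemma mx_unit_in (I : finType) (V : I -> A) (W : unit -> A) (B : nbiproduct V) m i :
  mx B (nbip_unit W) m \co nin B i = m i tt.
Proof. by rewrite -[LHS]comp1c compA -[idc _]/(npr (nbip_unit W) tt) mxE. Qed.

Lemma mx_unit_pr (I : finType) (V : unit -> A) (W : I -> A) (C : nbiproduct W) m i :
  npr C i \co mx (nbip_unit V) C m = m tt i.
Proof. by rewrite -[LHS]compc1 -[idc _]/(nin (nbip_unit V) tt) mxE. Qed.

(** Distinct elements of [Yx x] are incomparable, so the column of entries from [val z] to the
    members of [Yx x] has the identity at [z] and zeros elsewhere. *)
Lemma ent_sumF_in (K : D true) x (z : {y : Y | y \in Yx x}) :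
  @ent A _ (gpos false) (sumF true false K) (inr (val z)) (inl x) =
  nin (sum_bip (FP K) (inl x)) z :> hom (K (inr (val z))) (sum_bip (FP K) (inl x)).
Proof.
have h : @hom (gcat false) (inr (val z)) (inl x).
  by apply/le_minusP; exists (val z); first exact: valP.
rewrite (entT _ h); apply: nbip_ext_out => w; rewrite [LHS]mx_unit_pr.
have [<-|zw] := eqVneq z w.
  by rewrite [RHS](npr_in (sum_bip (FP K) (inl x)) z); apply: (@ent1 _ _ (gpos true)).
rewrite [RHS](@npr_in0 _ _ _ (sum_bip (FP K) (inl x))) 1?eq_sym //.
apply: (@entF _ _ (gpos true)); apply: contraNN zw => zw.
exact/eqP/(@sum_anti true (inl x)).
Qed.

Lemma ent_sumF_pr (K : D false) x (z : {y : Y | y \in Yx x}) :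
  @ent A _ (gpos true) (sumF false true K) (inl x) (inr (val z)) =
  npr (sum_bip (FP K) (inl x)) z :> hom (sum_bip (FP K) (inl x)) (K (inr (val z))).
Proof.
have h : @hom (gcat true) (inl x) (inr (val z)).
  by apply/le_plusP; exists (val z); first exact: valP.
rewrite (entT _ h); apply: nbip_ext_in => w.
rewrite [LHS](mx_unit_in (sum_bip (FP K) (inl x))).
have [<-|zw] := eqVneq z w.
  by rewrite [RHS](npr_in (sum_bip (FP K) (inl x)) z); apply: (@ent1 _ _ (gpos false)).
rewrite [RHS](@npr_in0 _ _ _ (sum_bip (FP K) (inl x))) //.
apply: (@entF _ _ (gpos false)); apply: contraNN zw => zw.
exact/eqP/esym/(@sum_anti false (inl x)).
Qed.

(** This makes [G1 F0 -> G0 F0] invertible on [X]: it is assembled from the structure maps out of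
    the summands, which are the injections. Dually, [ext_to_sum_sumF] assembles [F1 G1 -> F0 G1]
    from the projections. *)
Lemma sum_to_ext_sumF (K : D true) x :
  (sum_to_ext (sumF true false K) : nat_trans _ _) (inl x) = idc (sum_bip (FP K) (inl x)).
Proof.
apply: (nbip_ext_in (B := sum_bip (FP K) (inl x))) => z; rewrite comp1c.
by rewrite [LHS](mx_unit_in (sum_bip (sumF true false K) (inl x))); apply: ent_sumF_in.
Qed.

Lemma ext_to_sum_sumF (K : D false) x :
  (ext_to_sum (sumF false true K) : nat_trans _ _) (inl x) = idc (sum_bip (FP K) (inl x)).
Proof.
apply: (nbip_ext_out (B := sum_bip (FP K) (inl x))) => z; rewrite compc1.
by rewrite [LHS](mx_unit_pr (sum_bip (sumF false true K) (inl x))); apply: ent_sumF_pr.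
Qed.

Lemma is_iso_id (C : category) (Z : C) : is_iso (idc Z).
Proof. by exists (idc Z); rewrite comp1c. Qed.

Lemma is_iso_opp (B : preadditive) (Z W : B) (f : hom Z W) : is_iso f -> is_iso (- f).
Proof.
by move=> [g [gf fg]]; exists (- g); rewrite !compNl !compNr !opprK gf fg.
Qed.

Lemma mat_unit1 b (K : D b) p : matg b K (self_bip (FP K) p) (self_bip (FP K) p) = idc _.
Proof. by apply: (mat1 (Q := gpos b)) => [[] []]. Qed.

Lemma idc_zero : idc (zero_obj A) = 0.
Proof. exact: hom_to_zero. Qed.

(** Negating the sum unit turns a commutative square into a vanishing composite. On [X] the arrows
    [c] and [b] are identities; on [Y] the functor [extF] is zero and the sum unit is invertible. *)
Lemma plus_short_exact (K : D true) :
  short_exact (W := extF false true (sumF true false K))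
    (nt_opp unit_sum_nat_trans K) (unit_ext_nat_trans K)
    (sum_to_ext (sumF true false K)) (fmap (extF false true) (ext_to_sum K)).
Proof.
apply: short_exact_pointwise => [[x|y]]; last first.
  apply: short_exact_left.
  - exact: idc_zero.
  - exact: idc_zero.
  - apply/is_iso_opp; rewrite [X in is_iso X](mat_unit1 (b := true) K (inr y)).
    exact: is_iso_id.
have sE : (unit_ext_nat_trans K : nat_trans _ _) (inl x) = idc (K (inl x)).
  exact: (mat_unit1 (b := true) K (inl x)).
apply: short_exact_iso.
(* Once the identities are removed, the two remaining arrows are the map from [K x] to the sum of
   the [K z] and its negative. *)
- rewrite [X in X \co _ + _]sum_to_ext_sumF [X in _ + _ \co X]sE compc1 comp1c.
  rewrite [X in _ + X]dg_unit.
  by apply/eqP; rewrite addrC subr_eq0; apply/eqP.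
- by rewrite sum_to_ext_sumF; apply: is_iso_id.
- by rewrite sE; apply: is_iso_id.
Qed.

(** Here the sign sits on the arrow [F1 G1 -> F1 G0]. On [X] the [extF] counit and [F1 G1 -> F0 G1]
    are identities, and both composites to [K x] are the map from the sum of the [K z], up to that
    sign. *)
Lemma minus_short_exact (K : D false) :
  short_exact (X := extF true false (sumF false true K))
    (- fmap (extF true false) (sum_to_ext K)) (ext_to_sum (sumF false true K))
    (counit_ext_nat_trans K) (counit_sum_nat_trans K).
Proof.
apply: short_exact_pointwise => [[x|y]]; last first.
  apply: short_exact_right.
  - exact: idc_zero.
  - exact: idc_zero.
  - rewrite [X in is_iso X](mat_unit1 (b := false) K (inr y)).
    exact: is_iso_id.
have aE : (counit_ext_nat_trans K : nat_trans _ _) (inl x) = idc (K (inl x)).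
  exact: (mat_unit1 (b := false) K (inl x)).
apply: short_exact_iso.
- rewrite [X in X \co _ + _]aE [X in _ + _ \co X]ext_to_sum_sumF compc1 comp1c.
  have e := dg_unit (fun i => (sum_to_ext K : nat_trans _ _) (@ext_val (inl x) i)).
  apply/eqP; rewrite addrC subr_eq0; apply/eqP.
  by apply: etrans (esym e).
- by rewrite aE; apply: is_iso_id.
- by rewrite ext_to_sum_sumF; apply: is_iso_id.
Qed.

Lemma glue_derived_equivalence : triangulated_equivalent (derived (D true)) (derived (D false)).
Proof.
apply: (tot_triangulated_equivalence (eps := ext_to_sum) (del := sum_to_ext)
  (r := nt_opp unit_sum_nat_trans) (s := unit_ext_nat_trans)
  (a := counit_ext_nat_trans) (b := counit_sum_nat_trans)).
- by split; apply: mfun_exact.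
- by move=> K; apply: sumF_extF.
- by move=> K; apply: sumF_extF.
- exact: plus_short_exact.
- exact: minus_short_exact.
Qed.

End Gluing.

Theorem theorem1p1 (dX dY : Order.disp_t)
    (X : finPOrderType dX) (Y : finPOrderType dY) (Yx : X -> {set Y})
    (Yx_disjoint : forall (x : X) (y y' : Y),
       y \in Yx x -> y' \in Yx x -> y <> y' ->
       upset y :&: upset y' = set0 /\ downset y :&: downset y' = set0)
    (Yx_iso : forall x x' : X, (x <= x')%O ->
       exists phi : {y : Y | y \in Yx x} -> {y : Y | y \in Yx x'},
         [/\ bijective phi,
             forall y1 y2, (val (phi y1) <= val (phi y2))%O = (val y1 <= val y2)%O
           & forall y, (val y <= val (phi y))%O]) :
  exists (plus_po : is_partial_order (le_plus Yx))
         (minus_po : is_partial_order (le_minus Yx)),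
    universally_derived_equivalent (poset_of plus_po) (poset_of minus_po).
Proof.
exists (glue_po Yx_iso true), (glue_po Yx_iso false) => A.
exact: (glue_derived_equivalence Yx_disjoint Yx_iso A).
Qed.
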